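(* Let $n<d$ and let $\mathbf F:\mathbb R^d\to\mathbb R^n$ be differentiable with Jacobian $\mathbf J$. Suppose there are constants $L,L_2>0$ with $\|\mathbf J(\mathbf x)\|\le L$ and $\|\mathbf J(\mathbf x)-\mathbf J(\mathbf y)\|\le L_2\|\mathbf x-\mathbf y\|$ for all $\mathbf x,\mathbf y\in\mathbb R^d$, and a constant $\mu>0$ such that the set $\Omega_{\mathrm{under}}=\{\mathbf x:\|\mathbf F(\mathbf x)\|\le \mu^2/(2L_2)\}$ is non-empty and $\sigma_n(\mathbf J(\mathbf x))\ge\mu$ for all $\mathbf x\in\Omega_{\mathrm{under}}$. Run the RQGN algorithm (see context) with one fixed choice among Options I, II, III and with $\mathbf x_0\in\Omega_{\mathrm{under}}$ satisfying $$\lambda_{\mathrm{under}}(\mathbf x_0)\le\frac{\mu^2(1-\gamma)}{20\,\tilde c\,n\,LL_2\,\eta_0},$$ where $(\gamma,\tilde c)$ are the constants of the chosen option given in the context. Let $$q_{\mathrm{under}}=e^{11/10}\Big(\delta_0+\frac{7(1-\gamma)}{20\eta_0}\Big),$$ with $\delta_0$ given in the context. Then for all $t\ge 0$ $$\mathbb E[\eta_t-1]\le(1-\gamma)^t q_{\mathrm{under}}\qquad\text{and}\qquad \mathbb E\left[\frac{\lambda_{\mathrm{under}}(\mathbf x_{t+1})}{\lambda_{\mathrm{under}}(\mathbf x_t)}\right]\le(1-\gamma)^t q_{\mathrm{under}}.$$ Moreover, for every $p\in(0,1)$ there exists a non-negative integer $t_0=\mathcal O\big(\log(1+q_{\mathrm{under}}/(p\gamma^2))/\gamma\big)$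 such that, with probability at least $1-p$, for all $t\ge1$, $$\lambda_{\mathrm{under}}(\mathbf x_{t_0+t})\le\Big(1-\frac{\gamma}{\gamma+1}\Big)^{\frac{t(t-1)}2}\Big(\frac12\Big)^t\Big(1-\frac1{2\eta_0}\Big)^{t_0}\lambda_{\mathrm{under}}(\mathbf x_0).$$
   Context: Notation: $\|\cdot\|$ is the Euclidean norm of vectors and the spectral norm of matrices; $\sigma_i(\cdot)$ is the $i$-th largest singular value; $\preceq$ is the Loewner order on symmetric matrices; $\mathbf I_n$ is the identity; $\mathcal O(\cdot)$ hides an absolute constant. The Gram matrix is $\mathbf H(\mathbf x)=\mathbf J(\mathbf x)\mathbf J(\mathbf x)^\top\in\mathbb R^{n\times n}$, and $\mathbf H_t=\mathbf H(\mathbf x_t)$. When $\mathbf H(\mathbf x)$ is invertible, $\lambda_{\mathrm{under}}(\mathbf x)=\sqrt{\mathbf F(\mathbf x)^\top\mathbf H(\mathbf x)^{-1}\mathbf F(\mathbf x)}$. Quasi-Newton updates. For symmetric positive definite $\mathbf G,\mathbf H$ and a vector $\mathbf u$: BFGS$(\mathbf G,\mathbf H,\mathbf u)=\mathbf G-\frac{\mathbf G\mathbf u\mathbf u^\top\mathbf G}{\mathbf u^\top\mathbf G\mathbf u}+\frac{\mathbf H\mathbf u\mathbf u^\top\mathbf H}{\mathbf u^\top\mathbf H\mathbf u}$; F-BFGS$(\mathbf G,\mathbf H,\mathbf u)=$ BFGS$(\mathbf G,\mathbf H,\mathbf R^\top\mathbf u)$, where $\mathbf R$ is a square matrix with $\mathbf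 G^{-1}=\mathbf R^\top\mathbf R$; SR1$(\mathbf G,\mathbf H,\mathbf u)=\mathbf G-\frac{(\mathbf G-\mathbf H)\mathbf u\mathbf u^\top(\mathbf G-\mathbf H)}{\mathbf u^\top(\mathbf G-\mathbf H)\mathbf u}$, interpreted as $\mathbf G$ if $(\mathbf G-\mathbf H)\mathbf u=\mathbf 0$. RQGN algorithm ($n<d$). Input: $\mathbf x_0\in\Omega_{\mathrm{under}}$, a symmetric positive definite $\mathbf G_0\in\mathbb R^{n\times n}$ with $\mathbf G_0\succeq\mathbf H_0$, and $M=2LL_2/\mu^2$. For $t=0,1,\dots$: $\mathbf x_{t+1}=\mathbf x_t-\mathbf J(\mathbf x_t)^\top\mathbf G_t^{-1}\mathbf F(\mathbf x_t)$; $r_t=\|\mathbf x_{t+1}-\mathbf x_t\|$; $\widetilde{\mathbf G}_t=(1+Mr_t)\mathbf G_t$; draw $\mathbf u_t\sim\mathcal N(\mathbf 0,\mathbf I_n)$ independently of the past; set $\mathbf G_{t+1}$ to be BFGS$(\widetilde{\mathbf G}_t,\mathbf H_{t+1},\mathbf u_t)$ (Option I), F-BFGS$(\widetilde{\mathbf G}_t,\mathbf H_{t+1},\mathbf u_t)$ (Option II, the factor $\mathbf R$ of $\widetilde{\mathbf G}_t$ being determined by $\mathbf u_0,\dots,\mathbf u_{t-1}$), or SR1$(\widetilde{\mathbf G}_t,\mathbf H_{t+1},\mathbf u_t)$ (Option III). Statements about the iterates are understood almost surely. For each $t$, $\eta_t$ is the smallest real $\eta$ with $\mathbf H_t\preceq\mathbf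 G_t\preceq\eta\mathbf H_t$ (it is part of the theory that $\mathbf H_t\preceq\mathbf G_t$ and $\mathbf H_t\succ\mathbf 0$, so $\eta_t$ is well defined). Constants: Option I: $\gamma=\mu^2/(nL^2)$, $\tilde c=1$, $\delta_0=\mathrm{tr}(\mathbf H_0^{-1}(\mathbf G_0-\mathbf H_0))$. Option II: $\gamma=1/n$, $\tilde c=1$, $\delta_0=\mathrm{tr}(\mathbf H_0^{-1}(\mathbf G_0-\mathbf H_0))$. Option III: $\gamma=1/n$, $\tilde c=L^2/\mu^2$, $\delta_0=\frac{nL^2\,\mathrm{tr}(\mathbf G_0-\mathbf H_0)}{\mu^2\,\mathrm{tr}(\mathbf H_0)}$. The ratio $\lambda_{\mathrm{under}}(\mathbf x_{t+1})/\lambda_{\mathrm{under}}(\mathbf x_t)$ is interpreted as $0$ when $\lambda_{\mathrm{under}}(\mathbf x_t)=0$. *)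

(* Defs.v *)
From HB Require Import structures.
From mathcomp Require Import all_boot all_order all_algebra.
From mathcomp Require Import all_classical all_reals all_analysis.

Set Implicit Arguments.
Unset Strict Implicit.
Unset Printing Implicit Defensive.

Import Order.TTheory GRing.Theory Num.Theory.
Import numFieldNormedType.Exports.

Local Open Scope classical_set_scope.
Local Open Scope ring_scope.

(** * Linear algebra *)

(* The library norm on matrices is the sup norm (it defines the same topology,
   hence the same [differentiable] and ['d]), so the Euclidean and spectral
   norms are introduced separately. *)
Definition enorm (R : realType) (n : nat) (v : 'cV[R]_n) : R :=
  Num.sqrt (\sum_(i < n) v i 0 ^+ 2).

Definition spectral_norm (R : realType) (m n : nat) (A : 'M[R]_(m, n)) : R :=
  sup [set enorm (A *m v) | v in [set v : 'cV[R]_n | enorm v <= 1]].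

(* [s] lists, with multiplicity and in nonincreasing order, the square roots of
   the eigenvalues of A A^T; for m <= n these are the m singular values of A,
   and otherwise they are the n singular values followed by m - n zeros. *)
Definition is_singular_values (R : realType) (m n : nat) (A : 'M[R]_(m, n))
    (s : seq R) : Prop :=
  [/\ sorted >=%R s, all (fun a => 0 <= a) s &
      char_poly (A *m A^T) = \prod_(a <- s) ('X - (a ^+ 2)%:P)].

(* The index is 1-based: [sing_val 1 A] is the largest singular value. *)
Definition sing_val (R : realType) (m n : nat) (i : nat) (A : 'M[R]_(m, n)) : R :=
  nth 0 (xget [::] [set s | is_singular_values A s]) i.-1.

Definition psd (R : realType) (n : nat) (A : 'M[R]_n) : Prop :=
  A^T = A /\ forall v : 'cV[R]_n, 0 <= (v^T *m A *m v) 0 0.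

Definition spd (R : realType) (n : nat) (A : 'M[R]_n) : Prop :=
  A^T = A /\ forall v : 'cV[R]_n, v != 0 -> 0 < (v^T *m A *m v) 0 0.

Definition loewner (R : realType) (n : nat) (A B : 'M[R]_n) : Prop :=
  psd (B - A).

(** * The nonlinear system *)

(* The library's [jacobian] acts on row vectors; this is the usual Jacobian
   (column j is the derivative along the j-th basis vector), so that
   'd F x v = jac F x *m v wherever F is differentiable. *)
Definition jac (R : realType) (n d : nat) (F : 'cV[R]_d -> 'cV[R]_n)
    (x : 'cV[R]_d) : 'M[R]_(n, d) :=
  \matrix_(i < n, j < d) ('d F x (delta_mx j 0 : 'cV[R]_d)) i 0.

Definition gram (R : realType) (n d : nat) (F : 'cV[R]_d -> 'cV[R]_n)
    (x : 'cV[R]_d) : 'M[R]_n :=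
  jac F x *m (jac F x)^T.

Definition lambda_under (R : realType) (n d : nat) (F : 'cV[R]_d -> 'cV[R]_n)
    (x : 'cV[R]_d) : R :=
  Num.sqrt (((F x)^T *m invmx (gram F x) *m F x) 0 0).

Definition Omega_under (R : realType) (n d : nat) (F : 'cV[R]_d -> 'cV[R]_n)
    (mu L2 : R) : set 'cV[R]_d :=
  [set x | enorm (F x) <= mu ^+ 2 / (2 * L2)].

(* Meaningful when H is positive definite and H is below G: the set is then
   nonempty and its infimum is attained, i.e. it is the smallest such real. *)
Definition loewner_ratio (R : realType) (n : nat) (G H : 'M[R]_n) : R :=
  inf [set e : R | loewner H G /\ loewner G (e *: H)].

(** * Quasi-Newton updates *)

(* For u = 0 the denominators vanish and, as a / 0 = 0, BFGS returns G. *)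
Definition bfgs (R : realType) (n : nat) (G H : 'M[R]_n) (u : 'cV[R]_n) :
    'M[R]_n :=
  G - ((u^T *m G *m u) 0 0)^-1 *: (G *m u *m u^T *m G)
    + ((u^T *m H *m u) 0 0)^-1 *: (H *m u *m u^T *m H).

(* [K] is the factor with invmx G = K^T *m K. *)
Definition fbfgs (R : realType) (n : nat) (K G H : 'M[R]_n) (u : 'cV[R]_n) :
    'M[R]_n :=
  bfgs G H (K^T *m u).

Definition sr1 (R : realType) (n : nat) (G H : 'M[R]_n) (u : 'cV[R]_n) :
    'M[R]_n :=
  if (G - H) *m u == 0 then G
  else G - ((u^T *m (G - H) *m u) 0 0)^-1 *:
             ((G - H) *m u *m u^T *m (G - H)).

Inductive rqgn_option := OptionI | OptionII | OptionIII.

(** * The RQGN iteration *)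

Definition rqgn_next_x (R : realType) (n d : nat) (F : 'cV[R]_d -> 'cV[R]_n)
    (s : 'cV[R]_d * 'M[R]_n) : 'cV[R]_d :=
  s.1 - (jac F s.1)^T *m invmx s.2 *m F s.1.

Definition rqgn_scaled_G (R : realType) (n d : nat)
    (F : 'cV[R]_d -> 'cV[R]_n) (M : R) (s : 'cV[R]_d * 'M[R]_n) : 'M[R]_n :=
  (1 + M * enorm (rqgn_next_x F s - s.1)) *: s.2.

Definition rqgn_step (R : realType) (n d : nat) (opt : rqgn_option)
    (F : 'cV[R]_d -> 'cV[R]_n) (M : R) (u : 'cV[R]_n) (K : 'M[R]_n)
    (s : 'cV[R]_d * 'M[R]_n) : 'cV[R]_d * 'M[R]_n :=
  let x' := rqgn_next_x F s in
  let Gs := rqgn_scaled_G F M s in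
  let H' := gram F x' in
  (x', match opt with
       | OptionI => bfgs Gs H' u
       | OptionII => fbfgs K Gs H' u
       | OptionIII => sr1 Gs H' u
       end).

(* The pair (x_t, G_t) produced by the directions u_0, u_1, ... and the
   factors K_0, K_1, ... (the latter are used by Option II only). *)
Fixpoint rqgn (R : realType) (n d : nat) (opt : rqgn_option)
    (F : 'cV[R]_d -> 'cV[R]_n) (M : R) (x0 : 'cV[R]_d) (G0 : 'M[R]_n)
    (u : nat -> 'cV[R]_n) (K : nat -> 'M[R]_n) (t : nat) :
    'cV[R]_d * 'M[R]_n :=
  if t is t'.+1 then
    rqgn_step opt F M (u t') (K t') (rqgn opt F M x0 G0 u K t')
  else (x0, G0).

Definition rqgn_gamma (R : realType) (opt : rqgn_option) (n : nat) (mu L : R) :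
    R :=
  match opt with
  | OptionI => mu ^+ 2 / (n%:R * L ^+ 2)
  | OptionII | OptionIII => n%:R^-1
  end.

Definition rqgn_ctilde (R : realType) (opt : rqgn_option) (mu L : R) : R :=
  match opt with
  | OptionI | OptionII => 1
  | OptionIII => L ^+ 2 / mu ^+ 2
  end.

Definition rqgn_delta0 (R : realType) (opt : rqgn_option) (n : nat) (mu L : R)
    (G0 H0 : 'M[R]_n) : R :=
  match opt with
  | OptionI | OptionII => \tr (invmx H0 *m (G0 - H0))
  | OptionIII => n%:R * L ^+ 2 * \tr (G0 - H0) / (mu ^+ 2 * \tr H0)
  end.

Definition q_under (R : realType) (gamma delta0 eta0 : R) : R :=
  expR (11 / 10) * (delta0 + 7 * (1 - gamma) / (20 * eta0)).

(** * Gaussian directions *)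

(* The sigma-algebra generated by the vectors u_s, s in I. *)
Definition sigma_gen (R : realType) (T : Type) (n : nat)
    (u : nat -> T -> 'cV[R]_n) (I : set nat) : set (set T) :=
  <<s [set A | exists s (i : 'I_n) (B : set R),
         [/\ I s, measurable B & A = (fun w => u s w i 0) @^-1` B]] >>.

(* v has law N(0, I_n), the n-fold product of N(0, 1): it is a random vector
   whose law agrees with the product measure on boxes. *)
Definition std_gaussian (R : realType) (disp : measure_display)
    (T : measurableType disp) (P : probability T R) (n : nat)
    (v : T -> 'cV[R]_n) : Prop :=
  (forall i : 'I_n, measurable_fun [set: T] (fun w => v w i 0)) /\
  (forall B : 'I_n -> set R, (forall i, measurable (B i)) ->
     P [set w | forall i, B i (v w i 0)] =
     (\prod_(i < n) normal_prob 0 1 (B i))%E).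

Definition indep_of_past (R : realType) (disp : measure_display)
    (T : measurableType disp) (P : probability T R) (n : nat)
    (u : nat -> T -> 'cV[R]_n) : Prop :=
  forall (t : nat) (A B : set T),
    sigma_gen u [set t] A -> sigma_gen u [set s | (s < t)%N] B ->
    P (A `&` B) = (P A * P B)%E.

(* K_t is a (measurable) function of u_0, ..., u_(t-1). *)
Definition determined_by_past (R : realType) (T : Type) (n : nat)
    (u : nat -> T -> 'cV[R]_n) (K : nat -> T -> 'M[R]_n) : Prop :=
  forall (t : nat) (i j : 'I_n) (B : set R), measurable B ->
    sigma_gen u [set s | (s < t)%N] ((fun w => K t w i j) @^-1` B).

(* Main.v *)
Require Import Defs.
From HB Require Import structures.
From mathcomp Require Import all_boot all_order all_algebra.
From mathcomp Require Import fingroup perm.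
From mathcomp Require Import all_classical all_reals all_analysis.
From mathcomp Require Import measurable_realfun.
From mathcomp Require Import ring lra.

(** Notation: H_t is the Gram matrix at x_t, r_t the length of the step,
    lambda_t the weighted residual, gamma the rate, N = ctilde n, and
    rho = 1 - 1 / (2 eta_0). Primes denote transposes.

    The argument has a part that holds for every sequence of directions and a
    part that averages over them.

    Every direction. Along a step the Gram matrix drifts by a factor between
    (1 + M r_t)^-1 and 1 + M r_t, so that the corrected matrix
    (1 + M r_t) G_t dominates H_{t+1}. The three updates keep a matrix between H
    and e H (e >= 1) in that interval. If H_t <= G_t <= e H_t, the linearized
    residual is contracted by 1 - 1 / e in the norm of H_t^-1
    ([linear_residual]), the Taylor remainder adds M lambda_t / 4, and changing
    the norm costs 1 + M lambda_t / 2 ([step_lambda]). As r_t <= lambda_t and the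
    initial lambda is small, an induction ([path_invariant]) gives
    lambda_t <= rho^t lambda_0 while e grows only from eta_0 to
    exp (2 / 5) eta_0; in particular the iterates never leave the region where
    the smallest singular value is at least mu.

    Average over the directions. The potential delta_t, which is the formula of
    delta_0 at (G_t, H_t), dominates eta_t - 1 ([pot_ratio]). An update with
    direction u lowers it by at least u' A u / u' u, where the semidefinite gain
    matrix A depends on the past only ([pot_update]). The direction of a standard
    Gaussian vector is isotropic ([gaussian_dir_moment]), so this Rayleigh
    quotient has conditional mean tr A / n, which is at least gamma times the
    potential ([gain_trace]). The correction by 1 + M r_t and the drift raise the
    potential from delta_t to at most (1 + M lambda_t)^2 theta_t, with
    theta_t = delta_t + 2 N M lambda_t ([pot_drift]). Together,
    E theta_{t+1} <= (1 - gamma) exp (4 s_t) E theta_t with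
    s_t = rho^t / (10 eta_0) ([theta_step]); the s_t have sum 1 / 5, which yields
    E theta_t <= (1 - gamma)^t exp (4 / 5) theta_0 and hence the bound on eta_t.
    Taking e = 1 + delta_t in the contraction estimate gives
    lambda_{t+1} <= Z_t lambda_t with Z_t <= (1 + s_t) theta_t, and hence the bound
    on the ratios.

    High probability. Markov's inequality for Z_{t0+t} at the level
    (1 + gamma)^-t / 2 and a union bound over t leave a bad event of probability
    at most 2 q (1 - gamma)^t0 / gamma^2; a logarithmic t0 makes this at most p
    ([superlinear_whp]). On the good event the levels multiply to the asserted
    superlinear factor, and the first t0 steps contribute rho^t0.

    All matrix inequalities are reduced to the Cauchy-Schwarz inequality for
    semidefinite forms; neither square roots of matrices nor spectral
    decompositions enter. *)

Set Implicit Arguments.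
Unset Strict Implicit.
Unset Printing Implicit Defensive.

Import Order.TTheory GRing.Theory Num.Theory.
Import numFieldNormedType.Exports.

Local Open Scope classical_set_scope.
Local Open Scope ring_scope.

(** * Bilinear forms and the Loewner order *)

Section BilinearForms.
Variables (R : realType) (n : nat).
Implicit Types (A B G H D : 'M[R]_n) (u v w : 'cV[R]_n).

Definition bform A u v : R := (u^T *m A *m v) 0 0.

Lemma bformDl A u v w : bform A (u + v) w = bform A u w + bform A v w.
Proof. by rewrite /bform linearD /= !mulmxDl mxE. Qed.

Lemma bformDr A u v w : bform A u (v + w) = bform A u v + bform A u w.
Proof. by rewrite /bform mulmxDr mxE. Qed.

Lemma bformZl A a u v : bform A (a *: u) v = a * bform A u v.
Proof. by rewrite /bform linearZ /= -!scalemxAl mxE. Qed.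

Lemma bformZr A a u v : bform A u (a *: v) = a * bform A u v.
Proof. by rewrite /bform -scalemxAr mxE. Qed.

Lemma bformNl A u v : bform A (- u) v = - bform A u v.
Proof. by rewrite -scaleN1r bformZl mulN1r. Qed.

Lemma bformNr A u v : bform A u (- v) = - bform A u v.
Proof. by rewrite -scaleN1r bformZr mulN1r. Qed.

Lemma bformDm A B u v : bform (A + B) u v = bform A u v + bform B u v.
Proof. by rewrite /bform mulmxDr mulmxDl mxE. Qed.

Lemma bformZm A a u v : bform (a *: A) u v = a * bform A u v.
Proof. by rewrite /bform -scalemxAr -scalemxAl mxE. Qed.

Lemma bformNm A u v : bform (- A) u v = - bform A u v.
Proof. by rewrite -scaleN1r bformZm mulN1r. Qed.

Lemma bformBm A B u v : bform (A - B) u v = bform A u v - bform B u v.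
Proof. by rewrite bformDm bformNm. Qed.

Lemma bform_tr A u v : bform A^T u v = bform A v u.
Proof.
rewrite /bform; have -> : u^T *m A^T *m v = (v^T *m A *m u)^T.
  by rewrite !trmx_mul !trmxK mulmxA.
by rewrite mxE.
Qed.

Lemma bformC A u v : A^T = A -> bform A u v = bform A v u.
Proof. by move=> sA; rewrite -{1}sA bform_tr. Qed.

Lemma bform_mulr A B u v : bform (A *m B) u v = bform A u (B *m v).
Proof. by rewrite /bform !mulmxA. Qed.

Lemma bform1 u v : bform 1%:M u v = \sum_i u i 0 * v i 0.
Proof. by rewrite /bform mulmx1 mxE; apply: eq_bigr => i _; rewrite mxE. Qed.

Lemma bform_delta A i j : bform A (delta_mx i 0) (delta_mx j 0) = A i j.
Proof. by rewrite /bform trmx_delta -rowE -colE !mxE. Qed.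

Lemma bform_outer A w u v :
  bform (A *m w *m w^T *m A) u v = bform A u w * bform A w v.
Proof.
rewrite /bform.
have -> : u^T *m (A *m w *m w^T *m A) *m v
          = (u^T *m A *m w) *m (w^T *m A *m v) by rewrite !mulmxA.
by rewrite mxE big_ord1.
Qed.

Lemma psd_sym A : psd A -> A^T = A. Proof. by case. Qed.
Lemma psd_ge0 A v : psd A -> 0 <= bform A v v. Proof. by case=> _ /(_ v). Qed.
Lemma spd_gt0 A v : spd A -> v != 0 -> 0 < bform A v v.
Proof. by case=> _ /(_ v). Qed.
Lemma spd_psd A : spd A -> psd A.
Proof.
case=> sA hA; split=> // v; have [->|v0] := eqVneq v 0.
  by rewrite mulmx0 mxE.
exact/ltW/hA.
Qed.

Lemma loewnerP A B : A^T = A -> B^T = B ->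
  (forall v, bform A v v <= bform B v v) -> loewner A B.
Proof.
move=> sA sB h; split; first by rewrite linearB /= sA sB.
by move=> v; have := h v; rewrite -subr_ge0 -bformBm.
Qed.

Lemma loewner_le A B v : loewner A B -> bform A v v <= bform B v v.
Proof. by move=> /(@psd_ge0 _ v); rewrite bformBm subr_ge0. Qed.

Lemma loewner_symr A B : A^T = A -> loewner A B -> B^T = B.
Proof.
move=> sA [+ _]; rewrite linearB /= sA => h.
by apply: (addIr (- A)).
Qed.

Lemma loewner_trans A B C : loewner A B -> loewner B C -> loewner A C.
Proof.
move=> [s1 h1] [s2 h2]; rewrite /loewner; have -> : C - A = (C - B) + (B - A) by rewrite subrKA.
split; first by rewrite linearD /= s1 s2.
by move=> v; rewrite -/(bform _ v v) bformDm addr_ge0 //; [exact: h2|exact: h1].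
Qed.

Lemma loewner_scale a A B : 0 <= a -> loewner A B -> loewner (a *: A) (a *: B).
Proof.
move=> a0 [s h]; rewrite /loewner -scalerBr; split; first by rewrite linearZ /= s.
by move=> v; rewrite -/(bform _ v v) bformZm mulr_ge0 //; exact: h.
Qed.

Lemma loewner_scalel a b A : a <= b -> psd A -> loewner (a *: A) (b *: A).
Proof.
move=> ab [s h]; rewrite /loewner -scalerBl; split; first by rewrite linearZ /= s.
by move=> v; rewrite -/(bform _ v v) bformZm mulr_ge0 ?subr_ge0//; exact: h.
Qed.

Lemma loewner_spd A B : spd A -> loewner A B -> spd B.
Proof.
move=> [sA pA] AB; split; first exact: loewner_symr AB.
by move=> v /pA /lt_le_trans; apply; exact: loewner_le.
Qed.

Lemma spd_scale a A : 0 < a -> spd A -> spd (a *: A).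
Proof.
move=> a0 [s h]; split; first by rewrite linearZ /= s.
by move=> v v0; rewrite -/(bform _ v v) bformZm mulr_gt0 //; exact: h.
Qed.

(** Cauchy-Schwarz for a positive semidefinite form, the only inequality that
    the matrix part of the proof rests on: it makes square roots of matrices
    and eigenvalue decompositions unnecessary. *)
Lemma psd_cauchy_schwarz A u v : psd A ->
  bform A u v ^+ 2 <= bform A u u * bform A v v.
Proof.
move=> pA; have sA := psd_sym pA.
set a := bform A u u; set b := bform A u v; set c := bform A v v.
have q t : 0 <= a + t * b *+ 2 + t ^+ 2 * c.
  have := psd_ge0 (u + t *: v) pA.
  rewrite bformDl !bformDr !bformZl !bformZr (bformC v u sA) -/a -/b -/c.
  by congr (_ <= _); ring.
have c0 : 0 <= c by exact: psd_ge0.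
have [cz|cn] := eqVneq c 0.
  have [->|bn] := eqVneq b 0; first by rewrite cz expr0n mulr0.
  have := q (- (a + 1) / b *  2^-1); rewrite cz mulr0 addr0.
  suff -> : a + - (a + 1) / b / 2 * b *+ 2 = -1 by rewrite oppr_ge0 ler10.
  by field.
have cp : 0 < c by rewrite lt0r cn.
have := q (- b / c).
have -> : a + - b / c * b *+ 2 + (- b / c) ^+ 2 * c = a - b ^+ 2 / c by field.
by rewrite subr_ge0 ler_pdivrMr.
Qed.

Lemma psd_triangle A v w : psd A -> Num.sqrt (bform A (v + w) (v + w)) <=
  Num.sqrt (bform A v v) + Num.sqrt (bform A w w).
Proof.
move=> pA; have [a0 b0] := (psd_ge0 v pA, psd_ge0 w pA).
rewrite -(ler_pXn2r (ltn0Sn 1)) ?nnegrE ?addr_ge0 ?sqrtr_ge0 //.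
rewrite sqr_sqrtr ?psd_ge0 // bformDl !bformDr (bformC w v (psd_sym pA)).
rewrite sqrrD !sqr_sqrtr // addrA lerD2r -addrA lerD2l -mulr2n ler_pMn2r //.
apply: le_trans (ler_norm _) _.
rewrite -(ler_pXn2r (ltn0Sn 1)) ?nnegrE ?mulr_ge0 ?sqrtr_ge0 //.
by rewrite real_normK ?num_real // exprMn !sqr_sqrtr //; exact: psd_cauchy_schwarz.
Qed.

Lemma spd_unit A : spd A -> A \in unitmx.
Proof.
move=> [sA pA]; rewrite -row_free_unit -kermx_eq0; apply/eqP/row_matrixP => i.
rewrite row0; apply/eqP; apply: contraT => v0; set v := row i _ in v0.
have vA : v *m A = 0 by rewrite /v -row_mul mulmx_ker row0.
have : v^T != 0 by apply: contraNneq v0 => h; rewrite -[v]trmxK h trmx0.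
by move/pA; rewrite trmxK vA mul0mx mxE ltxx.
Qed.

Lemma inv_sym A : A^T = A -> (invmx A)^T = invmx A.
Proof. by move=> sA; rewrite trmx_inv sA. Qed.

Lemma bform_inv A u : A^T = A -> A \in unitmx ->
  bform A (invmx A *m u) (invmx A *m u) = bform (invmx A) u u.
Proof.
move=> sA uA; rewrite -bform_mulr mulmxV // /bform mulmx1 trmx_mul inv_sym //.
Qed.

Lemma spd_inv A : spd A -> spd (invmx A).
Proof.
move=> pA; have uA := spd_unit pA; have sA := proj1 pA.
split; first exact: inv_sym.
move=> v v0; rewrite -/(bform _ v v) -bform_inv //; apply: spd_gt0 => //.
by apply: contraNneq v0 => h; rewrite -(mulKVmx uA v) h mulmx0.
Qed.

(** Cauchy-Schwarz for A at u and A^-1 v: the forms of A and of its inverse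
    are dual to each other. *)
Lemma cauchy_schwarz_inv A u v : spd A ->
  bform 1%:M u v ^+ 2 <= bform A u u * bform (invmx A) v v.
Proof.
move=> pA; have uA := spd_unit pA; have sA := proj1 pA.
have := psd_cauchy_schwarz u (invmx A *m v) (spd_psd pA).
by rewrite bform_inv // -bform_mulr mulmxV.
Qed.

(** Inversion is antitone: with a = G^-1 v, the duality
    (v' G^-1 v)^2 = (a' v)^2 <= (a' H a)(v' H^-1 v) and H below G give
    (v' G^-1 v)^2 <= (v' G^-1 v)(v' H^-1 v). *)
Lemma loewner_inv H G : spd H -> loewner H G -> loewner (invmx G) (invmx H).
Proof.
move=> pH HG; have pG := loewner_spd pH HG.
have [uG sG] := (spd_unit pG, proj1 pG).
apply: loewnerP; [exact: inv_sym|exact/inv_sym/(proj1 pH)|move=> v].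
have [->|v0] := eqVneq v 0; first by rewrite /bform !mulmx0.
have pv := spd_gt0 (spd_inv pG) v0.
rewrite -(ler_pM2l pv) -expr2.
have := cauchy_schwarz_inv (invmx G *m v) v pH.
have -> : bform 1%:M (invmx G *m v) v = bform (invmx G) v v.
  by rewrite /bform mulmx1 trmx_mul inv_sym.
move/le_trans; apply; rewrite ler_wpM2r //.
  exact/psd_ge0/spd_psd/spd_inv.
by rewrite -(bform_inv v sG uG); exact: loewner_le.
Qed.

Lemma inv_scale a A : a != 0 -> A \in unitmx -> invmx (a *: A) = a^-1 *: invmx A.
Proof. by move=> a0 uA; rewrite invmxZ // unitmxZ // unitfE. Qed.

End BilinearForms.

(** * Traces of products of semidefinite matrices *)

Section TraceOfProduct.
Variables (R : realType) (n : nat).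
Implicit Types (A B G H D P Q : 'M[R]_n) (u v w : 'cV[R]_n).

Lemma trace_outer Q w : \tr (Q *m (w *m w^T)) = bform Q w w.
Proof. by rewrite mulmxA mxtrace_mulC mulmxA trace_mx11. Qed.

Lemma outer_bform w u v : bform (w *m w^T) u v = bform 1%:M u w * bform 1%:M w v.
Proof. by rewrite -bform_outer !mul1mx mulmx1. Qed.

Lemma outer_sym w : (w *m w^T)^T = w *m w^T.
Proof. by rewrite trmx_mul trmxK. Qed.

Lemma psd_zero P i j : psd P -> P i i = 0 -> P i j = 0.
Proof.
move=> pP Pii; have := psd_cauchy_schwarz (delta_mx i 0) (delta_mx j 0) pP.
rewrite !bform_delta Pii mul0r => h; apply/eqP; rewrite -sqrf_eq0 eq_le h.
exact: sqr_ge0.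
Qed.

(** Splitting off the rank-one part carried by a nonzero diagonal entry leaves
    a positive semidefinite matrix with a smaller diagonal support, so P is a
    sum of squares w w' and the trace is a sum of values w' Q w. *)
Lemma trace_psd_ge0 P Q : psd P -> psd Q -> 0 <= \tr (Q *m P).
Proof.
move: {2}_.+1 (ltnSn #|[set i | P i i != 0]%SET|) => k.
elim: k P => // k IH P hk pP pQ.
have [h0|[i]] := set_0Vmem [set i | P i i != 0]%SET.
  have -> : P = 0.
    apply/matrixP => i j; rewrite mxE; apply: psd_zero => //.
    by have := finset.in_set0 i; rewrite -h0 inE => /negbT/negPn/eqP.
  by rewrite mulmx0 mxtrace0.
rewrite inE => Pii0; have Pii : 0 < P i i.
  by rewrite lt0r Pii0 -bform_delta psd_ge0.
pose w : 'cV[R]_n := P *m delta_mx i 0; set P' := P - (P i i)^-1 *: (w *m w^T).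
have sP := psd_sym pP.
have wv v : bform 1%:M w v = bform P (delta_mx i 0) v.
  by rewrite /bform mulmx1 trmx_mul sP.
have vw v : bform 1%:M v w = bform P v (delta_mx i 0).
  by rewrite /bform mulmx1 mulmxA.
have pP' : psd P'.
  split; first by rewrite /P' linearB linearZ /= outer_sym sP.
  move=> v; rewrite -/(bform _ v v) /P' bformBm bformZm outer_bform wv vw.
  rewrite (bformC v _ sP) -expr2 mulrC subr_ge0 ler_pdivrMr // mulrC.
  by have := psd_cauchy_schwarz (delta_mx i 0) v pP; rewrite bform_delta.
have -> : P = P' + (P i i)^-1 *: (w *m w^T) by rewrite /P' subrK.
rewrite mulmxDr linearD /= -scalemxAr linearZ /= trace_outer addr_ge0 //; last first.
  by rewrite mulr_ge0 ?invr_ge0 ?(ltW Pii) // psd_ge0.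
apply: IH pP' pQ; rewrite ltnS in hk; apply: leq_trans hk; apply: proper_card.
have P'jj j : P' j j = P j j - (P i i)^-1 * (P j i) ^+ 2.
  rewrite -[LHS]bform_delta /P' bformBm bformZm outer_bform wv vw.
  by rewrite (bformC _ (delta_mx j 0) sP) !bform_delta.
apply/properP; split.
  apply/fintype.subsetP => j; rewrite !inE; apply: contraNneq => Pj.
  rewrite P'jj Pj (psd_zero i pP Pj).
  by rewrite expr0n mulr0 subr0.
exists i; rewrite finset.in_set //.
by rewrite negbK P'jj expr2 mulKf // subrr.
Qed.

Lemma trace_mono Q A B : psd Q -> loewner A B -> \tr (Q *m A) <= \tr (Q *m B).
Proof.
by move=> pQ AB; rewrite -subr_ge0 -linearB /= -mulmxBr; exact: trace_psd_ge0.
Qed.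

Lemma psd1 : psd (1%:M : 'M[R]_n).
Proof.
split; first exact: trmx1.
move=> v; rewrite -/(bform _ v v) bform1; apply: sumr_ge0 => i _.
by rewrite -expr2 sqr_ge0.
Qed.

Lemma trace_psd_nneg P : psd P -> 0 <= \tr P.
Proof. by move=> pP; rewrite -(mul1mx P) trace_psd_ge0 //; exact: psd1. Qed.

Lemma spd1 : spd (1%:M : 'M[R]_n).
Proof.
split; first exact: trmx1.
move=> v v0; rewrite -/(bform _ v v) lt0r psd_ge0 ?andbT; last exact: psd1.
apply: contraNneq v0 => h; apply/eqP/matrixP => i j; rewrite ord1 mxE.
move: h; rewrite bform1 => /psumr_eq0P h; apply/eqP.
by rewrite -sqrf_eq0 expr2 h // => k _; rewrite -expr2 sqr_ge0.
Qed.

(** By duality v v' is below (v' H v) H^-1, and the trace against D is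
    monotone. *)
Lemma loewner_trace H D : spd H -> psd D -> loewner D (\tr (invmx H *m D) *: H).
Proof.
move=> pH pD; have sH := proj1 pH; have sD := psd_sym pD.
apply: loewnerP; rewrite ?linearZ /= ?sH // => v.
rewrite bformZm mxtrace_mulC -trace_outer.
have pv : loewner (v *m v^T) (bform H v v *: invmx H).
  apply: loewnerP; rewrite ?outer_sym ?linearZ /= ?inv_sym // => u.
  rewrite outer_bform bformZm (bformC u v (trmx1 _ _)) -expr2.
  exact: cauchy_schwarz_inv.
apply: le_trans (trace_mono pD pv) _.
by rewrite -scalemxAr linearZ /= mulrC.
Qed.

Lemma loewner_trace1 D : psd D -> loewner D (\tr D *: 1%:M).
Proof. by move=> /(loewner_trace spd1); rewrite invmx1 mul1mx. Qed.

Lemma psd_entry_le_trace P i j : psd P -> `|P i j| <= \tr P.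
Proof.
move=> pP; have h v := loewner_le v (loewner_trace1 pP).
have d k : 0 <= P k k by rewrite -bform_delta psd_ge0.
have t0 := trace_psd_nneg pP.
have hd k : P k k <= \tr P.
  have := h (delta_mx k 0); rewrite bform_delta bformZm bform_delta mxE eqxx.
  by rewrite mulr1.
rewrite -(ler_pXn2r (ltn0Sn 1)) ?nnegrE //.
rewrite real_normK ?num_real //.
have := psd_cauchy_schwarz (delta_mx i 0) (delta_mx j 0) pP.
rewrite !bform_delta => /le_trans; apply.
by rewrite expr2; apply: ler_pM.
Qed.

End TraceOfProduct.

(** * Order properties of the updates *)

Section Updates.
Variables (R : realType) (n : nat).
Implicit Types (A B G H D K : 'M[R]_n) (u v w : 'cV[R]_n).

Lemma bfgsE G H u : bfgs G H u =
  G - (bform G u u)^-1 *: (G *m u *m u^T *m G)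
    + (bform H u u)^-1 *: (H *m u *m u^T *m H).
Proof. by []. Qed.

Lemma bfgs0 G H : bfgs G H 0 = G.
Proof. by rewrite bfgsE !mulmx0 !mul0mx !scaler0 subr0 addr0. Qed.

Lemma outer_cong_sym A u : A^T = A -> (A *m u *m u^T *m A)^T = A *m u *m u^T *m A.
Proof. by move=> sA; rewrite !trmx_mul trmxK sA !mulmxA. Qed.

Lemma bfgs_sym G H u : G^T = G -> H^T = H -> (bfgs G H u)^T = bfgs G H u.
Proof.
by move=> sG sH; rewrite /bfgs !raddfD raddfN /= !linearZ /= !outer_cong_sym ?sG.
Qed.

Lemma bform_bfgs G H u v : G^T = G -> H^T = H ->
  bform (bfgs G H u) v v =
    bform G v v - bform G u v ^+ 2 / bform G u u + bform H u v ^+ 2 / bform H u u.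
Proof.
move=> sG sH; rewrite bfgsE bformDm bformBm !bformZm !bform_outer.
by rewrite (bformC v u sG) (bformC v u sH) -!expr2 ![_^-1 * _]mulrC.
Qed.

(** The form v' G v - (u' G v)^2 / (u' G u) is the minimum over t of the value of G
    at v - t u; minima are monotone in G. *)
Lemma schur_mono A B u v : A^T = A -> spd B -> (forall w, bform A w w <= bform B w w) ->
  0 < bform A u u ->
  bform A v v - bform A u v ^+ 2 / bform A u u
   <= bform B v v - bform B u v ^+ 2 / bform B u u.
Proof.
move=> sA pB AB auu; have buu : 0 < bform B u u by exact: lt_le_trans (AB u).
have := AB (v - (bform B u v / bform B u u) *: u).
have sB := proj1 pB.
rewrite !bformDl !bformDr !bformNl !bformNr !bformZl !bformZr.
rewrite (bformC v u sA) (bformC v u sB).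
move: (bform A u u) auu (bform B u u) buu (bform A u v) (bform B u v)
  (bform A v v) (bform B v v) => a a0 b b0 x y p q h.
have -> : q - y ^+ 2 / b = q - y / b * y + (- (y / b * y) - - (y / b * (y / b * b))).
  by field; rewrite gt_eqF.
apply: le_trans h; rewrite -subr_ge0.
have -> : p - y / b * x + (- (y / b * x) - - (y / b * (y / b * a))) - (p - x ^+ 2 / a)
  = a * (y / b - x / a) ^+ 2 by field; rewrite !gt_eqF.
by rewrite mulr_ge0 ?sqr_ge0 ?ltW.
Qed.

(** In the form of H at v, BFGS replaces the minimum of H over v - t u by the
    minimum of G over v - t u, and minima inherit the order of G and H. *)
Lemma bfgs_lower G H u : spd H -> loewner H G -> loewner H (bfgs G H u).
Proof.
move=> pH HG; have [->|u0] := eqVneq u 0; first by rewrite bfgs0.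
have pG := loewner_spd pH HG; have [sH sG] := (proj1 pH, proj1 pG).
apply: loewnerP => //; first exact: bfgs_sym.
move=> v; rewrite bform_bfgs // -lerBlDr; apply: schur_mono => //.
  by move=> w; exact: loewner_le.
exact: spd_gt0.
Qed.

Lemma bfgs_upper e G H u : 1 <= e -> spd G -> spd H -> loewner G (e *: H) ->
  loewner (bfgs G H u) (e *: H).
Proof.
move=> e1 pG pH GH; have [->|u0] := eqVneq u 0; first by rewrite bfgs0.
have e0 : 0 < e by exact: lt_le_trans e1.
have [sH sG] := (proj1 pH, proj1 pG).
have pE := spd_scale e0 pH.
apply: loewnerP => //; [exact: bfgs_sym|exact: (proj1 pE)|move=> v].
rewrite bform_bfgs //.
have huu := spd_gt0 pH u0.
have : bform G v v - bform G u v ^+ 2 / bform G u u <=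
   bform (e *: H) v v - bform (e *: H) u v ^+ 2 / bform (e *: H) u u.
  apply: schur_mono => //; last exact: spd_gt0.
  by move=> w; exact: loewner_le.
rewrite -(lerD2r (bform H u v ^+ 2 / bform H u u)) => /le_trans; apply.
rewrite !bformZm -addrA gerDl addrC subr_le0.
have -> : (e * bform H u v) ^+ 2 / (e * bform H u u) =
          e * (bform H u v ^+ 2 / bform H u u).
  by field; rewrite !gt_eqF.
by apply: ler_peMl => //; rewrite divr_ge0 ?sqr_ge0 ?ltW.
Qed.

Lemma bform_sr1 G H u v : G^T = G -> H^T = H -> (G - H) *m u != 0 ->
  bform (sr1 G H u) v v =
    bform G v v - bform (G - H) u v ^+ 2 / bform (G - H) u u.
Proof.
move=> sG sH du; rewrite /sr1 (negbTE du) [LHS]bformBm bformZm bform_outer.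
have sD : (G - H)^T = G - H by rewrite linearB /= sG sH.
by rewrite (bformC v u sD) -expr2 mulrC.
Qed.

Lemma sr1_sym G H u : G^T = G -> H^T = H -> (sr1 G H u)^T = sr1 G H u.
Proof.
move=> sG sH; rewrite /sr1; case: ifP => // _.
by rewrite linearB linearZ /= outer_cong_sym ?sG // linearB /= sG sH.
Qed.

Lemma psd_mul_eq0 D u : psd D -> bform D u u = 0 -> D *m u = 0.
Proof.
move=> pD h; apply/matrixP => i j; rewrite ord1 mxE [RHS]mxE.
have -> : \sum_k D i k * u k 0 = bform D (delta_mx i 0) u.
  rewrite /bform trmx_delta -mulmxA -rowE mxE mxE.
  by apply: eq_bigr.
apply/eqP; rewrite -sqrf_eq0 eq_le sqr_ge0 andbT.
have := psd_cauchy_schwarz (delta_mx i 0) u pD.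
by rewrite h mulr0.
Qed.

(** SR1 replaces D = G - H by its Schur complement along u, which remains
    semidefinite by Cauchy-Schwarz for D. *)
Lemma sr1_lower G H u : spd H -> loewner H G -> loewner H (sr1 G H u).
Proof.
move=> pH HG; have pG := loewner_spd pH HG; have [sH sG] := (proj1 pH, proj1 pG).
have [du|du] := eqVneq ((G - H) *m u) 0; first by rewrite /sr1 du eqxx.
apply: loewnerP => //; first exact: sr1_sym.
move=> v; rewrite bform_sr1 // lerBrDr -lerBrDl -bformBm.
have duu : 0 < bform (G - H) u u.
  rewrite lt0r psd_ge0 // andbT; apply: contraNneq du => h.
  by rewrite (psd_mul_eq0 _ h).
by rewrite ler_pdivrMr // mulrC; exact: psd_cauchy_schwarz.
Qed.

Lemma sr1_upper B G H u : loewner H G -> spd H -> loewner G B ->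
  loewner (sr1 G H u) B.
Proof.
move=> HG pH; apply: loewner_trans.
have pG := loewner_spd pH HG; have [sH sG] := (proj1 pH, proj1 pG).
have [du|du] := eqVneq ((G - H) *m u) 0.
  rewrite /sr1 du eqxx; exact: loewnerP.
apply: loewnerP => //; first exact: sr1_sym.
move=> v; rewrite bform_sr1 // gerBl divr_ge0 ?sqr_ge0 //; exact: psd_ge0.
Qed.

Definition rqgn_update opt K G H u : 'M[R]_n :=
  match opt with
  | OptionI => bfgs G H u
  | OptionII => fbfgs K G H u
  | OptionIII => sr1 G H u
  end.

Lemma update_lower opt K G H u : spd H -> loewner H G ->
  loewner H (rqgn_update opt K G H u).
Proof.
by case: opt => pH HG /=; rewrite /fbfgs; [exact: bfgs_lower|exact: bfgs_lower|exact: sr1_lower].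
Qed.

Lemma update_upper opt e K G H u : 1 <= e -> spd H -> loewner H G ->
  loewner G (e *: H) -> loewner (rqgn_update opt K G H u) (e *: H).
Proof.
move=> e1 pH HG GH; have pG := loewner_spd pH HG.
by case: opt => /=; [exact: bfgs_upper|exact: bfgs_upper|exact: sr1_upper].
Qed.

End Updates.

(** * The trace potential *)

Section Potential.
Variables (R : realType) (n : nat) (opt : rqgn_option) (mu L : R).
Hypotheses (n0 : (0 < n)%N) (mu0 : 0 < mu) (muL : mu <= L).
Implicit Types (A B G H D K : 'M[R]_n) (u v w : 'cV[R]_n).
Let L0 : 0 < L := lt_le_trans mu0 muL.

(** The random direction enters the decrease of the potential only through
    the Rayleigh quotient of this matrix. *)
Definition gain_mx K G H : 'M[R]_n :=
  match opt with
  | OptionI => (L ^+ 2)^-1 *: (G - H)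
  | OptionII => K *m G *m invmx H *m G *m K^T - 1%:M
  | OptionIII => (n%:R * L ^+ 2 / (mu ^+ 2 * \tr H)) *: (G - H)
  end.

Definition pot_weight : R := rqgn_ctilde opt mu L * n%:R.

Notation pot G H := (rqgn_delta0 opt mu L G H).

Definition well_cond H :=
  loewner (mu ^+ 2 *: 1%:M) H /\ loewner H (L ^+ 2 *: 1%:M).

Lemma well_cond_spd H : well_cond H -> spd H.
Proof.
case=> h _; apply: loewner_spd h; apply: spd_scale; last exact: spd1.
by rewrite exprn_gt0.
Qed.

Lemma trace_inv_mul H G : spd H -> \tr (invmx H *m (G - H)) = \tr (invmx H *m G) - n%:R.
Proof.
by move=> pH; rewrite mulmxBr mulVmx ?spd_unit // linearB /= mxtrace1.
Qed.

Lemma well_cond_trace H : well_cond H ->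
  n%:R * mu ^+ 2 <= \tr H /\ \tr H <= n%:R * L ^+ 2.
Proof.
have t1 a : \tr (1%:M *m (a *: 1%:M : 'M[R]_n)) = n%:R * a.
  by rewrite mul1mx linearZ /= mxtrace1 mulrC.
case=> h1 h2; split.
  by have := trace_mono (psd1 R n) h1; rewrite t1 mul1mx.
by have := trace_mono (psd1 R n) h2; rewrite t1 mul1mx.
Qed.

Lemma well_cond_trace_gt0 H : well_cond H -> 0 < \tr H.
Proof.
case/well_cond_trace => h _; apply: lt_le_trans h.
by rewrite mulr_gt0 ?ltr0n ?exprn_gt0.
Qed.

Lemma ctilde_ge1 : 1 <= rqgn_ctilde opt mu L.
Proof.
case: opt => //=; rewrite ler_pdivlMr ?exprn_gt0 // mul1r.
by rewrite ler_pXn2r // nnegrE ltW.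
Qed.

Lemma pot_weight_gt0 : 0 < pot_weight.
Proof.
by rewrite mulr_gt0 ?ltr0n // (lt_le_trans _ ctilde_ge1).
Qed.

Lemma pot_ge0 G H : well_cond H -> loewner H G -> 0 <= pot G H.
Proof.
move=> wH HG; have pH := well_cond_spd wH.
have p : 0 <= \tr (invmx H *m (G - H)).
  by apply: trace_psd_ge0 => //; exact/spd_psd/spd_inv.
case: opt => //=; apply: divr_ge0.
  by apply: mulr_ge0; [rewrite mulr_ge0 ?ler0n ?sqr_ge0|exact: trace_psd_nneg].
by rewrite mulr_ge0 ?sqr_ge0 // ltW // well_cond_trace_gt0.
Qed.

(** The potential dominates the excess of the condition ratio over 1, because a
    positive semidefinite D lies below tr (H^-1 D) H and below tr D I. *)
Lemma pot_ratio G H : well_cond H -> loewner H G ->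
  loewner G ((1 + pot G H) *: H).
Proof.
move=> wH HG; have pH := well_cond_spd wH; have pG := loewner_spd pH HG.
have [sH sG] := (proj1 pH, proj1 pG).
suff : loewner (G - H) (pot G H *: H).
  by rewrite /loewner opprB addrA scalerDl scale1r [H + _]addrC.
case: opt => /=; [exact: loewner_trace|exact: loewner_trace|].
apply: loewner_trans (loewner_trace1 HG) _.
have t0 : 0 <= \tr (G - H) by exact: trace_psd_nneg.
have [h1 h2] := well_cond_trace wH; have tH := well_cond_trace_gt0 wH.
case: wH => h _.
have [z|z] := eqVneq (\tr (G - H)) 0.
  by rewrite z mulr0 mul0r !scale0r; apply: loewnerP; rewrite ?trmx0.
have -> : \tr (G - H) *: (1%:M : 'M[R]_n) = (\tr (G - H) / mu ^+ 2) *: (mu ^+ 2 *: 1%:M).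
  by rewrite scalerA divfK // sqrf_eq0 gt_eqF.
have k0 : 0 <= \tr (G - H) / mu ^+ 2 by rewrite divr_ge0 ?sqr_ge0.
apply: loewner_trans (loewner_scale k0 h) _.
apply: loewner_scalel; last exact: spd_psd.
have -> : n%:R * L ^+ 2 * \tr (G - H) / (mu ^+ 2 * \tr H) =
    \tr (G - H) / mu ^+ 2 * (n%:R * L ^+ 2 / \tr H) by field; rewrite !gt_eqF.
by rewrite ler_peMr // ler_pdivlMr // mul1r.
Qed.

(** The quantities tr (H^-1 G) and tr G / tr H grow by a factor (1 + a)^2 at
    most; subtracting their values at G = H produces the additive term, since
    (1 + a)^2 (1 + x) - 1 <= (1 + a)^2 (x + 2 a). *)
Lemma pot_drift a G H H' : 0 <= a -> well_cond H -> well_cond H' ->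
  loewner H G -> loewner H ((1 + a) *: H') ->
  pot ((1 + a) *: G) H' <= (1 + a) ^+ 2 * (pot G H + 2 * pot_weight * a).
Proof.
move=> a0 wH wH' HG HH'; have [pH pH'] := (well_cond_spd wH, well_cond_spd wH').
have pG := loewner_spd pH HG.
have a1 : 0 < 1 + a by rewrite ltr_pwDl.
have num (N : R) x : 0 < N -> N * ((1 + a) ^+ 2 * (1 + x) - 1) <=
    (1 + a) ^+ 2 * (N * x + 2 * N * a).
  move=> N0; rewrite -subr_ge0.
  have -> : (1 + a) ^+ 2 * (N * x + 2 * N * a) - N * ((1 + a) ^+ 2 * (1 + x) - 1)
     = N * (a ^+ 2 * (3 + 2 * a)) by ring.
  by rewrite !mulr_ge0 ?sqr_ge0 ?(ltW N0) // addr_ge0 ?mulr_ge0.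
have nR : 0 < n%:R :> R by rewrite ltr0n.
have invH : loewner (invmx H') ((1 + a) *: invmx H).
  have := loewner_inv pH HH'.
  rewrite inv_scale ?gt_eqF ?spd_unit // => /(loewner_scale (ltW a1)).
  by rewrite scalerA divff ?gt_eqF // scale1r.
have I2 : \tr (invmx H' *m ((1 + a) *: G - H')) <=
  (1 + a) ^+ 2 * (\tr (invmx H *m (G - H)) + 2 * n%:R * a).
  rewrite !trace_inv_mul // -scalemxAr linearZ /=.
  have h : \tr (invmx H' *m G) <= (1 + a) * \tr (invmx H *m G).
    rewrite mxtrace_mulC (mxtrace_mulC (invmx H)).
    apply: le_trans (trace_mono (spd_psd pG) invH) _.
    by rewrite -scalemxAr linearZ.
  have := num n%:R (\tr (invmx H *m G) / n%:R - 1) nR.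
  have -> : n%:R * (\tr (invmx H *m G) / n%:R - 1) = \tr (invmx H *m G) - n%:R.
    by field; rewrite gt_eqF.
  apply: le_trans.
  have -> : n%:R * ((1 + a) ^+ 2 * (1 + (\tr (invmx H *m G) / n%:R - 1)) - 1) =
    (1 + a) * ((1 + a) * \tr (invmx H *m G)) - n%:R.
    by field; rewrite gt_eqF.
  by rewrite lerD2r ler_pM2l.
have [tH tH'] := (well_cond_trace_gt0 wH, well_cond_trace_gt0 wH').
have I3 : n%:R * L ^+ 2 * \tr ((1 + a) *: G - H') / (mu ^+ 2 * \tr H') <=
  (1 + a) ^+ 2 * (n%:R * L ^+ 2 * \tr (G - H) / (mu ^+ 2 * \tr H) +
     2 * (L ^+ 2 / mu ^+ 2 * n%:R) * a).
  set N := L ^+ 2 / mu ^+ 2 * n%:R.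
  have N0 : 0 < N by rewrite mulr_gt0 // divr_gt0 ?exprn_gt0.
  have e A B : 0 < \tr B -> n%:R * L ^+ 2 * \tr (A - B) / (mu ^+ 2 * \tr B) =
    N * (\tr A / \tr B - 1).
    by move=> tB; rewrite linearB /= /N; field; rewrite !gt_eqF.
  rewrite !e //.
  have := num N (\tr G / \tr H - 1) N0; apply: le_trans.
  rewrite ler_pM2l // lerD2r linearZ /= [1 + (_ - 1)]addrC subrK.
  rewrite ler_pdivrMr // expr2 -!mulrA ler_pM2l //.
  have h : \tr H <= (1 + a) * \tr H'.
    by have := trace_mono (psd1 R n) HH'; rewrite !mul1mx linearZ.
  have tG : 0 <= \tr G by rewrite trace_psd_nneg //; exact: spd_psd.
  rewrite mulrCA -[leLHS]mulr1 ler_wpM2l //.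
  by rewrite mulrCA ler_pdivlMl // mulr1.
by rewrite /pot_weight; case: opt => /=; rewrite ?mul1r.
Qed.

Definition good_factor K G := opt = OptionII -> invmx G = K^T *m K.

Lemma good_factor_id K G : G \in unitmx -> invmx G = K^T *m K -> K *m G *m K^T = 1%:M.
Proof.
move=> uG h; have e : G *m K^T *m K = 1%:M by rewrite -mulmxA -h mulmxV.
by have := mulmx1C e; rewrite mulmxA.
Qed.

Lemma gain_psd K G H : well_cond H -> loewner H G -> good_factor K G ->
  psd (gain_mx K G H).
Proof.
move=> wH HG; have pH := well_cond_spd wH; have pG := loewner_spd pH HG.
have tH := well_cond_trace_gt0 wH; have [sH sG] := (proj1 pH, proj1 pG).
have sc c : 0 <= c -> psd (c *: (G - H)).
  move=> c0; have := loewner_scale c0 HG; rewrite /loewner -scalerBr //.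
rewrite /good_factor /gain_mx; case: opt => [_|/(_ erefl) hK|_].
- by apply: sc; rewrite invr_ge0 sqr_ge0.
- split; first by rewrite linearB /= !trmx_mul trmxK trmx1 sG inv_sym // !mulmxA.
  move=> v; rewrite -/(bform _ v v) bformBm subr_ge0.
  have hi := loewner_inv pH HG; have uG := spd_unit pG.
  have := loewner_le (G *m K^T *m v) hi.
  have e A : bform A (G *m K^T *m v) (G *m K^T *m v) = bform (K *m G *m A *m G *m K^T) v v.
    by rewrite /bform !trmx_mul !trmxK sG !mulmxA.
  rewrite !e mulmxKV // -{1}(good_factor_id uG hK) //.
- by apply: sc; rewrite divr_ge0 ?mulr_ge0 ?sqr_ge0 ?ler0n ?ltW.
Qed.

Lemma gamma_gt0 : 0 < rqgn_gamma opt n mu L.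
Proof.
case: opt => /=; rewrite ?invr_gt0 ?ltr0n //.
by rewrite divr_gt0 ?mulr_gt0 ?exprn_gt0 ?ltr0n.
Qed.

Lemma gamma_le1 : rqgn_gamma opt n mu L <= 1.
Proof.
have n1 : 1 <= n%:R :> R by rewrite ler1n.
have : mu ^+ 2 <= L ^+ 2 by rewrite ler_pXn2r // nnegrE ltW.
case: opt => /= h; rewrite ?invf_le1 ?ltr0n // ler_pdivrMr ?mulr_gt0 ?exprn_gt0 ?ltr0n //.
by rewrite mul1r (le_trans h) // ler_peMl // sqr_ge0.
Qed.

(** This is where the rate comes from: for Option I, H^-1 is below mu^-2 I, while
    the factor K turns the trace for Option II into that of H^-1 (G - H). *)
Lemma gain_trace K G H : well_cond H -> loewner H G -> good_factor K G ->
  n%:R * rqgn_gamma opt n mu L * pot G H <= \tr (gain_mx K G H).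
Proof.
move=> wH HG; have pH := well_cond_spd wH; have pG := loewner_spd pH HG.
have tH := well_cond_trace_gt0 wH; have [sH sG] := (proj1 pH, proj1 pG).
have nR : n%:R != 0 :> R by rewrite pnatr_eq0 -lt0n.
rewrite /good_factor /gain_mx; case: opt => /= [_|/(_ erefl) hK|_].
- rewrite linearZ /=.
  have hi : loewner (invmx H) ((mu ^+ 2)^-1 *: 1%:M).
    have := loewner_inv (spd_scale (exprn_gt0 2 mu0) (spd1 R n)) (proj1 wH).
    by rewrite inv_scale ?unitmx1 ?invmx1 // gt_eqF // exprn_gt0.
  have h := trace_mono HG hi; rewrite -scalemxAr mulmx1 linearZ /= in h.
  rewrite mxtrace_mulC.
  have -> : n%:R * (mu ^+ 2 / (n%:R * L ^+ 2)) = mu ^+ 2 / L ^+ 2.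
    by field; rewrite nR gt_eqF.
  rewrite mulrAC [leRHS]mulrC ler_wpM2r ?invr_ge0 ?sqr_ge0 //.
  by rewrite mulrC -ler_pdivlMr ?exprn_gt0 // mulrC.
- have uG := spd_unit pG.
  rewrite mulfV // mul1r trace_inv_mul // linearB /= mxtrace1.
  by rewrite lerD2r (mxtrace_mulC _ K^T) !mulmxA -hK mulVmx // mul1mx.
- by rewrite mulfV // mul1r linearZ /= mulrAC.
Qed.

Lemma gain_trace_upper e K G H : 1 <= e -> well_cond H -> loewner H G ->
  loewner G (e *: H) -> good_factor K G ->
  \tr (gain_mx K G H) <= pot_weight * (e - 1).
Proof.
move=> e1 wH HG GH; have pH := well_cond_spd wH; have pG := loewner_spd pH HG.
have [[sH sG] tH] := ((proj1 pH, proj1 pG), well_cond_trace_gt0 wH).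
have e0 : 0 <= e - 1 by rewrite subr_ge0.
have tD : \tr (G - H) <= (e - 1) * \tr H.
  have := trace_mono (psd1 R n) GH; rewrite !mul1mx linearZ /= => h.
  by rewrite linearB /= mulrBl mul1r lerD2r.
have nL : \tr H <= n%:R * L ^+ 2 by case: (well_cond_trace wH).
rewrite /pot_weight /good_factor /gain_mx; case: opt => /= [_|/(_ erefl) hK|_].
- rewrite linearZ /= mul1r ler_pdivrMl ?exprn_gt0 //; apply: le_trans tD _.
  apply: le_trans (ler_wpM2l e0 nL) _.
  by rewrite le_eqVlt; apply/orP; left; apply/eqP; ring.
- have uG := spd_unit pG.
  rewrite linearB /= mxtrace1 (mxtrace_mulC _ K^T) !mulmxA -hK mulVmx // mul1mx.
  have := trace_mono (spd_psd (spd_inv pH)) GH.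
  rewrite -scalemxAr mulVmx ?spd_unit // linearZ /= mxtrace1 => h.
  by rewrite mul1r mulrBr mulr1 lerD2r mulrC.
- rewrite linearZ /= mulrAC ler_pdivrMr ?mulr_gt0 ?exprn_gt0 //.
  have c0 : 0 <= n%:R * L ^+ 2 by rewrite mulr_ge0 ?ler0n ?sqr_ge0.
  apply: le_trans (ler_wpM2l c0 tD) _.
  rewrite le_eqVlt; apply/orP; left; apply/eqP.
  by field; rewrite gt_eqF.
Qed.

(** BFGS along w changes tr (H^-1 G) by 1 - w' G H^-1 G w / w' G w. For w = K' u
    this is exactly the Rayleigh quotient of the gain at u; for w = u it is
    estimated by Cauchy-Schwarz for H and H^-1. SR1 lowers tr G by
    |D u|^2 / u' D u with D = G - H, which is at least u' D u / u' u. *)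
Lemma pot_update K G H u : well_cond H -> loewner H G -> good_factor K G ->
  pot (rqgn_update opt K G H u) H <=
  pot G H - bform (gain_mx K G H) u u / bform 1%:M u u.
Proof.
move=> wH HG; have pH := well_cond_spd wH; have pG := loewner_spd pH HG.
have tH := well_cond_trace_gt0 wH; have [sH sG] := (proj1 pH, proj1 pG).
have [uG uH] := (spd_unit pG, spd_unit pH).
have [->|u0] := eqVneq u 0.
  move=> _; rewrite {1}/bform mulmx0 mxE mul0r subr0.
  have -> : rqgn_update opt K G H 0 = G; last by [].
  by rewrite /rqgn_update /fbfgs /sr1 !mulmx0 eqxx !bfgs0; case: opt.
have tb w : w != 0 -> \tr (invmx H *m (bfgs G H w - H)) =
  \tr (invmx H *m (G - H)) - (bform (G *m invmx H *m G) w w / bform G w w - 1).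
  move=> w0; have hw := spd_gt0 pH w0.
  rewrite !trace_inv_mul // bfgsE mulmxDr mulmxBr !raddfD raddfN /=.
  rewrite -!scalemxAr !mxtraceZ.
  have t B : B^T = B -> \tr (invmx H *m (B *m w *m w^T *m B)) = bform (B *m invmx H *m B) w w.
    move=> sB; have -> : B *m w *m w^T *m B = (B *m w) *m (B *m w)^T.
      by rewrite trmx_mul sB !mulmxA.
    by rewrite trace_outer /bform trmx_mul sB !mulmxA.
  rewrite !t // mulmxV // mul1mx mulVf ?gt_eqF //.
  by rewrite [_^-1 * _]mulrC; ring.
have uu := spd_gt0 (spd1 R n) u0; have guu := spd_gt0 pG u0; have huu := spd_gt0 pH u0.
have duu := psd_ge0 u HG.
have GHG : G *m invmx H *m G = (G - H) *m invmx H *m (G - H) + (G - H) + G.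
  rewrite !mulmxBl !mulmxBr mulmxV // !mul1mx mulmxKV //.
  move: (G *m invmx H *m G) => X; apply/matrixP => i j; rewrite !mxE; ring.
rewrite /good_factor /gain_mx /rqgn_update; case: opt => /= [_|/(_ erefl) hK|_].
- rewrite tb // lerD2l lerN2 bformZm.
  have -> : bform (G *m invmx H *m G) u u = bform ((G - H) *m invmx H *m (G - H)) u u
      + bform (G - H) u u + bform G u u by rewrite -!bformDm -GHG.
  set d := bform (G - H) u u; set x := bform (_ *m _ *m _) u u.
  have cs : d ^+ 2 <= bform H u u * x.
    have := cauchy_schwarz_inv u ((G - H) *m u) pH.
    rewrite -bform_mulr mul1mx.
    by rewrite /x /bform !trmx_mul (psd_sym HG) !mulmxA.
  have guE : bform G u u = d + bform H u u by rewrite /d bformBm subrK.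
  have hL : bform H u u <= L ^+ 2 * bform 1%:M u u.
    by rewrite -bformZm; apply: loewner_le; case: wH.
  apply: (@le_trans _ _ (d / bform H u u)).
    rewrite [_ * d]mulrC -mulrA ler_wpM2l // -invfM lef_pV2 ?posrE // mulr_gt0 ?exprn_gt0 //.
  have -> : (x + d + bform G u u) / bform G u u - 1 = (x + d) / bform G u u.
    by field; rewrite gt_eqF.
  rewrite ler_pdivrMr // mulrAC ler_pdivlMr // guE mulrDr mulrDl -expr2 [x * _]mulrC.
  by rewrite lerD2r.
- rewrite /fbfgs.
  have w0 : K^T *m u != 0.
    apply: contraNneq u0 => h.
    have := good_factor_id uG hK; move/(congr1 (fun A => A *m u)).
    by rewrite mul1mx -mulmxA h mulmx0 => <-.
  rewrite tb // lerD2l lerN2 bformBm mulrBl divff ?gt_eqF // lerD2r.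
  have e A : bform A (K^T *m u) (K^T *m u) = bform (K *m A *m K^T) u u.
    by rewrite /bform trmx_mul trmxK !mulmxA.
  by rewrite !e (good_factor_id uG hK) !mulmxA.
- have tl : bform (G - H) u u / bform 1%:M u u <= \tr (G - sr1 G H u).
    have [du|du] := eqVneq ((G - H) *m u) 0.
      rewrite /sr1 du eqxx subrr linear0 /=.
      by rewrite /bform -!mulmxA du mulmx0 mxE mul0r.
    rewrite /sr1 (negbTE du) subKr linearZ /=.
    have d0 : 0 < bform (G - H) u u.
      rewrite lt0r psd_ge0 // andbT; apply: contraNneq du => h.
      by rewrite (psd_mul_eq0 HG h).
    have -> : (G - H) *m u *m u^T *m (G - H) = ((G - H) *m u) *m ((G - H) *m u)^T.
      by rewrite trmx_mul (psd_sym HG) !mulmxA.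
    rewrite -(mul1mx (_ *m _^T)) trace_outer -/(bform (G - H) u u).
    rewrite ler_pdivrMr // -mulrA [leRHS]mulrC ler_pdivlMr // -expr2.
    have := psd_cauchy_schwarz u ((G - H) *m u) (psd1 R n).
    by rewrite -bform_mulr mul1mx mulrC.
  have -> : \tr (sr1 G H u - H) = \tr (G - H) - \tr (G - sr1 G H u).
    by rewrite -linearB /= opprB [X in _ = \tr X]addrC subrKA.
  rewrite bformZm.
  have c0 : 0 <= n%:R * L ^+ 2 / (mu ^+ 2 * \tr H).
    by rewrite divr_ge0 ?mulr_ge0 ?sqr_ge0 ?ler0n ?ltW.
  move: tl c0; set c := n%:R * L ^+ 2; set x := bform (G - H) u u / _; set m := mu ^+ 2 * _.
  move=> tl c0; rewrite -[c / m * _ / _]mulrA -/x mulrBr mulrBl lerD2l lerN2.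
  by rewrite [leRHS]mulrAC ler_wpM2l.
Qed.

End Potential.

(** * Euclidean norm, spectral norm and singular values *)

Section EuclideanNorm.
Variable R : realType.
Implicit Types (n m : nat).

Lemma enorm_ge0 n (v : 'cV[R]_n) : 0 <= enorm v.
Proof. exact: sqrtr_ge0. Qed.

Lemma bform1_enorm n (v : 'cV[R]_n) : bform 1%:M v v = enorm v ^+ 2.
Proof.
rewrite bform1 sqr_sqrtr; last by apply: sumr_ge0 => i _; exact: sqr_ge0.
by apply: eq_bigr => i _; rewrite expr2.
Qed.

Lemma enorm_le_sqr n m (v : 'cV[R]_n) (w : 'cV[R]_m) (a : R) : 0 <= a ->
  bform 1%:M v v <= a ^+ 2 * bform 1%:M w w -> enorm v <= a * enorm w.
Proof.
move=> a0; rewrite !bform1_enorm -exprMn ler_pXn2r ?nnegrE ?enorm_ge0 //.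
by rewrite mulr_ge0 // enorm_ge0.
Qed.

Lemma enorm_gt0 n (v : 'cV[R]_n) : v != 0 -> 0 < enorm v.
Proof.
move=> /(spd_gt0 (spd1 R n)); rewrite bform1_enorm lt0r => /andP[h _].
by rewrite lt0r enorm_ge0 andbT; apply: contraNneq h => ->; rewrite expr0n.
Qed.

Lemma enormZ n a (v : 'cV[R]_n) : enorm (a *: v) = `|a| * enorm v.
Proof.
apply: (@pexpIrn R 2) => //; rewrite ?nnegrE ?mulr_ge0 ?enorm_ge0 //.
by rewrite -bform1_enorm bformZl bformZr bform1_enorm exprMn real_normK ?num_real // mulrA.
Qed.

Lemma enorm0 n : enorm (0 : 'cV[R]_n) = 0.
Proof. by rewrite -(scale0r 0) enormZ normr0 mul0r. Qed.

Lemma dot_le_enorm n (u v : 'cV[R]_n) : `|bform 1%:M u v| <= enorm u * enorm v.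
Proof.
rewrite -(ler_pXn2r (ltn0Sn 1)) ?nnegrE ?mulr_ge0 ?enorm_ge0 //.
rewrite real_normK ?num_real // exprMn -!bform1_enorm.
exact: psd_cauchy_schwarz (psd1 R n).
Qed.

Lemma enormD n (u v : 'cV[R]_n) : enorm (u + v) <= enorm u + enorm v.
Proof.
rewrite -(ler_pXn2r (ltn0Sn 1)) ?nnegrE ?addr_ge0 ?enorm_ge0 //.
rewrite -bform1_enorm bformDl !bformDr (bformC v u (trmx1 _ _)) !bform1_enorm.
have := le_trans (ler_norm _) (dot_le_enorm u v); set b := bform _ u v.
set x := enorm u; set y := enorm v; nra.
Qed.

Lemma enormN n (v : 'cV[R]_n) : enorm (- v) = enorm v.
Proof. by rewrite -scaleN1r enormZ normrN1 mul1r. Qed.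

Lemma enormB_le n (u v : 'cV[R]_n) : enorm u - enorm v <= enorm (u - v).
Proof. by rewrite lerBlDr; rewrite -{1}(subrK v u) enormD. Qed.

Lemma mulmx_enorm_bounded n m (A : 'M[R]_(n, m)) :
  exists c, 0 <= c /\ forall v, enorm (A *m v) <= c * enorm v.
Proof.
exists (Num.sqrt (\sum_i \sum_j A i j ^+ 2)); split => [|v]; first exact: sqrtr_ge0.
apply: enorm_le_sqr; first exact: sqrtr_ge0.
rewrite sqr_sqrtr; last first.
  by apply: sumr_ge0 => i _; apply: sumr_ge0 => j _; exact: sqr_ge0.
rewrite {1}bform1 mulr_suml; apply: ler_sum => i _.
have e : (A *m v) i 0 = bform 1%:M (row i A)^T v.
  by rewrite bform1 mxE; apply: eq_bigr => j _; rewrite !mxE.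
rewrite -expr2 e; apply: le_trans (psd_cauchy_schwarz _ _ (psd1 R m)) _.
apply: ler_wpM2r; first exact: psd_ge0 (psd1 _ _).
rewrite bform1.
by apply: ler_sum => j _; rewrite !mxE expr2.
Qed.

Lemma spectral_norm_le n m (A : 'M[R]_(n, m)) v :
  enorm (A *m v) <= spectral_norm A * enorm v.
Proof.
have [c [c0 hc]] := mulmx_enorm_bounded A.
have [->|v0] := eqVneq v 0; first by rewrite mulmx0 !enorm0 mulr0.
have pv := enorm_gt0 v0.
rewrite -ler_pdivrMr //.
have -> : enorm (A *m v) / enorm v = enorm (A *m ((enorm v)^-1 *: v)).
  by rewrite -scalemxAr enormZ gtr0_norm ?invr_gt0 // mulrC.
apply: sup_upper_bound; last first.
  exists ((enorm v)^-1 *: v) => //=.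
  by rewrite enormZ gtr0_norm ?invr_gt0 // mulVf ?gt_eqF.
split; first by exists (enorm (A *m 0)); exists 0 => //=; rewrite enorm0.
exists c => _ [w /= hw <-]; apply: le_trans (hc w) _.
by rewrite ler_piMr.
Qed.

Lemma spectral_norm_ge0 n m (A : 'M[R]_(n, m)) : 0 <= spectral_norm A.
Proof.
have [c [c0 hc]] := mulmx_enorm_bounded A.
have -> : 0 = enorm (A *m 0) by rewrite mulmx0 enorm0.
apply: sup_upper_bound; last by exists 0 => //=; rewrite enorm0.
split; first by exists (enorm (A *m 0)); exists 0 => //=; rewrite enorm0.
exists c => _ [w /= hw <-]; apply: le_trans (hc w) _.
by rewrite ler_piMr.
Qed.

Lemma bform_gram n m (A : 'M[R]_(n, m)) v :
  bform (A *m A^T) v v = enorm (A^T *m v) ^+ 2.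
Proof. by rewrite -bform1_enorm /bform trmx_mul trmxK mulmx1 !mulmxA. Qed.

Lemma gram_sym n m (A : 'M[R]_(n, m)) : (A *m A^T)^T = A *m A^T.
Proof. by rewrite trmx_mul trmxK. Qed.

Lemma tr_enorm_le n m (A : 'M[R]_(n, m)) c : 0 <= c ->
  (forall w, enorm (A *m w) <= c * enorm w) ->
  forall v, enorm (A^T *m v) <= c * enorm v.
Proof.
move=> c0 h v; have [->|z] := eqVneq (A^T *m v) 0.
  by rewrite enorm0 mulr_ge0 // enorm_ge0.
rewrite -(ler_pM2l (enorm_gt0 z)) -expr2 -bform_gram.
have -> : bform (A *m A^T) v v = bform 1%:M v (A *m (A^T *m v)).
  by rewrite /bform mulmx1 !mulmxA.
apply: le_trans (le_trans (ler_norm _) (dot_le_enorm _ _)) _.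
apply: le_trans (ler_wpM2l (enorm_ge0 _) (h _)) _.
by rewrite mulrCA [leRHS]mulrCA ler_wpM2l // mulrC.
Qed.

Lemma trmx_spectral_norm_le n m (A : 'M[R]_(n, m)) v c : spectral_norm A <= c ->
  enorm (A^T *m v) <= c * enorm v.
Proof.
move=> h; apply: tr_enorm_le; first exact: le_trans (spectral_norm_ge0 A) h.
by move=> w; apply: le_trans (spectral_norm_le _ _) _; rewrite ler_wpM2r // enorm_ge0.
Qed.

(** The supremum s of the shifts with s I below A is attained. If it were less
    than m, the matrix A - s I would be semidefinite and invertible, hence
    definite, hence above a positive multiple of I: a larger shift would do. *)
Lemma loewner_of_shift_unit n (A : 'M[R]_n) (m : R) : (0 < n)%N -> A^T = A ->
  (forall s, s < m -> A - s *: 1%:M \in unitmx) -> loewner (m *: 1%:M) A.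
Proof.
move=> n0 sA hu; pose S := [set s | loewner (s *: 1%:M) A].
have s1 s : (s *: 1%:M : 'M[R]_n)^T = s *: 1%:M by rewrite linearZ /= trmx1.
have down s t : s <= t -> S t -> S s.
  by move=> st; apply: loewner_trans; apply: loewner_scalel => //; exact: psd1.
have [//|nm] := pselect (S m).
have ub : ubound S m.
  by move=> s Ss; rewrite leNgt; apply/negP => /ltW /down /(_ Ss).
have [c [c0 hc]] := mulmx_enorm_bounded A.
have neS : S !=set0.
  exists (- c); apply: loewnerP => // v.
  rewrite bformZm bform1_enorm mulNr lerNl.
  have -> : bform A v v = bform 1%:M v (A *m v) by rewrite -bform_mulr mul1mx.
  apply: le_trans (le_trans (ler_norm _) _) (_ : enorm v * enorm (A *m v) <= _).
    by rewrite normrN; exact: dot_le_enorm.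
  apply: le_trans (ler_wpM2l (enorm_ge0 _) (hc _)) _.
  by rewrite mulrCA expr2.
have hS : has_sup S by split => //; exists m.
pose s := sup S.
have Ss : S s.
  apply: loewnerP => // v; apply/ler_addgt0Pr => e e0.
  have [->|v0] := eqVneq v 0; first by rewrite /bform !mulmx0 mxE add0r ltW.
  have pv := spd_gt0 (spd1 R n) v0.
  have [t St tl] := sup_adherent (divr_gt0 e0 pv) hS.
  have := loewner_le v St; rewrite !bformZm -(lerD2r e) => /(le_trans _); apply.
  rewrite -lerBlDl -mulrBl -ler_pdivlMr //; rewrite -/s in tl; lra.
have sm : s < m.
  rewrite lt_neqAle sup_le_ub // andbT; apply/eqP => e; apply: nm.
  by rewrite -e.
pose B := A - s *: 1%:M.
have pB : spd B.
  split; first exact: psd_sym Ss.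
  move=> v v0; rewrite -/(bform B v v) lt0r psd_ge0 // andbT.
  apply: contraNneq v0 => /(psd_mul_eq0 Ss) h.
  by rewrite -(mulKmx (hu s sm) v) h mulmx0.
have := loewner_trace pB (psd1 R n); rewrite mulmx1.
set tau := \tr _ => htau.
have tau0 : 0 < tau.
  pose v : 'cV[R]_n := const_mx 1.
  have v0 : v != 0.
    apply/eqP => /matrixP /(_ (Ordinal n0) 0); rewrite !mxE => /eqP.
    by rewrite oner_eq0.
  have := loewner_le v htau; rewrite bformZm.
  have h1 := spd_gt0 (spd1 R n) v0; have h2 := spd_gt0 pB v0.
  by move=> /(lt_le_trans h1); rewrite pmulr_lgt0.
have : S (s + tau^-1).
  apply: loewnerP => // v; rewrite bformZm mulrDl -lerBrDl.
  have := loewner_le v htau; rewrite bformZm bformBm bformZm.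
  by rewrite ler_pdivrMl.
move/(sup_upper_bound hS); rewrite -/s gerDl.
by rewrite leNgt invr_gt0 tau0.
Qed.

(** The eigenvalues of A A^T are the squares of the singular values, so every
    shift below mu^2 is invertible. *)
Lemma sing_val_loewner n d (A : 'M[R]_(n, d)) (mu : R) : (0 < n)%N -> 0 < mu ->
  mu <= sing_val n A -> loewner (mu ^+ 2 *: 1%:M) (A *m A^T).
Proof.
move=> n0 mu0; rewrite /sing_val.
have [ex|no] := pselect (exists s, is_singular_values A s); last first.
  rewrite xgetPN; first by rewrite nth_nil leNgt mu0.
  by move=> s hs; apply: no; exists s.
move: (xgetPex [::] ex); move: (xget _ _) => s [srt pos cp] hmu.
have sz : size s = n.
  by apply: succn_inj; rewrite -(size_char_poly (A *m A^T)) cp size_prod_XsubC.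
apply: loewner_of_shift_unit => //; first exact: gram_sym.
move=> a ha; rewrite -row_free_unit -kermx_eq0 scalemx1.
have : ~~ eigenvalue (A *m A^T) a.
  rewrite eigenvalue_root_char cp rootE horner_prod prodf_seq_neq0.
  apply/allP => b bs /=; rewrite !hornerE subr_eq0 lt_eqF //.
  apply: lt_le_trans ha _; rewrite ler_pXn2r ?nnegrE ?(ltW mu0) //; last exact: (allP pos).
  apply: le_trans hmu _.
  rewrite -(nth_index 0 bs).
  apply: (sorted_leq_nth (leT := >=%R)) => //.
  - by move=> x y z /= h1 h2; exact: le_trans h2 h1.
  - by move=> x /=; exact: lexx.
  - by rewrite inE index_mem.
  - by rewrite inE sz prednK.
  - by rewrite -ltnS prednK // -sz index_mem.
by rewrite negbK.
Qed.

End EuclideanNorm.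

(** * Taylor remainder for a Lipschitz Jacobian *)

Section Calculus.
Variables (R : realType) (n d : nat) (F : 'cV[R]_d -> 'cV[R]_n).
Hypothesis dF : forall y, differentiable F y.
Implicit Types (x y h v : 'cV[R]_d).

Lemma diff_jac x v : 'd F x v = jac F x *m v.
Proof.
rewrite [in LHS](_ : v = \sum_j v j 0 *: delta_mx j 0); last first.
  apply/matrixP => i j; rewrite ord1 summxE (bigD1 i) //= big1 => [|k ki].
    by rewrite !mxE !eqxx mulr1 addr0.
  by rewrite !mxE eq_sym (negbTE ki) mulr0.
rewrite linear_sum /=; apply/matrixP => i j; rewrite ord1 summxE mxE.
by apply: eq_bigr => k _; rewrite linearZ /= !mxE mulrC.
Qed.

Lemma is_derive_line (i : 'I_n) x h t :
  is_derive (t : R) 1 (fun s : R => F (x + s *: h) i 0) ((jac F (x + t *: h) *m h) i 0).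
Proof.
pose c := (cst x : R -> 'cV[R]_d) + *:%R ^~ h.
have dc : is_diff t c (0 + *:%R ^~ h) by exact: is_diffD.
have dFc : is_diff (c t) F ('d F (c t)) by apply: DiffDef.
have dFc' := is_diff_comp dc dFc.
have dG := differentiable_coord ((F \o c) t) i 0.
have @f : {linear 'cV[R]_n -> R}.
  by exists (fun N : 'cV[R]_n => N i 0); do 2![eexists]; do ?[constructor];
     rewrite ?mxE// => ? *; rewrite ?mxE//; move=> ?; rewrite !mxE.
have df : is_diff ((F \o c) t) f f.
  by apply: DiffDef => //; rewrite diff_lin //; exact: coord_continuous.
have D := is_diff_comp dFc' df.
have e : (fun s : R => F (x + s *: h) i 0) = f \o (F \o c) by [].
rewrite e; apply: DeriveDef.
  by apply: diff_derivable; exact: ex_diff.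
rewrite deriveE; last exact: ex_diff.
by rewrite diff_val /= !fctE /= add0r scale1r diff_jac.
Qed.

Lemma is_derive_test m (g : 'I_m -> R -> R) (a dg : 'I_m -> R) (c b s : R) :
  (forall i, is_derive (s : R) 1 (g i) (dg i)) ->
  is_derive (s : R) 1 (fun t : R => \sum_i a i * g i t - (t * c + t ^+ 2 * (b / 2)))
    (\sum_i a i * dg i - (c + s * b)).
Proof.
move=> dgi.
have di i : is_derive s 1 (a i *: g i) (a i *: dg i) by exact: is_deriveZ.
have D1 := is_derive_sum di.
have D2 := is_deriveZ c (is_derive_id (s : R) (1 : R)).
have D3 := is_deriveZ (b / 2) (is_deriveX 2 (is_derive_id (s : R) (1 : R))).
have := is_deriveB D1 (is_deriveD D2 D3).
set f := (X in is_derive _ _ X _); set df := (X in is_derive _ _ _ X).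
have -> : f = fun t : R => \sum_i a i * g i t - (t * c + t ^+ 2 * (b / 2)).
  apply/funext => t; rewrite /f !fctE /= fct_sumE; congr (_ - (_ + _)).
    by rewrite /GRing.scale /= mulrC.
  exact: mulrC.
suff -> : df = \sum_i a i * dg i - (c + s * b) by [].
by rewrite /df /GRing.scale /=; field.
Qed.

(** Comparison with the quadratic t^2 l |h|^2 |a| / 2 along the segment, tested
    against a fixed vector a, for which the remainder itself is taken. *)
Lemma taylor_bound l : 0 <= l ->
  (forall y z, spectral_norm (jac F y - jac F z) <= l * enorm (y - z)) ->
  forall x h, enorm (F (x + h) - F x - jac F x *m h) <= l / 2 * enorm h ^+ 2.
Proof.
move=> l0 hl x h.
have [J0 J0E] : exists J0, J0 = jac F x := ex_intro _ _ erefl.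
rewrite -J0E; set a := F (x + h) - F x - J0 *m h.
pose b := l * enorm h ^+ 2 * enorm a.
pose psi (t : R) : R := \sum_i a i 0 * (F (x + t *: h) i 0) -
  (t * bform 1%:M a (J0 *m h) + t ^+ 2 * (b / 2)).
have dpsi s : is_derive (s : R) 1 psi
    (\sum_i a i 0 * (jac F (x + s *: h) *m h) i 0 -
      (bform 1%:M a (J0 *m h) + s * b)).
  by apply: is_derive_test => i; exact: is_derive_line.
have ps0 (s : R) : 0 <= s -> derive1 psi s <= 0.
  move=> s0; rewrite derive1E derive_val.
  have [J1 J1E] : exists J1, J1 = jac F (x + s *: h) := ex_intro _ _ erefl.
  rewrite -J1E -bform1 opprD addrA -bformNr -bformDr -mulmxBl subr_le0.
  apply: le_trans (le_trans (ler_norm _) (dot_le_enorm _ _)) _.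
  rewrite /b mulrA [leLHS]mulrC ler_wpM2r ?enorm_ge0 //.
  apply: le_trans (spectral_norm_le _ _) _.
  rewrite expr2 !mulrA ler_wpM2r ?enorm_ge0 // J0E J1E.
  apply: le_trans (hl _ _) _.
  by rewrite addrC addKr enormZ ger0_norm // mulrCA mulrA.
have p10 : psi 1 <= psi 0.
  apply: (@ler0_derive1_le_cc _ psi 0 1) => //.
  - by move=> s; rewrite in_itv /= => /andP[/ltW s0 _]; exact: ps0.
  - apply: derivable_within_continuous => s _; exact: ex_derive.
  - by rewrite in_itv /= lexx ler01.
  - by rewrite in_itv /= lexx ler01.
have : enorm a ^+ 2 <= b / 2.
  rewrite -bform1_enorm {2}/a !bformDr !bformNr.
  move: p10; rewrite /psi.
  have -> : \sum_i a i 0 * F (x + 1 *: h) i 0 = bform 1%:M a (F (x + h)).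
    by rewrite scale1r bform1.
  have -> : \sum_i a i 0 * F (x + 0 *: h) i 0 = bform 1%:M a (F x).
    by rewrite scale0r addr0 bform1.
  rewrite expr1n expr0n /= !mul1r !mul0r addr0 subr0 => ?; lra.
have [->|a0] := eqVneq a 0.
  by rewrite enorm0 mulr_ge0 ?sqr_ge0 // divr_ge0.
have pa := enorm_gt0 a0.
have -> : b / 2 = enorm a * (l / 2 * enorm h ^+ 2) by rewrite /b; field.
by rewrite expr2 ler_pM2l.
Qed.

End Calculus.

(** * The relative condition ratio *)

Section LoewnerRatio.
Variables (R : realType) (n : nat).
Implicit Types (G H : 'M[R]_n).
Hypothesis n0 : (0 < n)%N.

Let one_vec : exists v : 'cV[R]_n, v != 0.
Proof.
exists (const_mx 1); apply/eqP => /matrixP /(_ (Ordinal n0) 0); rewrite !mxE.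
by move/eqP; rewrite oner_eq0.
Qed.

Lemma ratio_lbound G H e : spd H -> loewner H G -> loewner G (e *: H) -> 1 <= e.
Proof.
move=> pH HG GH; have [v v0] := one_vec.
have := loewner_le v (loewner_trans HG GH); rewrite bformZm.
by rewrite -{1}[bform H v v]mul1r ler_pM2r //; exact: spd_gt0.
Qed.

Let ratio_inf G H : spd H -> loewner H G ->
  has_inf [set e : R | loewner H G /\ loewner G (e *: H)].
Proof.
move=> pH HG; split.
  exists (1 + \tr (invmx H *m (G - H))); split => //.
  have := loewner_trace pH HG; rewrite /loewner opprB addrA scalerDl scale1r.
  by rewrite [H + _]addrC.
by exists 1 => e [_]; exact: ratio_lbound.
Qed.

Lemma loewner_ratioP G H : spd H -> loewner H G ->
  loewner G (loewner_ratio G H *: H).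
Proof.
move=> pH HG; have hI := ratio_inf pH HG.
have [sH sG] := (proj1 pH, loewner_symr (proj1 pH) HG).
apply: loewnerP; rewrite ?linearZ /= ?sH // => v; apply/ler_addgt0Pr => e e0.
have [->|v0] := eqVneq v 0; first by rewrite /bform !mulmx0 mxE add0r ltW.
have pv := spd_gt0 pH v0.
have [t [_ St] tl] := inf_adherent (divr_gt0 e0 pv) hI.
apply: le_trans (loewner_le v St) _; rewrite !bformZm -lerBlDl -mulrBl.
by rewrite -ler_pdivlMr // lerBlDl ltW.
Qed.

Lemma loewner_ratio_le G H e : spd H -> loewner H G -> loewner G (e *: H) ->
  loewner_ratio G H <= e.
Proof.
move=> pH HG GH; apply: ge_inf; first by case: (ratio_inf pH HG).
by split.
Qed.

Lemma loewner_ratio_ge1 G H : spd H -> loewner H G -> 1 <= loewner_ratio G H.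
Proof. by move=> pH HG; exact: ratio_lbound pH HG (loewner_ratioP pH HG). Qed.

End LoewnerRatio.

(** * One step of the iteration *)

Section OneStep.
Variables (R : realType) (n d : nat) (F : 'cV[R]_d -> 'cV[R]_n) (L L2 mu : R).
Hypotheses (n0 : (0 < n)%N) (dF : forall y, differentiable F y).
Hypotheses (L0 : 0 < L) (L20 : 0 < L2) (mu0 : 0 < mu).
Hypothesis JL : forall y, spectral_norm (jac F y) <= L.
Hypothesis JLip : forall y z,
  spectral_norm (jac F y - jac F z) <= L2 * enorm (y - z).
Hypothesis Jmu : forall y, Omega_under F mu L2 y -> mu <= sing_val n (jac F y).
Implicit Types (x y : 'cV[R]_d) (G H K : 'M[R]_n) (u v w : 'cV[R]_n).

Let M := 2 * L * L2 / mu ^+ 2.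
Let M0 : 0 < M. Proof. by rewrite divr_gt0 ?mulr_gt0 ?exprn_gt0. Qed.
Notation Om := (Omega_under F mu L2).
Notation lam := (lambda_under F).

Lemma gram_well_cond y : Om y -> well_cond mu L (gram F y).
Proof.
move=> Oy; split; first exact: sing_val_loewner (Jmu Oy).
apply: loewnerP; rewrite ?linearZ /= ?trmx1 //; first exact: gram_sym.
move=> v; rewrite bform_gram bformZm bform1_enorm -exprMn.
rewrite ler_pXn2r ?nnegrE ?mulr_ge0 ?enorm_ge0 ?(ltW L0) //.
exact: trmx_spectral_norm_le.
Qed.

Lemma gram_spd y : Om y -> spd (gram F y).
Proof. by move/gram_well_cond; exact: well_cond_spd. Qed.

Lemma mu_le_L y : Om y -> mu <= L.
Proof.
move=> Oy; have [h1 h2] := gram_well_cond Oy.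
have := loewner_le (delta_mx (Ordinal n0) 0) (loewner_trans h1 h2).
rewrite !bformZm bform_delta mxE eqxx !mulr1 ler_pXn2r // nnegrE ltW //.
Qed.

(** |A' v|^2 - |B' v|^2 factors as a difference, bounded by l |v|, times a sum,
    bounded by 2 L |v|; and mu^2 |v|^2 is at most |B' v|^2. *)
Lemma gram_perturb (A B : 'M[R]_(n, d)) l :
  loewner (mu ^+ 2 *: 1%:M) (B *m B^T) -> spectral_norm A <= L ->
  spectral_norm B <= L -> spectral_norm (A - B) <= l ->
  loewner (A *m A^T) ((1 + 2 * L * l / mu ^+ 2) *: (B *m B^T)).
Proof.
move=> h hA hB hAB; apply: loewnerP; rewrite ?linearZ /= ?gram_sym //.
move=> v; rewrite bformZm mulrDl mul1r -lerBlDl !bform_gram.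
set a := enorm (A^T *m v); set b := enorm (B^T *m v).
have ab : a - b <= l * enorm v.
  apply: le_trans (enormB_le _ _) _; rewrite -mulmxBl -linearB /=.
  exact: trmx_spectral_norm_le.
have aL : a <= L * enorm v by exact: trmx_spectral_norm_le.
have bL : b <= L * enorm v by exact: trmx_spectral_norm_le.
have hb : mu ^+ 2 * enorm v ^+ 2 <= b ^+ 2.
  by have := loewner_le v h; rewrite bformZm bform1_enorm bform_gram.
have [a0 b0] : 0 <= a /\ 0 <= b by rewrite !enorm_ge0.
have l0 : 0 <= l by exact: le_trans (spectral_norm_ge0 _) hAB.
have v0 : 0 <= enorm v by exact: enorm_ge0.
apply: (@le_trans _ _ (2 * L * l / mu ^+ 2 * (mu ^+ 2 * enorm v ^+ 2))); last first.
  by rewrite ler_wpM2l // divr_ge0 ?sqr_ge0 // !mulr_ge0 // ltW.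
have -> : 2 * L * l / mu ^+ 2 * (mu ^+ 2 * enorm v ^+ 2) =
    (l * enorm v) * (L * enorm v + L * enorm v).
  by field; rewrite gt_eqF.
rewrite subr_sqr; apply: (@le_trans _ _ (l * enorm v * (a + b))).
  by rewrite ler_wpM2r // addr_ge0.
by rewrite ler_wpM2l ?lerD // !mulr_ge0.
Qed.

Lemma gram_drift x y : Om x ->
  loewner (gram F y) ((1 + M * enorm (y - x)) *: gram F x).
Proof.
move=> Ox; have [h _] := gram_well_cond Ox.
have -> : M * enorm (y - x) = 2 * L * (L2 * enorm (y - x)) / mu ^+ 2.
  by rewrite /M; move: (enorm _) => z; field; rewrite gt_eqF.
by apply: gram_perturb.
Qed.

Lemma lambda_sqr x : Om x -> lam x ^+ 2 = bform (invmx (gram F x)) (F x) (F x).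
Proof.
by move=> /gram_spd /spd_inv /spd_psd h; rewrite sqr_sqrtr //; exact: psd_ge0.
Qed.

Lemma lambda_ge0 x : 0 <= lam x.
Proof. exact: sqrtr_ge0. Qed.

Section Step.
Variables (x : 'cV[R]_d) (G : 'M[R]_n).
Hypotheses (Ox : Om x) (HG : loewner (gram F x) G).
Let H := gram F x.
Let pH : spd H := gram_spd Ox.
Let pG : spd G := loewner_spd pH HG.
Let sH : H^T = H := proj1 pH.
Let sG : G^T = G := proj1 pG.
Let uH : H \in unitmx := spd_unit pH.
Let uG : G \in unitmx := spd_unit pG.
Let x' := rqgn_next_x F (x, G).
Let r := enorm (x' - x).

Let step_dir : x' - x = - ((jac F x)^T *m (invmx G *m F x)).
Proof. by rewrite /x' /rqgn_next_x /= addrC addKr mulmxA. Qed.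

(** The squared step is F' G^-1 H G^-1 F, where H is below G and G^-1 below H^-1. *)
Lemma step_le_lambda : r <= lam x.
Proof.
rewrite -(ler_pXn2r (ltn0Sn 1)) ?nnegrE ?enorm_ge0 ?lambda_ge0 //.
rewrite lambda_sqr // /r step_dir enormN -bform_gram.
apply: le_trans (loewner_le _ HG) _; rewrite bform_inv //.
exact: loewner_le (loewner_inv pH HG).
Qed.

(** With E = H^-1 - G^-1, which lies between 0 and (1 - 1/e) H^-1, the residual
    of the linearized step is H E F(x); applying Cauchy-Schwarz for E to F(x)
    and H E F(x) bounds its H^-1-norm by (1 - 1/e) times that of F(x). *)
Lemma linear_residual e : 1 <= e -> loewner G (e *: H) ->
  Num.sqrt (bform (invmx H) (F x - H *m (invmx G *m F x)) (F x - H *m (invmx G *m F x)))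
    <= (1 - e^-1) * lam x.
Proof.
move=> e1 GH; have e0 : 0 < e by exact: lt_le_trans e1.
pose E := invmx H - invmx G; pose c := 1 - e^-1.
have c0 : 0 <= c by rewrite subr_ge0 invf_le1.
have pE : psd E := loewner_inv pH HG.
have hE v : bform E v v <= c * bform (invmx H) v v.
  have := loewner_le v (loewner_inv pG GH).
  rewrite inv_scale ?gt_eqF // bformZm /E bformBm /c mulrBl mul1r.
  by rewrite lerD2l lerN2.
have -> : F x - H *m (invmx G *m F x) = H *m (E *m F x).
  by rewrite mulmxBl mulmxBr mulKVmx.
set b := H *m (E *m F x); set q := bform (invmx H) b b.
have q0 : 0 <= q by apply: psd_ge0; exact/spd_psd/spd_inv.
have qE : q = bform E (F x) b.
  have sE : E^T = E := psd_sym pE.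
  have -> : q = ((F x)^T *m E^T *m H^T *m invmx H *m b) 0 0.
    by rewrite /q /bform {1}/b !trmx_mul !mulmxA.
  by rewrite sE sH mulmxK.
have h : q <= c ^+ 2 * lam x ^+ 2.
  have [->|qn] := eqVneq q 0; first by rewrite mulr_ge0 // sqr_ge0.
  have qp : 0 < q by rewrite lt0r qn.
  have := psd_cauchy_schwarz (F x) b pE; rewrite -qE => h.
  rewrite -(ler_pM2r qp) -expr2; apply: le_trans h _.
  rewrite lambda_sqr // -/H expr2 -[c * c * _]mulrA mulrAC [leRHS]mulrC.
  by apply: ler_pM; rewrite ?psd_ge0 //; exact: hE.
rewrite -(ler_pXn2r (ltn0Sn 1)) ?nnegrE ?sqrtr_ge0 ?mulr_ge0 ?lambda_ge0 //.
by rewrite sqr_sqrtr // exprMn.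
Qed.

(** The Taylor remainder costs L2 / (2 mu) r^2, and r is at most lambda. *)
Lemma residual_bound e : 1 <= e -> loewner G (e *: H) ->
  Num.sqrt (bform (invmx H) (F x') (F x')) <= (1 - e^-1 + M * lam x / 4) * lam x.
Proof.
move=> e1 GH; pose w := F x' - F x - jac F x *m (x' - x).
have -> : F x' = (F x - H *m (invmx G *m F x)) + w.
  have -> : H *m (invmx G *m F x) = - (jac F x *m (x' - x)).
    by rewrite step_dir mulmxN opprK [RHS]mulmxA.
  rewrite /w; move: (jac F x *m _) (F x') (F x) => a b c.
  by apply/matrixP => i j; rewrite !mxE; ring.
apply: le_trans (psd_triangle _ _ (spd_psd (spd_inv pH))) _.
rewrite mulrDl lerD ?linear_residual //.
have [hlow _] := gram_well_cond Ox.
have hi : bform (invmx H) w w <= mu ^- 2 * enorm w ^+ 2.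
  have pmu : spd (mu ^+ 2 *: 1%:M : 'M[R]_n).
    by apply: spd_scale; [exact: exprn_gt0|exact: spd1].
  have := loewner_le w (loewner_inv pmu hlow).
  by rewrite inv_scale ?unitmx1 ?gt_eqF ?exprn_gt0 // invmx1 bformZm bform1_enorm.
have hw : enorm w <= L2 / 2 * lam x ^+ 2.
  have := taylor_bound dF (ltW L20) JLip x (x' - x).
  rewrite [x + _]addrC subrK -/w => /le_trans; apply.
  rewrite ler_wpM2l ?divr_ge0 ?(ltW L20) // ler_pXn2r ?nnegrE ?enorm_ge0 ?lambda_ge0 //.
  exact: step_le_lambda.
have muL := mu_le_L Ox.
apply: (@le_trans _ _ (mu^-1 * enorm w)).
  rewrite -(ler_pXn2r (ltn0Sn 1)) ?nnegrE ?sqrtr_ge0 ?mulr_ge0 ?invr_ge0 ?enorm_ge0 ?(ltW mu0) //.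
  rewrite sqr_sqrtr; last by apply: psd_ge0; exact/spd_psd/spd_inv.
  by rewrite exprMn exprVn.
rewrite mulrC ler_pdivrMr //; apply: le_trans hw _.
have -> : M * lam x / 4 * lam x * mu = (L / mu) * (L2 / 2 * lam x ^+ 2).
  by rewrite /M; field; rewrite gt_eqF.
rewrite ler_peMl //; last by rewrite ler_pdivlMr // mul1r.
by rewrite mulr_ge0 ?sqr_ge0 // divr_ge0 // ltW.
Qed.

Lemma step_stays e : 1 <= e -> loewner G (e *: H) ->
  1 - e^-1 + M * lam x / 4 <= 1 -> L * lam x <= mu ^+ 2 / (2 * L2) -> Om x'.
Proof.
move=> e1 GH c1 hl; rewrite /Omega_under /=; apply: le_trans hl.
have [_ hup] := gram_well_cond Ox.
have hi : enorm (F x') ^+ 2 <= L ^+ 2 * bform (invmx H) (F x') (F x').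
  have := loewner_le (F x') (loewner_inv pH hup).
  rewrite inv_scale ?unitmx1 ?gt_eqF ?exprn_gt0 // invmx1 bformZm bform1_enorm.
  by rewrite -ler_pdivrMl ?exprn_gt0.
have q0 : 0 <= bform (invmx H) (F x') (F x') by apply: psd_ge0; exact/spd_psd/spd_inv.
apply: (@le_trans _ _ (L * Num.sqrt (bform (invmx H) (F x') (F x')))).
  rewrite -(ler_pXn2r (ltn0Sn 1)) ?nnegrE ?enorm_ge0 ?mulr_ge0 ?sqrtr_ge0 ?(ltW L0) //.
  by rewrite exprMn [X in _ * X]sqr_sqrtr.
rewrite ler_pM2l //; apply: le_trans (residual_bound e1 GH) _.
by rewrite ler_piMl // lambda_ge0.
Qed.

Hypothesis Ox' : Om x'.

(** Passing from the norm of H^-1 to that of the next Gram matrix costs the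
    square root of 1 + M r, which is at most 1 + M lambda / 2. *)
Lemma step_lambda e : 1 <= e -> loewner G (e *: H) ->
  lam x' <= (1 + M * lam x / 2) * ((1 - e^-1 + M * lam x / 4) * lam x).
Proof.
move=> e1 GH; have l0 := lambda_ge0 x.
have ml0 : 0 <= M * lam x by rewrite mulr_ge0 // ltW.
apply: le_trans (ler_wpM2l _ (residual_bound e1 GH)); last first.
  by rewrite addr_ge0 // divr_ge0.
have q0 : 0 <= bform (invmx H) (F x') (F x') by apply: psd_ge0; exact/spd_psd/spd_inv.
rewrite -(ler_pXn2r (ltn0Sn 1)) ?nnegrE ?lambda_ge0 ?mulr_ge0 ?sqrtr_ge0 ?addr_ge0 ?divr_ge0 //.
rewrite lambda_sqr // exprMn sqr_sqrtr //.
have pH' := gram_spd Ox'.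
have a1 : 0 < 1 + M * r by rewrite ltr_pwDl // mulr_ge0 ?enorm_ge0 // ltW.
have dr : loewner H ((1 + M * r) *: gram F x').
  by have := gram_drift x Ox'; rewrite -enormN opprB.
have := loewner_le (F x') (loewner_inv pH dr).
rewrite inv_scale ?spd_unit ?gt_eqF // bformZm ler_pdivrMl // => /le_trans; apply.
rewrite ler_wpM2r //.
have : M * r <= M * lam x by rewrite ler_pM2l // step_le_lambda.
have : 0 <= (M * lam x) ^+ 2 by exact: sqr_ge0.
set z := M * lam x; move=> h1 h2.
by rewrite sqrrD expr1n mul1r; lra.
Qed.

Let Gs := rqgn_scaled_G F M (x, G).
Let GsE : Gs = (1 + M * r) *: G. Proof. by []. Qed.

(** The factor 1 + M r compensates the drift of the Gram matrix. *)
Lemma scaled_lower : loewner (gram F x') Gs.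
Proof.
apply: loewner_trans (gram_drift x' Ox) _; rewrite GsE.
by apply: loewner_scale => //; rewrite addr_ge0 // mulr_ge0 ?enorm_ge0 // ltW.
Qed.

Lemma scaled_upper e : 0 <= e -> loewner G (e *: H) ->
  loewner Gs (((1 + M * r) ^+ 2 * e) *: gram F x').
Proof.
move=> e0 GH; rewrite GsE.
have a0 : 0 <= 1 + M * r by rewrite addr_ge0 // mulr_ge0 ?enorm_ge0 // ltW.
apply: loewner_trans (loewner_scale a0 GH) _.
have dr : loewner H ((1 + M * r) *: gram F x').
  by have := gram_drift x Ox'; rewrite -enormN opprB.
have := loewner_scale (mulr_ge0 a0 e0) dr; rewrite !scalerA.
by rewrite expr2 -!mulrA [e * _]mulrC.
Qed.

Lemma scaled_pot opt : rqgn_delta0 opt mu L Gs (gram F x') <=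
  (1 + M * lam x) ^+ 2 *
    (rqgn_delta0 opt mu L G H + 2 * pot_weight n opt mu L * (M * lam x)).
Proof.
have muL := mu_le_L Ox.
have mr0 : 0 <= M * r by rewrite mulr_ge0 ?enorm_ge0 // ltW.
have mrl : M * r <= M * lam x by rewrite ler_pM2l // step_le_lambda.
have dr : loewner H ((1 + M * r) *: gram F x').
  by have := gram_drift x Ox'; rewrite -enormN opprB.
have := pot_drift opt n0 mu0 muL mr0 (gram_well_cond Ox) (gram_well_cond Ox') HG dr.
rewrite -GsE => /le_trans; apply.
have p0 := pot_ge0 opt n0 mu0 (gram_well_cond Ox) HG.
have w0 := pot_weight_gt0 opt n0 mu0 muL.
apply: ler_pM.
- by rewrite sqr_ge0.
- by rewrite addr_ge0 // mulr_ge0 // mulr_ge0 // ltW.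
- by rewrite ler_pXn2r ?nnegrE ?addr_ge0 // ?lerD2l // (le_trans mr0).
- by rewrite lerD2l ler_wpM2l // mulr_ge0 // ltW.
Qed.

End Step.

(** * The iteration along a fixed sequence of directions *)

#[local] Opaque jac gram lambda_under rqgn_next_x rqgn_scaled_G Omega_under rqgn_update.

Section Run.
Variables (opt : rqgn_option) (x0 : 'cV[R]_d) (G0 : 'M[R]_n).
Hypotheses (Ox0 : Om x0) (HG0 : loewner (gram F x0) G0).
Let eta0 := loewner_ratio G0 (gram F x0).
Let gamma := rqgn_gamma opt n mu L.
Let N := pot_weight n opt mu L.
Hypothesis small : lam x0 <= mu ^+ 2 * (1 - gamma) /
      (20 * rqgn_ctilde opt mu L * n%:R * L * L2 * eta0).
Let rho := 1 - 1 / (2 * eta0).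
Notation pot G H := (rqgn_delta0 opt mu L G H).

Let muL : mu <= L := mu_le_L Ox0.

Let eta1 : 1 <= eta0.
Proof. by apply: loewner_ratio_ge1 => //; exact: gram_spd. Qed.

Let g01 : 0 < gamma <= 1.
Proof. by rewrite /gamma gamma_gt0 //= gamma_le1. Qed.

Let N1 : 1 <= N.
Proof.
rewrite /N /pot_weight -[leLHS]mulr1; apply: ler_pM => //.
  exact: (ctilde_ge1 opt mu0 muL).
by rewrite ler1n.
Qed.

Lemma rho_bounds : 1 / 2 <= rho < 1.
Proof.
have e0 : 0 < eta0 by exact: lt_le_trans eta1.
have h : 0 < eta0^-1 <= 1 by rewrite invr_gt0 e0 invf_le1.
have -> : rho = 1 - eta0^-1 / 2 by rewrite /rho; field; rewrite gt_eqF.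
by move: (eta0^-1) h => y /andP[h1 h2]; lra.
Qed.

Let rho_pow t : 0 <= rho ^+ t <= 1.
Proof.
have /andP[h1 h2] := rho_bounds.
have r0 : 0 <= rho by apply: le_trans h1; rewrite divr_ge0.
by rewrite exprn_ge0 //= exprn_ile1 // ltW.
Qed.

Lemma lambda0_weight : N * (M * lam x0) <= (1 - gamma) / (10 * eta0).
Proof.
have e0 : 0 < eta0 by exact: lt_le_trans eta1.
have c0 : 0 < rqgn_ctilde opt mu L by exact: lt_le_trans (ctilde_ge1 opt mu0 muL).
have nR : 0 < n%:R :> R by rewrite ltr0n.
have N0 : 0 < N by exact: lt_le_trans N1.
rewrite mulrA; apply: le_trans (ler_wpM2l (ltW (mulr_gt0 N0 M0)) small) _.
rewrite /N /pot_weight /M le_eqVlt; apply/orP; left; apply/eqP.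
move: (rqgn_ctilde _ _ _) c0 => c c0.
by field; rewrite !gt_eqF.
Qed.

Lemma lambda0_stay : L * lam x0 <= mu ^+ 2 / (2 * L2).
Proof.
have /andP[g0 g1] := g01.
have e0 : 0 < eta0 by exact: lt_le_trans eta1.
have c1 := ctilde_ge1 opt mu0 muL.
have c0 : 0 < rqgn_ctilde opt mu L by exact: lt_le_trans c1.
have nR : 1 <= n%:R :> R by rewrite ler1n.
have nR0 : 0 < n%:R :> R by rewrite ltr0n.
apply: le_trans (ler_wpM2l (ltW L0) small) _.
have -> : L * (mu ^+ 2 * (1 - gamma) / (20 * rqgn_ctilde opt mu L * n%:R * L * L2 * eta0))
   = mu ^+ 2 / (2 * L2) * ((1 - gamma) / (10 * (N * eta0))).
  rewrite /N /pot_weight; move: (rqgn_ctilde _ _ _) c0 => c c0.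
  by field; rewrite !gt_eqF.
rewrite ler_piMr //; first by rewrite divr_ge0 ?sqr_ge0 // mulr_ge0 // ltW.
have h : 1 <= N * eta0 by rewrite -[leLHS]mulr1; apply: ler_pM.
by rewrite ler_pdivrMr ?mulr_gt0 // ?mul1r; lra.
Qed.

Section Path.
Variables (u : nat -> 'cV[R]_n) (K : nat -> 'M[R]_n).
Let st := rqgn opt F M x0 G0 u K.

Lemma rqgnS t : st t.+1 = (rqgn_next_x F (st t),
  rqgn_update opt (K t) (rqgn_scaled_G F M (st t)) (gram F (rqgn_next_x F (st t))) (u t)).
Proof. by []. Qed.

(** The bound e_t on the condition ratio: each step multiplies it by at most
    the square of 1 + rho^t / (10 eta0), and the exponent telescopes because
    1 - rho = 1 / (2 eta0). *)
Definition ratio_bound t : R := eta0 * expR (2 / 5 * (1 - rho ^+ t)).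

Lemma ratio_bound_ge1 t : 1 <= ratio_bound t.
Proof.
rewrite -[leLHS]mulr1; apply: ler_pM => //.
have /andP[_ h] := rho_pow t; apply: le_trans (expR_ge1Dx _).
by rewrite lerDl mulr_ge0 // subr_ge0.
Qed.

Lemma path_lambda_small t : lam (st t).1 <= rho ^+ t * lam x0 ->
  N * (M * lam (st t).1) <= (1 - gamma) * (rho ^+ t / (10 * eta0)).
Proof.
move=> h; have N0 : 0 <= N by apply: le_trans N1.
have /andP[r0 r1] := rho_pow t.
apply: (@le_trans _ _ (N * (M * (rho ^+ t * lam x0)))).
  by rewrite ler_wpM2l // ler_wpM2l // ltW.
have := ler_wpM2l r0 lambda0_weight.
by congr (_ <= _); ring.
Qed.

Lemma path_lambda_small1 t : lam (st t).1 <= rho ^+ t * lam x0 ->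
  M * lam (st t).1 <= rho ^+ t / (10 * eta0).
Proof.
move/path_lambda_small => h; have /andP[g0 g1] := g01.
have /andP[r0 r1] := rho_pow t.
have ml : 0 <= M * lam (st t).1 by rewrite mulr_ge0 ?lambda_ge0 // ltW.
apply: (@le_trans _ _ (N * (M * lam (st t).1))); first by rewrite ler_peMl.
apply: le_trans h _; rewrite ler_piMl //; last by rewrite gerBl ltW.
by rewrite divr_ge0 // mulr_ge0 // (le_trans _ eta1).
Qed.

(** The invariant of the iteration; it holds for every choice of directions.
    As the steps are summable, M times their sum being at most 1 / 5, the ratio
    never exceeds exp (2 / 5) times its initial value, which is what keeps
    the contraction factor of lambda below rho. *)
Lemma path_invariant t :
  [/\ Om (st t).1, loewner (gram F (st t).1) (st t).2,
      loewner (st t).2 (ratio_bound t *: gram F (st t).1) &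
      lam (st t).1 <= rho ^+ t * lam x0].
Proof.
have e0 : 0 < eta0 by exact: lt_le_trans eta1.
elim: t => [|t].
  rewrite /ratio_bound expr0 subrr mulr0 expR0 mulr1 mul1r; split => //.
  by apply: loewner_ratioP => //; exact: gram_spd.
move=> [Ot HGt GHt ht]; have hs := path_lambda_small1 ht.
rewrite rqgnS; case: (st t) Ot HGt GHt ht hs => [x G] /= Ox HG GH hl hs.
have e1 := ratio_bound_ge1 t.
have /andP[r0 r1] := rho_pow t.
pose y := eta0^-1.
have y0 : 0 < y by rewrite invr_gt0.
have y1 : y <= 1 by rewrite invf_le1.
(* exp (- 2 / 5) >= 3 / 5 *)
have inve : 3 / 5 * y <= (ratio_bound t)^-1.
  rewrite /ratio_bound invfM mulrC ler_wpM2l ?(ltW y0) //.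
  rewrite -expRN; apply: le_trans (expR_ge1Dx _).
  by lra.
have hs' : M * lam x <= rho ^+ t * (y / 10).
  apply: le_trans hs _; rewrite /y le_eqVlt; apply/orP; left; apply/eqP.
  by field; rewrite gt_eqF.
have ml0 : 0 <= M * lam x by rewrite mulr_ge0 ?lambda_ge0 // ltW.
have hs1 : M * lam x <= y / 10.
  by apply: le_trans hs' _; rewrite ler_piMl // divr_ge0 // ltW.
have lle : lam x <= lam x0.
  by apply: le_trans hl _; rewrite ler_piMl // lambda_ge0.
have cle : 1 - (ratio_bound t)^-1 + M * lam x / 4 <= 1 - 23 / 40 * y by lra.
have stays : Om (rqgn_next_x F (x, G)).
  apply: (step_stays Ox HG e1 GH); first lra.
  by apply: le_trans lambda0_stay; rewrite ler_wpM2l // ltW.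
have pH' := gram_spd stays.
have sl := scaled_lower Ox HG.
split; [exact: stays|exact: update_lower| |].
- have aup : (1 + M * enorm (rqgn_next_x F (x, G) - x)) ^+ 2 * ratio_bound t <=
      ratio_bound t.+1.
    rewrite /ratio_bound mulrCA ler_wpM2l ?(ltW e0) //.
    have -> : 2 / 5 * (1 - rho ^+ t.+1) =
        2 * (rho ^+ t * (y / 10)) + 2 / 5 * (1 - rho ^+ t).
      by rewrite exprS {1}/rho /y; field; rewrite gt_eqF.
    rewrite expRD ler_wpM2r ?expR_ge0 // -[2]/(2%:R) expRM_natl.
    have a0 : 0 <= 1 + M * enorm (rqgn_next_x F (x, G) - x).
      by apply: addr_ge0 => //; exact: mulr_ge0 (ltW M0) (enorm_ge0 _).
    rewrite ler_pXn2r ?nnegrE ?expR_ge0 //.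
    apply: le_trans (expR_ge1Dx _); rewrite lerD2l; apply: le_trans hs'.
    by rewrite ler_wpM2l ?(ltW M0) //; exact: step_le_lambda.
  apply: update_upper; [exact: ratio_bound_ge1|exact: pH'|exact: sl|].
  apply: loewner_trans (scaled_upper stays _ GH) _; first exact: le_trans e1.
  by apply: (loewner_scalel aup); exact: spd_psd.
- apply: le_trans (step_lambda Ox HG stays e1 GH) _.
  rewrite exprS mulrA -[rho * _ * _]mulrA.
  apply: ler_pM; [ |exact: lambda_ge0| |exact: hl].
  + apply: mulr_ge0; first lra.
    have : (ratio_bound t)^-1 <= 1 by rewrite invf_le1 // (lt_le_trans _ e1).
    lra.
  + (* first-order terms in y: 1 / 20 - 23 / 40 = - 21 / 40 < - 1 / 2 *)
    have -> : rho = 1 - y / 2 by rewrite /rho /y; field; rewrite gt_eqF.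
    set c := (1 - _ + _) in cle *.
    have cc : c <= 1 - 23 / 40 * y := cle.
    apply: (@le_trans _ _ ((1 + y / 20) * (1 - 23 / 40 * y))).
      apply: (@le_trans _ _ ((1 + M * lam x / 2) * (1 - 23 / 40 * y))).
        by rewrite ler_wpM2l //; lra.
      by rewrite ler_wpM2r //; lra.
    by nra.
Qed.

Lemma path_in t : Om (st t).1. Proof. by case: (path_invariant t). Qed.
Lemma path_lower t : loewner (gram F (st t).1) (st t).2.
Proof. by case: (path_invariant t). Qed.
Lemma path_weight t :
  N * (M * lam (st t).1) <= (1 - gamma) * (rho ^+ t / (10 * eta0)).
Proof. by apply: path_lambda_small; case: (path_invariant t). Qed.
Lemma path_weight1 t : M * lam (st t).1 <= rho ^+ t / (10 * eta0).
Proof. by apply: path_lambda_small1; case: (path_invariant t). Qed.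

Definition path_pot t : R := pot (st t).2 (gram F (st t).1).
Definition path_pot_scaled t : R := pot (rqgn_scaled_G F M (st t)) (gram F (st t.+1).1).
Definition path_gain t : 'M[R]_n :=
  gain_mx opt mu L (K t) (rqgn_scaled_G F M (st t)) (gram F (st t.+1).1).

Lemma path_pot_ge0 t : 0 <= path_pot t.
Proof. exact (pot_ge0 opt n0 mu0 (gram_well_cond (path_in t)) (path_lower t)). Qed.

Lemma path_scaled_lower t : loewner (gram F (st t.+1).1) (rqgn_scaled_G F M (st t)).
Proof.
have := path_lower t; have := path_in t; rewrite rqgnS /=.
by case: (st t) => [x G] /= Ox HG; exact: scaled_lower.
Qed.

Lemma path_scaled_upper t : loewner (rqgn_scaled_G F M (st t))
  ((4 * ratio_bound t) *: gram F (st t.+1).1).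
Proof.
have hs := path_weight1 t; have Ot1 := path_in t.+1.
have [Ot HGt GHt _] := path_invariant t.
have e1 := ratio_bound_ge1 t; have pH' := gram_spd Ot1; move: hs Ot1 Ot HGt GHt pH'.
rewrite rqgnS /=; case: (st t) => [x G] /= hs Ox' Ox HG GH pH'.
have e0 : 0 <= ratio_bound t by exact: le_trans e1.
apply: loewner_trans (scaled_upper Ox' e0 GH) _.
apply: loewner_scalel; last exact: spd_psd.
have /andP[r0 r1] := rho_pow t.
have a0 : 0 <= M * enorm (rqgn_next_x F (x, G) - x).
  exact: mulr_ge0 (ltW M0) (enorm_ge0 _).
have a1 : M * enorm (rqgn_next_x F (x, G) - x) <= 1.
  apply: le_trans (ler_wpM2l (ltW M0) (step_le_lambda Ox HG)) _.
  apply: le_trans hs _; rewrite ler_pdivrMr ?mulr_gt0 ?(lt_le_trans _ eta1) // mul1r.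
  by apply: le_trans r1 _; move: (eta0) eta1 => e e1'; lra.
rewrite ler_wpM2r //; move: (M * enorm _) a0 a1 => z z0 z1; nra.
Qed.

Lemma path_ratio_le t : loewner_ratio (st t).2 (gram F (st t).1) - 1 <= path_pot t.
Proof.
have w := gram_well_cond (path_in t).
rewrite lerBlDl; apply: loewner_ratio_le; first exact: n0.
- exact: (well_cond_spd mu0 w).
- exact: path_lower.
- exact: (pot_ratio opt n0 mu0 w (path_lower t)).
Qed.

Lemma path_lambda_step t : lam (st t.+1).1 <=
  (1 + M * lam (st t).1 / 2) * ((path_pot t + M * lam (st t).1 / 4) * lam (st t).1).
Proof.
have p0 := path_pot_ge0 t; have Ot1 := path_in t.+1.
have w := gram_well_cond (path_in t).
have pr := pot_ratio opt n0 mu0 w (path_lower t).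
have := path_lower t; have := path_in t; move: p0 Ot1 pr {w}; rewrite /path_pot rqgnS /=.
case: (st t) => [x G] /= p0 Ox' pr Ox HG.
have d1 : 1 <= 1 + pot G (gram F x) by rewrite lerDl.
have l0 := lambda_ge0 x; have ml0 : 0 <= M * lam x by rewrite mulr_ge0 // ltW.
apply: le_trans (step_lambda Ox HG Ox' d1 pr) _.
rewrite ler_wpM2l //; first by rewrite addr_ge0 // divr_ge0.
rewrite ler_wpM2r // lerD2r.
move: (pot _ _) p0 d1 => p p0 d1.
have -> : 1 - (1 + p)^-1 = p / (1 + p) by field; rewrite gt_eqF // (lt_le_trans _ d1).
by rewrite ler_pdivrMr ?(lt_le_trans _ d1) // ler_peMr.
Qed.

Lemma path_scaled_pot_le t : path_pot_scaled t <=
  (1 + M * lam (st t).1) ^+ 2 * (path_pot t + 2 * N * (M * lam (st t).1)).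
Proof.
have Ot1 := path_in t.+1; have := path_lower t; have := path_in t; move: Ot1.
rewrite /path_pot /path_pot_scaled rqgnS /=.
by case: (st t) => [x G] /= Ox' Ox HG; exact: scaled_pot.
Qed.

Lemma path_pot_step t : good_factor opt (K t) (rqgn_scaled_G F M (st t)) ->
  path_pot t.+1 <= path_pot_scaled t -
    bform (path_gain t) (u t) (u t) / bform 1%:M (u t) (u t).
Proof.
exact: (pot_update n0 mu0 muL (u t) (gram_well_cond (path_in t.+1)) (path_scaled_lower t)).
Qed.

Lemma path_gain_psd t : good_factor opt (K t) (rqgn_scaled_G F M (st t)) ->
  psd (path_gain t).
Proof.
exact: (gain_psd n0 mu0 muL (gram_well_cond (path_in t.+1)) (path_scaled_lower t)).
Qed.

Lemma path_gain_trace t : good_factor opt (K t) (rqgn_scaled_G F M (st t)) ->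
  n%:R * gamma * path_pot_scaled t <= \tr (path_gain t).
Proof.
exact: (gain_trace n0 mu0 muL (gram_well_cond (path_in t.+1)) (path_scaled_lower t)).
Qed.

Lemma path_gain_bound t : good_factor opt (K t) (rqgn_scaled_G F M (st t)) ->
  forall i j, `|path_gain t i j| <= N * (4 * ratio_bound t - 1).
Proof.
move=> g i j; apply: le_trans (psd_entry_le_trace i j (path_gain_psd g)) _.
have e1 : 1 <= 4 * ratio_bound t by have := ratio_bound_ge1 t; lra.
exact: (gain_trace_upper n0 mu0 muL e1 (gram_well_cond (path_in t.+1))
  (path_scaled_lower t) (path_scaled_upper t) g).
Qed.

End Path.
End Run.
End OneStep.

(** * Measurable random matrices *)

Section EntrywiseMeasurable.
Context (dd : measure_display) (T : measurableType dd) (R : realType).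
Implicit Types (m n p : nat).

Definition mxmeas m n (A : T -> 'M[R]_(m, n)) :=
  forall i j, measurable_fun [set: T] (fun w => A w i j).

Lemma mxmeas_ext m n (A B : T -> 'M[R]_(m, n)) : A =1 B -> mxmeas A -> mxmeas B.
Proof. by move=> AB mA i j; rewrite -(funext AB); exact: mA. Qed.

Lemma mxmeas_cst m n (A : 'M[R]_(m, n)) : mxmeas (fun=> A).
Proof. by move=> i j; exact: measurable_cst. Qed.

Lemma mxmeasD m n (A B : T -> 'M[R]_(m, n)) : mxmeas A -> mxmeas B ->
  mxmeas (fun w => A w + B w).
Proof.
move=> mA mB i j; under eq_fun do rewrite mxE; exact: measurable_funD.
Qed.

Lemma mxmeasZ m n (a : T -> R) (A : T -> 'M[R]_(m, n)) :
  measurable_fun [set: T] a -> mxmeas A -> mxmeas (fun w => a w *: A w).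
Proof.
move=> ma mA i j; under eq_fun do rewrite mxE; exact: measurable_funM.
Qed.

Lemma mxmeasN m n (A : T -> 'M[R]_(m, n)) : mxmeas A -> mxmeas (fun w => - A w).
Proof.
move=> mA; apply: (@mxmeas_ext _ _ (fun w => (-1) *: A w)).
  by move=> w; rewrite scaleN1r.
by apply: mxmeasZ => //; exact: measurable_cst.
Qed.

Lemma mxmeasB m n (A B : T -> 'M[R]_(m, n)) : mxmeas A -> mxmeas B ->
  mxmeas (fun w => A w - B w).
Proof. by move=> mA mB; apply: mxmeasD => //; exact: mxmeasN. Qed.

Lemma mxmeasM m n p (A : T -> 'M[R]_(m, n)) (B : T -> 'M[R]_(n, p)) :
  mxmeas A -> mxmeas B -> mxmeas (fun w => A w *m B w).
Proof.
move=> mA mB i j; under eq_fun do rewrite mxE; apply: measurable_sum => k.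
exact: measurable_funM.
Qed.

Lemma mxmeas_tr m n (A : T -> 'M[R]_(m, n)) : mxmeas A -> mxmeas (fun w => (A w)^T).
Proof. by move=> mA i j; under eq_fun do rewrite mxE; exact: mA. Qed.

Lemma mxmeas_trace n (A : T -> 'M[R]_n) : mxmeas A ->
  measurable_fun [set: T] (fun w => \tr (A w)).
Proof. by move=> mA; apply: measurable_sum => i; exact: mA. Qed.

Lemma mxmeas_det n (A : T -> 'M[R]_n) : mxmeas A ->
  measurable_fun [set: T] (fun w => \det (A w)).
Proof.
move=> mA; apply: measurable_sum => s; apply: measurable_funM.
  exact: measurable_cst.
by apply: measurable_prod => i _; exact: mA.
Qed.

(** 1 / y is the product of y and (y^2)^-1, and the inverse of the nonnegative
    number y^2 is a real power of it; this covers y = 0 as well. *)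
Lemma measurable_fun_invr (f : T -> R) : measurable_fun [set: T] f ->
  measurable_fun [set: T] (fun w => (f w)^-1).
Proof.
move=> mf; have -> : (fun w => (f w)^-1) = (fun w => f w * (((f w) ^+ 2) `^ (-1))).
  apply/funext => w; rewrite powR_inv1 ?sqr_ge0 //.
  have [->|z] := eqVneq (f w) 0; first by rewrite invr0 mul0r.
  by rewrite expr2 invfM mulrA divff // mul1r.
apply: measurable_funM => //.
apply: (@measurableT_comp _ _ _ _ _ _ (fun x : R => x `^ (-1))).
  exact: measurable_powR.
exact: measurable_funX.
Qed.

Lemma mxmeas_if m n (b : T -> bool) (A B : T -> 'M[R]_(m, n)) :
  measurable_fun [set: T] b -> mxmeas A -> mxmeas B ->
  mxmeas (fun w => if b w then A w else B w).
Proof.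
move=> mb mA mB i j; have -> : (fun w => (if b w then A w else B w) i j) =
    (fun w => if b w then A w i j else B w i j).
  by apply/funext => w; case: (b w).
exact: measurable_fun_ifT.
Qed.

Lemma mxmeas_inv n (A : T -> 'M[R]_n) : mxmeas A -> mxmeas (fun w => invmx (A w)).
Proof.
move=> mA; rewrite /invmx; apply: mxmeas_if => //.
  have -> : (fun w => A w \in unitmx) = (fun w => ~~ (\det (A w) == 0)).
    by apply/funext => w; rewrite unitmxE unitfE.
  apply: (@measurableT_comp _ _ _ _ _ _ negb) => //.
  by apply: measurable_fun_eqr; [exact: mxmeas_det|exact: measurable_cst].
apply: mxmeasZ; first by apply: measurable_fun_invr; exact: mxmeas_det.
move=> i j; under eq_fun do rewrite mxE /cofactor.
apply: measurable_funM; first exact: measurable_cst.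
by apply: mxmeas_det => k l; under eq_fun do rewrite !mxE; exact: mA.
Qed.

Lemma mxmeas_eq m n (A B : T -> 'M[R]_(m, n)) : mxmeas A -> mxmeas B ->
  measurable_fun [set: T] (fun w => A w == B w).
Proof.
move=> mA mB; have -> : (fun w => A w == B w) =
    (fun w => \sum_i \sum_j (A w i j - B w i j) ^+ 2 == 0).
  apply/funext => w; apply/eqP/eqP => [->|].
    by apply: big1 => i _; apply: big1 => j _; rewrite subrr expr0n.
  have s0 i : 0 <= \sum_j (A w i j - B w i j) ^+ 2.
    by apply: sumr_ge0 => j _; exact: sqr_ge0.
  move=> /psumr_eq0P h; apply/matrixP => i j.
  have /psumr_eq0P h' := h (fun i _ => s0 i) i isT.
  apply/eqP; rewrite -subr_eq0 -sqrf_eq0; apply/eqP.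
  by apply: h' => // k _; exact: sqr_ge0.
apply: measurable_fun_eqr; last exact: measurable_cst.
apply: measurable_sum => i; apply: measurable_sum => j; apply: measurable_funX.
exact: measurable_funB.
Qed.

Lemma mxmeas_bform n (A : T -> 'M[R]_n) (v : T -> 'cV[R]_n) : mxmeas A ->
  mxmeas v -> measurable_fun [set: T] (fun w => bform (A w) (v w) (v w)).
Proof.
move=> mA mv; rewrite /bform; suff : mxmeas (fun w => (v w)^T *m A w *m v w) by exact.
by do 2 apply: mxmeasM => //; exact: mxmeas_tr.
Qed.

Lemma measurable_fun_sqrt (f : T -> R) : measurable_fun [set: T] f ->
  measurable_fun [set: T] (fun w => Num.sqrt (f w)).
Proof.
move=> mf; apply: (@measurableT_comp _ _ _ _ _ _ (@Num.sqrt R)) => //.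
by apply: continuous_measurable_fun; exact: sqrt_continuous.
Qed.

Lemma mxmeas_enorm n (v : T -> 'cV[R]_n) : mxmeas v ->
  measurable_fun [set: T] (fun w => enorm (v w)).
Proof.
move=> mv; apply: measurable_fun_sqrt; apply: measurable_sum => i.
by apply: measurable_funX; exact: mv.
Qed.

(** The random point is the limit of its roundings to the grids of mesh
    1 / (k + 1), and a function of a countably valued random point is
    measurable. *)
Lemma continuous_mxmeas d (f : 'cV[R]_d -> R) (x : T -> 'cV[R]_d) :
  continuous f -> mxmeas x -> measurable_fun [set: T] (fun w => f (x w)).
Proof.
move=> cf mx.
pose z k w : 'cV[int]_d := \col_i Num.floor (k.+1%:R * x w i 0).
pose y k (c : 'cV[int]_d) : 'cV[R]_d := \col_i ((c i 0)%:~R / k.+1%:R).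
apply: (@measurable_fun_cvg _ _ _ _ (fun k w => f (y k (z k w)))) => [k|w _].
  move=> _ B mB; rewrite setTI.
  have -> : (fun w => f (y k (z k w))) @^-1` B =
      \bigcup_m (if unpickle m is Some c then
        if f (y k c) \in B then [set w | z k w = c] else set0 else set0).
    apply/seteqP; split => w /=.
      move=> Bw; exists (pickle (z k w)) => //.
      by rewrite pickleK; case: ifPn => //; rewrite notin_setE.
    by move=> [m _]; case: unpickle => // c; case: ifPn => //; rewrite inE => Bc /= ->.
  apply: bigcupT_measurable => m; case: unpickle => // c; case: ifPn => // _.
  have -> : [set w | z k w = c] = \bigcap_(i in [set: 'I_d])
      [set w | (c i 0)%:~R <= k.+1%:R * x w i 0 < (c i 0 + 1)%:~R].
    apply/seteqP; split => w /=.
      by move=> <- i _ /=; rewrite mxE floor_itv.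
    move=> h; apply/matrixP => i j; rewrite ord1 mxE; apply: floor_def; exact: h.
  apply: fin_bigcap_measurable => [|i _]; first exact: finite_finset.
  have mf : measurable_fun [set: T] (fun w => k.+1%:R * x w i 0).
    by apply: measurable_funM => //; exact: measurable_cst.
  have := mf measurableT `[(c i 0)%:~R, (c i 0 + 1)%:~R[%classic (measurable_itv _).
  by rewrite setTI; congr measurable.
apply: continuous_cvg; first exact: cf.
apply/cvgrPdist_le => e e0; near=> k.
rewrite [leLHS]/Num.Def.normr /= mx_normrE (bigmax_le _ (ltW e0)) //= => -[i j] _ /=.
rewrite !ord1 !mxE.
have k0 : 0 < k.+1%:R :> R by rewrite ltr0n.
have /andP[h1 h2] := floor_itv (k.+1%:R * x w i 0).
rewrite -(ler_pM2l k0) -{1}(gtr0_norm k0) -normrM mulrBr mulrCA divff ?gt_eqF // mulr1.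
rewrite ger0_norm ?subr_ge0 //.
rewrite rmorphD /= in h2.
apply: (@le_trans _ _ 1); first by rewrite lerBlDl; exact: ltW.
rewrite -ler_pdivrMr // mul1r.
apply: (@le_trans _ _ k%:R); last by rewrite ler_nat.
near: k; exact: nbhs_infty_ger.
Unshelve. all: by end_near. Qed.

End EntrywiseMeasurable.

(** * Measurability of the iterates *)

Section IterateMeasurable.
Context (dd : measure_display) (T : measurableType dd) (R : realType).
Variables (n d : nat) (F : 'cV[R]_d -> 'cV[R]_n) (L2 : R).
Hypothesis dF : forall y, differentiable F y.
Hypothesis JLip : forall y z,
  spectral_norm (jac F y - jac F z) <= L2 * enorm (y - z).

Lemma entry_le_spectral_norm (A : 'M[R]_(n, d)) i j : `|A i j| <= spectral_norm A.
Proof.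
have -> : A i j = bform 1%:M (delta_mx i 0) (A *m delta_mx j 0).
  by rewrite /bform mulmx1 trmx_delta -colE -rowE !mxE.
have e1 m (k : 'I_m) : enorm (delta_mx k 0 : 'cV[R]_m) = 1.
  by apply: (@pexpIrn _ 2); rewrite ?nnegrE ?enorm_ge0 // -bform1_enorm bform_delta mxE eqxx expr1n.
apply: le_trans (dot_le_enorm _ _) _; rewrite e1 mul1r.
by apply: le_trans (spectral_norm_le _ _) _; rewrite e1 mulr1.
Qed.

Lemma enorm_le_norm m (v : 'cV[R]_m) : enorm v <= m%:R * `|v|.
Proof.
rewrite -(ler_pXn2r (ltn0Sn 1)) ?nnegrE ?enorm_ge0 ?mulr_ge0 //.
rewrite -bform1_enorm bform1.
apply: (@le_trans _ _ (\sum_(i < m) `|v| ^+ 2)).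
  apply: ler_sum => i _; rewrite -expr2 -real_normK ?num_real //.
  rewrite ler_pXn2r ?nnegrE // [leRHS]/Num.Def.normr /= mx_normrE.
  exact: (le_bigmax _ (fun ij : 'I_m * 'I_1 => `|v ij.1 ij.2|) (i, 0)).
rewrite sumr_const card_ord -[leLHS]mulr_natl exprMn ler_wpM2r ?sqr_ge0 //.
case: m v => [|m] v; first by rewrite expr0n.
by rewrite expr2 ler_peMl // ler1n.
Qed.

(** The Lipschitz hypothesis is stated for Euclidean norms, while continuity refers
    to the sup norm of matrices. *)
Lemma jac_entry_continuous i j : continuous (fun y => jac F y i j).
Proof.
move=> y; have fy : Filter (nbhs y) by exact: nbhs_filter.
apply/(@cvgrPdist_le _ _ _ (nbhs y) fy) => e e0.
pose c := `|L2| * d%:R + 1.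
have c0 : 0 < c by rewrite ltr_wpDl // mulr_ge0.
near=> z.
have : `|(jac F y - jac F z) i j| <= `|L2| * (d%:R * `|y - z|).
  apply: le_trans (entry_le_spectral_norm _ _ _) _; apply: le_trans (JLip _ _) _.
  apply: le_trans (ler_wpM2l (normr_ge0 _) (enorm_le_norm _)).
  by rewrite ler_wpM2r ?enorm_ge0 // ler_norm.
rewrite [X in `|X| <= _]mxE [X in `|_ + X| <= _]mxE => /le_trans; apply.
have h : `|y - z| <= e / c.
  by near: z; apply: cvgr_dist_le => //; rewrite divr_gt0.
apply: (@le_trans _ _ (c * `|y - z|)).
  by rewrite mulrA ler_wpM2r // lerDl.
by rewrite mulrC -ler_pdivlMr.
Unshelve. all: by end_near. Qed.

Lemma map_entry_continuous i : continuous (fun y => F y i 0).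
Proof.
move=> y; apply: (@continuous_comp _ _ _ F (fun v : 'cV[R]_n => v i 0)).
  exact: differentiable_continuous.
exact: coord_continuous.
Qed.

Lemma mxmeas_map (x : T -> 'cV[R]_d) : mxmeas x -> mxmeas (fun w => F (x w)).
Proof.
move=> mx i j; rewrite ord1.
exact: (continuous_mxmeas (@map_entry_continuous i) mx).
Qed.

Lemma mxmeas_jac (x : T -> 'cV[R]_d) : mxmeas x -> mxmeas (fun w => jac F (x w)).
Proof. move=> mx i j; exact: (continuous_mxmeas (@jac_entry_continuous i j) mx). Qed.

Lemma mxmeas_gram (x : T -> 'cV[R]_d) : mxmeas x -> mxmeas (fun w => gram F (x w)).
Proof.
move=> mx; have mJ := mxmeas_jac mx; rewrite /gram.
by apply: mxmeasM => //; exact: mxmeas_tr.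
Qed.

Lemma measurable_lambda (x : T -> 'cV[R]_d) : mxmeas x ->
  measurable_fun [set: T] (fun w => lambda_under F (x w)).
Proof.
move=> mx; apply: measurable_fun_sqrt; apply: mxmeas_bform; last exact: mxmeas_map.
exact/mxmeas_inv/mxmeas_gram.
Qed.

Section State.
Variables (M : R) (s : T -> 'cV[R]_d * 'M[R]_n).
Hypotheses (mx : mxmeas (fun w => (s w).1)) (mG : mxmeas (fun w => (s w).2)).

Lemma mxmeas_next : mxmeas (fun w => rqgn_next_x F (s w)).
Proof.
rewrite /rqgn_next_x; apply: mxmeasB => //; apply: mxmeasM; last exact: mxmeas_map.
by apply: mxmeasM; [exact/mxmeas_tr/mxmeas_jac|exact: mxmeas_inv].
Qed.

Lemma mxmeas_scaled : mxmeas (fun w => rqgn_scaled_G F M (s w)).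
Proof.
rewrite /rqgn_scaled_G; apply: mxmeasZ => //.
apply: measurable_funD; first exact: measurable_cst.
apply: measurable_funM; first exact: measurable_cst.
by apply: mxmeas_enorm; apply: mxmeasB => //; exact: mxmeas_next.
Qed.

End State.

Lemma mxmeas_bfgs (G H : T -> 'M[R]_n) (v : T -> 'cV[R]_n) : mxmeas G -> mxmeas H ->
  mxmeas v -> mxmeas (fun w => bfgs (G w) (H w) (v w)).
Proof.
move=> mG mH mv.
have r A : mxmeas A -> mxmeas (fun w => (bform (A w) (v w) (v w))^-1 *:
    (A w *m v w *m (v w)^T *m A w)).
  move=> mA; apply: mxmeasZ; first by apply: measurable_fun_invr; exact: mxmeas_bform.
  by do 2 apply: mxmeasM => //; [exact: mxmeasM|exact: mxmeas_tr].
by apply: mxmeasD; [apply: mxmeasB => //|]; exact: r.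
Qed.

Lemma mxmeas_update opt (K G H : T -> 'M[R]_n) (v : T -> 'cV[R]_n) :
  (opt = OptionII -> mxmeas K) -> mxmeas G -> mxmeas H ->
  mxmeas v -> mxmeas (fun w => rqgn_update opt (K w) (G w) (H w) (v w)).
Proof.
case: opt => mK mG mH mv /=; first exact: mxmeas_bfgs.
  apply: mxmeas_bfgs => //; apply: mxmeasM => //; apply: mxmeas_tr; exact: mK.
have mD : mxmeas (fun w => G w - H w) by exact: mxmeasB.
rewrite /rqgn_update /sr1; apply: mxmeas_if => //.
  by apply: mxmeas_eq; [exact: mxmeasM|exact: mxmeas_cst].
apply: mxmeasB => //; apply: mxmeasZ.
  by apply: measurable_fun_invr; exact: mxmeas_bform.
by do 2 apply: mxmeasM => //; [exact: mxmeasM|exact: mxmeas_tr].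
Qed.

(** The iterate at time t is measurable for any sigma-algebra that contains the
    information of the directions and factors of times before t. *)
Lemma mxmeas_rqgn opt M x0 G0 (u : nat -> T -> 'cV[R]_n) (K : nat -> T -> 'M[R]_n) t :
  (forall s, (s < t)%N -> mxmeas (u s)) ->
  (opt = OptionII -> forall s, (s < t)%N -> mxmeas (K s)) ->
  mxmeas (fun w => (rqgn opt F M x0 G0 (u ^~ w) (K ^~ w) t).1) /\
  mxmeas (fun w => (rqgn opt F M x0 G0 (u ^~ w) (K ^~ w) t).2).
Proof.
elim: t => [|t IH] mu mK; first by split; exact: mxmeas_cst.
have [s st|e s st|mx mG] := IH; first exact/mu/ltnW.
  exact/mK/ltnW.
have mx' := mxmeas_next mx mG; split => //.
apply: mxmeas_update => //.
- by move=> e; exact: mK.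
- exact: mxmeas_scaled.
- exact: mxmeas_gram.
- exact: mu.
Qed.

Lemma mxmeas_gain opt mu L (K G H : T -> 'M[R]_n) : (opt = OptionII -> mxmeas K) ->
  mxmeas G -> mxmeas H -> mxmeas (fun w => gain_mx opt mu L (K w) (G w) (H w)).
Proof.
have cst a : measurable_fun [set: T] (fun=> a : R) by exact: measurable_cst.
case: opt => mK mG mH; rewrite /gain_mx.
- by apply: mxmeasZ => //; exact: mxmeasB.
- have {}mK := mK erefl.
  apply: mxmeasB; last exact: mxmeas_cst.
  apply: mxmeasM; last exact: mxmeas_tr.
  apply: mxmeasM => //; apply: mxmeasM; last exact: mxmeas_inv.
  exact: mxmeasM.
- apply: mxmeasZ; last exact: mxmeasB.
  apply: measurable_funM => //; apply: measurable_fun_invr.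
  by apply: measurable_funM => //; exact: mxmeas_trace.
Qed.

Lemma measurable_pot opt mu L (G H : T -> 'M[R]_n) :
  mxmeas G -> mxmeas H -> measurable_fun [set: T] (fun w => rqgn_delta0 opt mu L (G w) (H w)).
Proof.
move=> mG mH; have mD : mxmeas (fun w => G w - H w) by exact: mxmeasB.
have cst a : measurable_fun [set: T] (fun=> a : R) by exact: measurable_cst.
case: opt => /=.
- by apply: mxmeas_trace; apply: mxmeasM => //; exact: mxmeas_inv.
- by apply: mxmeas_trace; apply: mxmeasM => //; exact: mxmeas_inv.
- apply: measurable_funM; first by apply: measurable_funM => //; exact: mxmeas_trace.
  by apply: measurable_fun_invr; apply: measurable_funM => //; exact: mxmeas_trace.
Qed.

End IterateMeasurable.

(** * Expectation of a product of independent variables *)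

Section Independence.
Context (dd : measure_display) (T : measurableType dd) (R : realType).
Variable P : probability T R.

Lemma bounded_integrable (X : T -> R) c : measurable_fun [set: T] X ->
  (forall w, `|X w| <= c) -> P.-integrable [set: T] (EFin \o X).
Proof.
move=> mX hX; apply: measurable_bounded_integrable => //.
  by apply: le_lt_trans (probability_le1 P measurableT) _; exact: ltry.
exists c; split; first exact: num_real.
by move=> M cM w _ /=; apply: le_trans (hX w) (ltW cM).
Qed.

(** The joint law of X and Y is the product of their laws, since both agree on
    rectangles; Fubini then factors the integral of the product. *)
Lemma integral_indep_mul (X Y : T -> R) a b :
  measurable_fun [set: T] X -> measurable_fun [set: T] Y ->
  (forall w, `|X w| <= a) -> (forall w, `|Y w| <= b) ->
  (forall A B, measurable A -> measurable B ->
     P (X @^-1` A `&` Y @^-1` B) = (P (X @^-1` A) * P (Y @^-1` B))%E) ->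
  (\int[P]_w (X w * Y w)%:E = (\int[P]_w (X w)%:E) * (\int[P]_w (Y w)%:E))%E.
Proof.
move=> mX mY bX bY ind.
have iX := bounded_integrable mX bX.
have iY := bounded_integrable mY bY.
have iXY : P.-integrable [set: T] (EFin \o (fun w => X w * Y w)).
  apply: (@bounded_integrable _ (a * b)); first exact: measurable_funM.
  by move=> w; rewrite normrM; apply: ler_pM.
pose phi w := (X w, Y w).
have mphi : measurable_fun [set: T] phi by exact: measurable_fun_pair.
pose X' : {RV P >-> R} := HB.pack X (isMeasurableFun.Build _ _ _ _ _ mX).
pose Y' : {RV P >-> R} := HB.pack Y (isMeasurableFun.Build _ _ _ _ _ mY).
pose phi' : {mfun T >-> (R * R)%type} :=
  HB.pack phi (isMeasurableFun.Build _ _ _ _ _ mphi).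
pose m1 := distribution P X'; pose m2 := distribution P Y'.
pose m := distribution P phi'.
have mE A : measurable A -> (m1 \x m2)%E A = m A.
  apply: product_measure_unique => A1 B1 mA mB; rewrite /m /pushforward /=.
  exact: ind.
pose f (z : R * R) : \bar R := (z.1 * z.2)%:E.
have mf : measurable_fun [set: (R * R)%type] f.
  apply/measurable_EFinP; apply: measurable_funM; first exact: measurable_fst.
  exact: measurable_snd.
have if' : m.-integrable [set: (R * R)%type] f.
  by apply: integrable_pushforward => //; rewrite preimage_setT.
have ifp : (m1 \x m2)%E.-integrable [set: (R * R)%type] f.
  apply/integrableP; split => //; rewrite (@eq_measure_integral _ _ _ _ m) //.
    by case/integrableP: if'.
  by move=> A mA _; exact: mE.
have idm : measurable_fun [set: R] (EFin : R -> \bar R).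
  by apply/measurable_EFinP; exact: measurable_id.
have E1 : (\int[P]_w (X w)%:E = \int[m1]_x x%:E)%E.
  by rewrite /m1 /distribution integral_pushforward //= preimage_setT.
have E2 : (\int[P]_w (Y w)%:E = \int[m2]_x x%:E)%E.
  by rewrite /m2 /distribution integral_pushforward //= preimage_setT.
have i1 : m1.-integrable [set: R] EFin.
  by apply: integrable_pushforward => //; rewrite preimage_setT.
have i2 : m2.-integrable [set: R] EFin.
  by apply: integrable_pushforward => //; rewrite preimage_setT.
transitivity (\int[m]_z f z)%E.
  by rewrite /m /distribution integral_pushforward //= preimage_setT.
rewrite -(@eq_measure_integral _ _ _ _ m (m1 \x m2)%E); last first.
  by move=> A mA _; exact: mE.
rewrite -integral12_prod_meas1 // E1 E2 /fubini_F /f /=.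
transitivity (\int[m1]_x (x%:E * \int[m2]_y y%:E))%E.
  apply: eq_integral => x _; rewrite -integralZl //.
have fY : (\int[m2]_x x%:E \is a fin_num)%E by rewrite -E2 integrable_fin_num.
by rewrite -(fineK fY) integralZr.
Qed.

End Independence.

(** * Isotropy of Gaussian directions *)

Section GaussianDirections.
Variable R : realType.

Lemma lebesgue_measure_opp (A : set R) : measurable A ->
  lebesgue_measure (-%R @^-1` A) = lebesgue_measure A.
Proof.
move=> mA.
have mopp : measurable_fun [set: measurableTypeR R]
    (-%R : measurableTypeR R -> measurableTypeR R).
  exact: (@oppr_measurable R setT).
pose m := measure_function_pushforward__canonical__measure_function_Measure
  (@lebesgue_measure R) mopp.
apply/esym; apply: (@lebesgue_measure_unique R m) => // X [[a b] _ <-].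
rewrite /m /= /pushforward /=.
have -> : -%R @^-1` `]a, b]%classic = `[- b, - a[%classic.
  apply/seteqP; split => x /=; rewrite !in_itv /= => /andP[h1 h2].
    by rewrite lerNl h2 ltrNr h1.
  by rewrite ltrNr h2 lerNl h1.
rewrite !lebesgue_measure_itv /= !lte_fin ltrN2; case: ifP => // _.
by rewrite !EFinN oppeK addeC.
Qed.

Lemma normal_prob_opp (B : set R) : measurable B ->
  normal_prob 0 1 (-%R @^-1` B) = normal_prob 0 1 B.
Proof.
move=> mB.
have mopp : measurable_fun [set: measurableTypeR R]
    (-%R : measurableTypeR R -> measurableTypeR R).
  exact: (@oppr_measurable R setT).
have e (x : R) : normal_pdf 0 1 (- x) = normal_pdf 0 1 x.
  by rewrite /normal_pdf oner_eq0 /normal_fun !subr0 sqrrN.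
rewrite /normal_prob.
transitivity (\int[pushforward lebesgue_measure
    (-%R : measurableTypeR R -> measurableTypeR R)]_(x in B) (normal_pdf 0 1 x)%:E)%E.
  rewrite ge0_integral_pushforward //.
  - by apply: eq_integral => x _ /=; rewrite e.
  - by apply/measurable_EFinP; apply: measurable_funTS; exact: measurable_normal_pdf.
  - by move=> x _; rewrite lee_fin normal_pdf_ge0.
pose m := measure_function_pushforward__canonical__measure_function_Measure
  (@lebesgue_measure R) mopp.
apply: (@eq_measure_integral _ _ _ _ (@lebesgue_measure R) m) => A mA _.
exact: lebesgue_measure_opp.
Qed.

Lemma normal_prob_set1 (a : R) : normal_prob 0 1 [set a] = 0%E.
Proof.
have := @normal_prob_dominates R 0 1; rewrite null_content_dominatesP; apply => //.
exact: lebesgue_measure_set1.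
Qed.

Context (dd : measure_display) (T : measurableType dd) (P : probability T R).
Variable n : nat.
Implicit Types v : T -> 'cV[R]_n.

Lemma gaussian_mxmeas v : std_gaussian P v -> mxmeas v.
Proof. by case=> mv _ i j; rewrite ord1. Qed.

Lemma std_gaussian_flip v k : std_gaussian P v ->
  std_gaussian P (fun w => \col_i (if i == k then - v w i 0 else v w i 0)).
Proof.
case=> mv hv; split => [i|B mB].
  by under eq_fun do rewrite mxE; case: eqP => _; [exact: measurable_funN|exact: mv].
have mN : measurable (-%R @^-1` (B k)).
  by rewrite -[X in measurable X]setTI; exact: (oppr_measurable measurableT).
pose B' i := if i == k then -%R @^-1` (B k) else B i.
have mB' i : measurable (B' i) by rewrite /B'; case: eqP.
have -> : (\prod_(i < n) normal_prob 0 1 (B i) = \prod_(i < n) normal_prob 0 1 (B' i))%E.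
  by apply: eq_bigr => i _; rewrite /B'; case: eqP => // ->; rewrite normal_prob_opp.
rewrite -hv //; congr (P _); apply/seteqP; split => w /= h i; have := h i;
  by rewrite mxE /B'; case: eqP => // ->.
Qed.

Lemma std_gaussian_perm v (s : 'S_n) : std_gaussian P v ->
  std_gaussian P (fun w => \col_i v w (s i) 0).
Proof.
case=> mv hv; split => [i|B mB]; first by under eq_fun do rewrite mxE; exact: mv.
transitivity (P [set w | forall i, (B \o (s^-1)%g) i (v w i 0)]).
  congr (P _); apply/seteqP; split => w /= h i.
    by have := h ((s^-1)%g i); rewrite mxE permKV.
  by have := h (s i); rewrite /= permK mxE.
rewrite hv => [|i]; last exact: mB.
rewrite [RHS](reindex_inj (@perm_inj _ (s^-1)%g)) /=.
by apply: eq_bigr.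
Qed.

Definition boxes : set (set 'cV[R]_n) :=
  [set A : set 'cV[R]_n | exists B : 'I_n -> set R,
     (forall i, measurable (B i)) /\
     A = [set x : 'cV[R]_n | forall i, B i (x i 0)]].

(** A standard Gaussian vector is determined in law by the boxes, a
    generating class that is closed under intersection. *)
Lemma std_gaussian_same_law v v' (f : 'cV[R]_n -> R) c :
  std_gaussian P v -> std_gaussian P v' ->
  measurable_fun [set: g_sigma_algebraType boxes] (f : g_sigma_algebraType boxes -> R) ->
  (forall x, `|f x| <= c) ->
  (\int[P]_w (f (v w))%:E = \int[P]_w (f (v' w))%:E)%E.
Proof.
move=> gv gv' mf bf.
have mvec x : std_gaussian P x ->
    measurable_fun [set: T] (x : T -> g_sigma_algebraType boxes).
  move=> [mx _].
  apply: (@measurability _ _ T (g_sigma_algebraType boxes) setT x boxes) => //.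
  move=> _ [A [B [mB ->]] <-].
  rewrite setTI.
  have -> : x @^-1` [set y | forall i, B i (y i 0)] =
      \bigcap_(i in [set: 'I_n]) ((fun w => x w i 0) @^-1` (B i)).
    by apply/seteqP; split => w /= h i; [move=> _|]; exact: h.
  apply: fin_bigcap_measurable => [|i _]; first exact: finite_finset.
  by rewrite -[X in measurable X]setTI; exact: mx.
have law x : std_gaussian P x -> (\int[P]_w (f (x w))%:E =
    \int[pushforward P (x : T -> g_sigma_algebraType boxes)]_y (f y)%:E)%E.
  move=> gx; rewrite integral_pushforward ?preimage_setT //; first exact: mvec.
    by apply/measurable_EFinP.
  apply: (@bounded_integrable _ _ _ _ _ c) => //.
  exact: (measurableT_comp mf (mvec _ gx)).
rewrite (law _ gv) (law _ gv').
pose m x (gx : std_gaussian P x) :=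
  measure_function_pushforward__canonical__measure_function_Measure P (mvec x gx).
apply: (@eq_measure_integral _ _ _ _ (m _ gv') (m _ gv)) => A mA _.
apply: (@measure_unique _ R (g_sigma_algebraType boxes) boxes (fun=> setT)) => //.
- move=> _ _ [B1 [m1 ->]] [B2 [m2 ->]]; exists (fun i => B1 i `&` B2 i).
  split=> [i|]; first exact: measurableI.
  apply/seteqP; split => x /=; first by move=> [h1 h2] i.
  by move=> h; split => i; case: (h i).
- by move=> _; exists (fun=> setT); split => //; apply/seteqP; split.
- by rewrite bigcup_const //; exists 0%N.
- move=> _ [B [mB ->]]; rewrite /m /= /pushforward.
  have [_ h] := gv; have [_ h'] := gv'.
  exact: etrans (h B mB) (esym (h' B mB)).
- by move=> _; rewrite /m /= /pushforward preimage_setT (le_lt_trans (probability_le1 P _)) // ltry.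
Qed.

Hypothesis n0 : (0 < n)%N.

(** The product of two coordinates of the direction of x, 0 for x = 0. *)
Definition dir_prod (i j : 'I_n) (x : 'cV[R]_n) : R := x i 0 * x j 0 / bform 1%:M x x.

Lemma dir_prod_bound i j x : `|dir_prod i j x| <= 1.
Proof.
rewrite /dir_prod; have [->|x0] := eqVneq x 0.
  by rewrite !mxE !mul0r normr0.
have px := spd_gt0 (spd1 R n) x0.
rewrite normrM normfV (gtr0_norm px) ler_pdivrMr // mul1r normrM.
have h k : `|x k 0| <= enorm x.
  rewrite -(ler_pXn2r (ltn0Sn 1)) ?nnegrE ?enorm_ge0 // real_normK ?num_real //.
  rewrite -bform1_enorm bform1 (bigD1 k) //= -expr2 lerDl.
  by apply: sumr_ge0 => l _; rewrite -expr2 sqr_ge0.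
by rewrite bform1_enorm expr2; apply: ler_pM.
Qed.

Lemma dir_prod_measurable i j : measurable_fun [set: g_sigma_algebraType boxes]
  (dir_prod i j : g_sigma_algebraType boxes -> R).
Proof.
have mc k : measurable_fun [set: g_sigma_algebraType boxes]
    (fun x : g_sigma_algebraType boxes => (x : 'cV[R]_n) k 0).
  move=> _ B mB; rewrite setTI; apply: sub_sigma_algebra.
  exists (fun l => if l == k then B else setT); split.
    by move=> l; case: ifP.
  apply/seteqP; split => x /=; first by move=> h l; case: eqP => // ->.
  by move=> /(_ k); rewrite eqxx.
apply: measurable_funM; first exact: measurable_funM.
apply: measurable_fun_invr.
have -> : (fun x : g_sigma_algebraType boxes => bform 1%:M (x : 'cV[R]_n) x) =
    (fun x : g_sigma_algebraType boxes => \sum_i (x : 'cV[R]_n) i 0 * (x : 'cV[R]_n) i 0).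
  by apply/funext => x; rewrite bform1.
by apply: measurable_sum => k; exact: measurable_funM.
Qed.

Lemma gaussian_neq0 v : std_gaussian P v -> P [set w | v w = 0] = 0%E.
Proof.
move=> [mv hv]; have -> : [set w | v w = 0] = [set w | forall i, [set 0] (v w i 0)].
  apply/seteqP; split => w /=; first by move=> -> i; rewrite mxE.
  by move=> h; apply/matrixP => i j; rewrite ord1 h mxE.
rewrite (hv (fun=> [set 0])) // (bigD1 (Ordinal n0)) //= normal_prob_set1 mul0e //.
Qed.

Lemma measurable_dir_prod v i j : mxmeas v ->
  measurable_fun [set: T] (fun w => dir_prod i j (v w)).
Proof.
move=> mv; apply: measurable_funM; first exact: measurable_funM.
by apply: measurable_fun_invr; apply: mxmeas_bform => //; exact: mxmeas_cst.
Qed.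

(** The direction of a Gaussian vector is isotropic: sign changes kill the
    off-diagonal moments, exchanging coordinates makes the diagonal ones equal,
    and these add up to 1. *)
Lemma gaussian_dir_moment v i j : std_gaussian P v ->
  (\int[P]_w (dir_prod i j (v w))%:E = (if i == j then n%:R^-1 else 0)%:E)%E.
Proof.
move=> gv.
have int k l : P.-integrable [set: T] (EFin \o (fun w => dir_prod k l (v w))).
  apply: (@bounded_integrable _ _ _ _ _ 1); first exact/measurable_dir_prod/gaussian_mxmeas.
  by move=> w; exact: dir_prod_bound.
have fin k l : (\int[P]_w (dir_prod k l (v w))%:E \is a fin_num)%E.
  exact: (integrable_fin_num measurableT (int k l)).
case: (eqVneq i j) => [<-{j}|ij].
  have eqi k : (\int[P]_w (dir_prod k k (v w))%:E = \int[P]_w (dir_prod i i (v w))%:E)%E.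
    rewrite -(std_gaussian_same_law (std_gaussian_perm (tperm i k) gv) gv
      (dir_prod_measurable i i) (dir_prod_bound i i)).
    apply: eq_integral => w _; rewrite /dir_prod !mxE tpermL; congr ((_ / _)%:E).
    rewrite !bform1 [LHS](reindex_inj (@perm_inj _ (tperm i k))) /=.
    by apply: eq_bigr => l _; rewrite !mxE.
  have sum1 : (\sum_(k < n) \int[P]_w (dir_prod k k (v w))%:E = 1)%E.
    rewrite -integral_sum //; last by move=> k; exact: int.
    transitivity (\int[P]_w 1%:E)%E; last first.
      rewrite integral_cst // -[RHS]mule1; congr (_ * _)%E.
      exact: probability_setT.
    apply: ae_eq_integral => //.
    - by apply: emeasurable_sum => k; exact: measurable_int (int k k).
    - exists [set w | v w = 0]; split; [ |exact: gaussian_neq0|].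
        have -> : [set w | v w = 0] = (fun w => v w == 0) @^-1` [set true].
          by apply/seteqP; split => w /= /eqP.
        rewrite -[X in measurable X]setTI.
        have mq : measurable_fun [set: T] (fun w => v w == 0).
          by apply: mxmeas_eq; [exact: gaussian_mxmeas|exact: mxmeas_cst].
        exact: mq.
      move=> w /= h; apply: contrapT => v0; apply: h => _.
      rewrite sumEFin; congr (_%:E); rewrite /dir_prod -mulr_suml -bform1 divff //.
      by rewrite gt_eqF // spd_gt0 //; [exact: spd1|exact/eqP].
  have nE : n%:R != 0 :> R by rewrite pnatr_eq0 -lt0n.
  move: sum1; under eq_bigr do rewrite eqi; rewrite -(fineK (fin i i)) sumEFin.
  move=> [] /eqP; rewrite sumr_const card_ord => /eqP h.
  by congr (_%:E); apply: (mulfI nE); rewrite mulr_natl h divff.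
have := std_gaussian_same_law (std_gaussian_flip i gv) gv
  (dir_prod_measurable i j) (dir_prod_bound i j).
rewrite -[X in _ = X](fineK (fin i j)).
have -> : (\int[P]_w (dir_prod i j (\col_k (if k == i then - v w k 0 else v w k 0)))%:E
    = (- fine (\int[P]_w (dir_prod i j (v w))%:E))%:E)%E.
  rewrite EFinN fineK // -mulN1e -integralZl //; last exact: int.
  apply: eq_integral => w _; rewrite -EFinM; congr (_%:E).
  rewrite /dir_prod !mxE eqxx [j == i]eq_sym (negbTE ij).
  have -> : bform 1%:M (\col_k (if k == i then - v w k 0 else v w k 0))
     (\col_k (if k == i then - v w k 0 else v w k 0)) = bform 1%:M (v w) (v w).
    by rewrite !bform1; apply: eq_bigr => k _; rewrite !mxE; case: eqP => // _; rewrite mulrNN.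
  by rewrite !mulNr mul1r.
move=> [] h; rewrite -(fineK (fin i j)); congr (_%:E).
by move: h; move: (fine _) => x h; lra.
Qed.

End GaussianDirections.

(** * Expected Rayleigh quotients *)

Section RayleighQuotients.
Context (dd : measure_display) (T : measurableType dd) (R : realType).
Variable P : probability T R.

(** The integral of a nonnegative function is a supremum over simple functions
    below it, hence monotone without any measurability. *)
Lemma integral_mono (f g : T -> R) : (forall w, 0 <= f w) -> (forall w, f w <= g w) ->
  (\int[P]_w (f w)%:E <= \int[P]_w (g w)%:E)%E.
Proof.
move=> f0 fg; rewrite !ge0_integralTE; first last.
- by move=> w; rewrite lee_fin.
- by move=> w; rewrite lee_fin (le_trans (f0 w)).
apply: le_ereal_sup => _ [h hf <-]; exists h => // w.
by apply: le_trans (hf w) _; rewrite lee_fin.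
Qed.

Lemma integral_prob_cst (c : R) : (\int[P]_w c%:E = c%:E)%E.
Proof.
by rewrite integral_cst // -[RHS]mule1; congr (_ * _)%E; exact: probability_setT.
Qed.

Lemma expectationE (X : T -> R) : ('E_P[X] = \int[P]_w (X w)%:E)%E.
Proof. by rewrite unlock. Qed.

(** For a matrix that is independent of the Gaussian vector v, the Rayleigh
    quotient at v averages to the trace over n. *)
Lemma expected_rayleigh n (A : T -> 'M[R]_n) (v : T -> 'cV[R]_n) c : (0 < n)%N ->
  std_gaussian P v -> mxmeas A -> (forall w i j, `|A w i j| <= c) ->
  (forall i j k l B1 B2, measurable B1 -> measurable B2 ->
    P ((fun w => A w i j) @^-1` B1 `&` (fun w => dir_prod k l (v w)) @^-1` B2) =
    (P ((fun w => A w i j) @^-1` B1) * P ((fun w => dir_prod k l (v w)) @^-1` B2))%E) ->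
  (\int[P]_w (bform (A w) (v w) (v w) / bform 1%:M (v w) (v w))%:E =
    (n%:R^-1)%:E * \int[P]_w (\tr (A w))%:E)%E.
Proof.
move=> n0 gv mA bA ind; have mv := gaussian_mxmeas gv.
have iA i j : P.-integrable [set: T] (EFin \o (fun w => A w i j)).
  by apply: (@bounded_integrable _ _ _ _ _ c) => //; exact: mA.
have mD i j : measurable_fun [set: T] (fun w => dir_prod i j (v w)).
  exact: measurable_dir_prod.
have iAD i j : P.-integrable [set: T] (EFin \o (fun w => A w i j * dir_prod i j (v w))).
  apply: (@bounded_integrable _ _ _ _ _ c); first by apply: measurable_funM => //; exact: mA.
  move=> w; rewrite normrM -[leRHS]mulr1; apply: ler_pM => //.
  exact: dir_prod_bound.
transitivity (\int[P]_w (\sum_i \sum_j (A w i j * dir_prod i j (v w))%:E))%E.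
  apply: eq_integral => w _.
  under [RHS]eq_bigr do rewrite sumEFin.
  rewrite sumEFin; congr (_%:E).
  rewrite /bform mxE mulr_suml exchange_big /=; apply: eq_bigr => j _.
  rewrite mxE mulr_suml mulr_suml; apply: eq_bigr => i _.
  rewrite [(v w)^T 0 i]mxE /dir_prod /bform mulrA [A w i j * _]mulrA.
  by congr (_ / _); rewrite [v w i 0 * _]mulrC.
rewrite integral_sum //; last by move=> i; apply: integrable_sum => // *; exact: iAD.
transitivity (\sum_(i < n) (n%:R^-1)%:E * \int[P]_w (A w i i)%:E)%E.
  apply: eq_bigr => i _; rewrite integral_sum; [|by []|by move=> j; exact: iAD].
  have fact j : (\int[P]_w (A w i j * dir_prod i j (v w))%:E =
      \int[P]_w (A w i j)%:E * (if i == j then n%:R^-1 else 0)%:E)%E.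
    rewrite (integral_indep_mul (mA i j) (mD i j) (fun w => bA w i j)
      (fun w => dir_prod_bound i j (v w))) ?gaussian_dir_moment // => B1 B2.
    exact: ind.
  rewrite (bigD1 i) //= big1 => [|j ji]; last first.
    by rewrite fact eq_sym (negbTE ji) mule0.
  by rewrite fact eqxx adde0 muleC.
have fin i : (\int[P]_w (A w i i)%:E \is a fin_num)%E.
  exact: (integrable_fin_num measurableT (iA i i)).
under eq_bigr => i _ do rewrite -(fineK (fin i)) -EFinM.
rewrite sumEFin -mulr_sumr EFinM -sumEFin.
under eq_bigr => i _ do rewrite fineK //.
rewrite -integral_sum //; last by move=> i; exact: iA.
congr (_ * _)%E.
by apply: eq_integral => w _; rewrite sumEFin.
Qed.

End RayleighQuotients.

(** * From decaying expectations to superlinear convergence *)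

Section HighProbability.
Context (dd : measure_display) (T : measurableType dd) (R : realType).
Variable P : probability T R.

(** For 2 y > 1 take the least integer above ln (2 y) / g: the first summand of
    the constant pays for ln (2 y) <= 2 ln (1 + y), the second for rounding up,
    as then ln (1 + y) exceeds ln (3 / 2). *)
Lemma logarithmic_time (y g : R) : 0 <= y -> 0 < g <= 1 ->
  exists t0 : nat, t0%:R <= (2 + (ln (3 / 2))^-1) * (ln (1 + y) / g) /\
    2 * y * (1 - g) ^+ t0 <= 1.
Proof.
move=> y0 /andP[g0 g1].
have l32 : 0 < ln (3 / 2 : R) by apply: ln_gt0; lra.
have [hy|hy] := leP (2 * y) 1.
  exists 0%N; rewrite expr0 mulr1; split => //.
  by rewrite mulr_ge0 ?addr_ge0 ?invr_ge0 ?divr_ge0 ?(ltW l32) ?(ltW g0) // ln_ge0 // lerDl.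
have ly : 0 <= ln (2 * y) / g by rewrite divr_ge0 ?(ltW g0) // ln_ge0 // ltW.
exists (Num.truncn (ln (2 * y) / g)).+1.
have /andP[h1 h2] := truncn_itv ly; split.
  apply: (@le_trans _ _ (ln (2 * y) / g + 1)); first by rewrite -natr1 lerD2r.
  have h3 : ln (2 * y) <= 2 * ln (1 + y).
    have -> : 2 * ln (1 + y) = ln ((1 + y) ^+ 2).
      by rewrite lnXn ?mulr_natl // ltr_pwDl.
    rewrite ler_ln ?posrE ?exprn_gt0 ?ltr_pwDl //; last by lra.
    by rewrite -subr_ge0; have := sqr_ge0 y; nra.
  have h4 : 1 <= ln (1 + y) / ln (3 / 2).
    by rewrite ler_pdivlMr // mul1r ler_ln ?posrE ?ltr_pwDl //; lra.
  have -> : (2 + (ln (3 / 2))^-1) * (ln (1 + y) / g) =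
      (2 * ln (1 + y)) / g + ln (1 + y) / ln (3 / 2) / g.
    by field; rewrite !gt_eqF.
  apply: lerD; first by rewrite ler_pM2r ?invr_gt0.
  by rewrite ler_pdivlMr // mul1r (le_trans g1).
set m := (Num.truncn _).+1 in h2 *.
have y2 : 0 < 2 * y by lra.
have e1 : (1 - g) ^+ m <= expR (- g) ^+ m.
  apply: lerXn2r; rewrite ?nnegrE ?expR_ge0 ?subr_ge0 //.
  exact: expR_ge1Dx.
have e2 : expR (- g) ^+ m <= (2 * y)^-1.
  rewrite -expRM_natl -[leRHS]lnK ?posrE ?invr_gt0 // ler_expR lnV ?posrE //.
  by rewrite mulrN lerN2 -ler_pdivrMr // ltW.
apply: le_trans (ler_wpM2l (ltW y2) (le_trans e1 e2)) _.
by rewrite divff // gt_eqF.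
Qed.

Lemma markov_ge (Z : T -> R) (a : R) : measurable_fun [set: T] Z ->
  (forall w, 0 <= Z w) -> 0 < a ->
  (a%:E * P [set w | (a <= Z w)%R] <= \int[P]_w (Z w)%:E)%E.
Proof.
move=> mZ Z0 a0.
have mE : measurable_fun [set: T] (EFin \o Z) by exact/measurable_EFinP.
have := @le_integral_comp_abse _ _ _ P setT measurableT (EFin \o Z) a id
  (fun _ A mA => measurableI _ _ measurableT mA) (fun r h => h) (fun x y _ _ h => h) mE a0.
rewrite setTI /=.
have -> : [set x | (a%:E <= `|(Z x)%:E|)%E] = [set w | a <= Z w].
  by apply/seteqP; split => w /=; rewrite lee_fin ger0_norm.
by under eq_integral do rewrite /= ger0_norm //.
Qed.

(** With the thresholds (1 + g)^-t / 2 for the factors Z (t0 + t), the Markov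
    bounds are 2 q (1 - g)^t0 (1 - g^2)^t, with sum 2 q (1 - g)^t0 / g^2. Once t0
    makes this at most p, outside an event of probability p all the factors are
    below their thresholds, whose product is the asserted bound. *)
Lemma superlinear_whp (Z l : nat -> T -> R) (g q rho l0 p : R) :
  0 < g <= 1 -> 0 <= q -> 0 < p ->
  (forall t, measurable_fun [set: T] (Z t)) -> (forall t w, 0 <= Z t w) ->
  (forall t, measurable_fun [set: T] (l t)) -> (forall t w, 0 <= l t w) ->
  (forall t w, l t.+1 w <= Z t w * l t w) ->
  (forall t w, l t w <= rho ^+ t * l0) ->
  (forall t, \int[P]_w (Z t w)%:E <= ((1 - g) ^+ t * q)%:E)%E ->
  exists t0 : nat,
    t0%:R <= (2 + (ln (3 / 2))^-1) * (ln (1 + q / (p * g ^+ 2)) / g) /\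
    ((1 - p)%:E <= P [set w | forall t : nat, (1 <= t)%N ->
      (l (t0 + t)%N w <= (1 - g / (g + 1)) ^+ ((t * (t - 1)) %/ 2) *
          (1 / 2) ^+ t * rho ^+ t0 * l0)%R])%E.
Proof.
move=> /andP[g0 g1] q0 p0 mZ Z0 ml lpos lZ lr EZ.
have pg : 0 < p * g ^+ 2 by rewrite mulr_gt0 ?exprn_gt0.
have [||t0 [t0b t0e]] := @logarithmic_time (q / (p * g ^+ 2)) g.
- by rewrite divr_ge0 // ltW.
- by rewrite g0.
exists t0; split => //.
have {}t0e : 2 * q * (1 - g) ^+ t0 <= p * g ^+ 2.
  move: t0e; rewrite mulrA mulrAC ler_pdivrMr // mul1r.
  by rewrite mulrAC.
have gg0 : 0 < 1 + g by rewrite ltr_pwDl // ltW.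
pose a t : R := 1 / 2 * (1 + g) ^- t.
have a0 t : 0 < a t by rewrite /a mulr_gt0 ?divr_gt0 // invr_gt0 exprn_gt0.
pose B t := [set w | a t <= Z (t0 + t)%N w].
have mB t : measurable (B t).
  have -> : B t = Z (t0 + t)%N @^-1` `[a t, +oo[%classic.
    by apply/seteqP; split => w /=; rewrite in_itv /= andbT.
  by rewrite -[X in measurable X]setTI; apply: mZ => //; exact: measurable_itv.
pose c := 2 * q * (1 - g) ^+ t0; pose r := 1 - g ^+ 2.
have c0 : 0 <= c by rewrite !mulr_ge0 // exprn_ge0 // subr_ge0.
have PB t : (P (B t) <= (c * r ^+ t)%:E)%E.
  rewrite -(lee_pmul2l (_ : (a t)%:E \is a fin_num)) ?lte_fin //.
  apply: le_trans (markov_ge (mZ _) (Z0 _) (a0 t)) _.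
  apply: le_trans (EZ _) _; rewrite -EFinM lee_fin le_eqVlt; apply/orP; left.
  apply/eqP; rewrite /a /c /r exprD.
  have -> : 1 - g ^+ 2 = (1 - g) * (1 + g) by ring.
  rewrite exprMn; field; by rewrite expf_neq0 // gt_eqF.
pose bad := \bigcup_t B t.
have mbad : measurable bad by exact: bigcupT_measurable.
have Pbad : (P bad <= p%:E)%E.
  apply: (@le_trans _ _ (\sum_(t <oo) P (B t))%E).
    by apply: measure_sigma_subadditive => //; exact: subset_refl.
  apply: lime_le; first exact: is_cvg_nneseries.
  apply: nearW => m /=.
  apply: (@le_trans _ _ (\sum_(0 <= t < m) (c * r ^+ t)%:E)%E).
    by apply: lee_sum => t _.
  rewrite sumEFin lee_fin -mulr_sumr big_mkord.
  have r1 : 1 - r = g ^+ 2 by rewrite /r subKr.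
  have r0 : 0 <= r by rewrite subr_ge0 expr_le1 // ltW.
  have gs x : (1 - x) * (\sum_(i < m) x ^+ i) = 1 - x ^+ m :> R.
    by rewrite -[RHS]opprB subrX1 -[in RHS]mulNr opprB.
  have g20 : 0 < g ^+ 2 by rewrite exprn_gt0.
  rewrite -(ler_pM2r g20); apply: le_trans t0e.
  rewrite -r1 -mulrA [_ * (1 - r)]mulrC gs.
  by rewrite ler_piMr // gerBl exprn_ge0.
set W := (X in P X).
have mW : measurable W.
  have -> : W = \bigcap_t [set w | (1 <= t)%N -> l (t0 + t)%N w <=
      (1 - g / (g + 1)) ^+ ((t * (t - 1)) %/ 2) * (1 / 2) ^+ t * rho ^+ t0 * l0].
    by apply/seteqP; split => w /= h t; [move=> _; exact: h|exact: h].
  apply: bigcap_measurable => [|t _]; first by exists 0%N.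
  case: (posnP t) => [->|t1].
    by rewrite (_ : [set _ | _] = setT) //; apply/seteqP; split.
  set b := (X in [set w | _ -> l _ w <= X]).
  have -> : [set w | true -> l (t0 + t)%N w <= b] =
      l (t0 + t)%N @^-1` `]-oo, b]%classic.
    by apply/seteqP; split => w /=; rewrite in_itv /=; [exact|move=> h _].
  by rewrite -[X in measurable X]setTI; apply: ml => //; exact: measurable_itv.
have sub : ~` bad `<=` W.
  move=> w wB; suff h t : l (t0 + t)%N w <=
      (1 + g) ^- 'C(t, 2) * (1 / 2) ^+ t * (rho ^+ t0 * l0).
    move=> t _; apply: le_trans (h t) _; rewrite mulrA.
    have -> : 1 - g / (g + 1) = (1 + g)^-1.
      rewrite [g + 1]addrC -{1}(divff (lt0r_neq0 gg0)).
      by rewrite -mulrBl addrK mul1r.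
    by rewrite subn1 divn2 -bin2 exprVn.
  elim: t => [|t IH]; first by rewrite addn0 bin0n expr0 invr1 !mul1r; exact: lr.
  rewrite addnS; apply: le_trans (lZ _ _) _.
  have hz : Z (t0 + t)%N w <= a t.
    by rewrite leNgt; apply/negP => /ltW h; apply: wB; exists t.
  apply: le_trans (ler_pM (Z0 _ _) (lpos _ _) hz IH) _.
  rewrite le_eqVlt; apply/orP; left; apply/eqP.
  rewrite /a binS bin1 exprD exprS invfM.
  by move: ((1 + g) ^- t) ((1 + g) ^- 'C(t, 2)) (rho ^+ t0 * l0) => A1 A2 A3; ring.
apply: (@le_trans _ _ (P (~` bad))); last first.
  by apply: le_measure => //; rewrite inE //; exact: measurableC.
by rewrite probability_setC // EFinB; apply: leeB.
Qed.

End HighProbability.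

Section Stochastic.
Variables (R : realType) (n d : nat) (F : 'cV[R]_d -> 'cV[R]_n) (L L2 mu : R).
Variables (opt : rqgn_option) (x0 : 'cV[R]_d) (G0 : 'M[R]_n).
Context (disp : measure_display) (T : measurableType disp) (P : probability T R).
Variables (u : nat -> T -> 'cV[R]_n) (K : nat -> T -> 'M[R]_n).
Hypotheses (n0 : (0 < n)%N) (dF : forall y, differentiable F y).
Hypotheses (L0 : 0 < L) (L20 : 0 < L2) (mu0 : 0 < mu).
Hypothesis JL : forall y, spectral_norm (jac F y) <= L.
Hypothesis JLip : forall y z,
  spectral_norm (jac F y - jac F z) <= L2 * enorm (y - z).
Hypothesis Jmu : forall y, Omega_under F mu L2 y -> mu <= sing_val n (jac F y).
Hypotheses (Ox0 : Omega_under F mu L2 x0) (HG0 : loewner (gram F x0) G0).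
Let eta0 := loewner_ratio G0 (gram F x0).
Let gamma := rqgn_gamma opt n mu L.
Let N := pot_weight n opt mu L.
Let M := 2 * L * L2 / mu ^+ 2.
Let rho := 1 - 1 / (2 * eta0).
Hypothesis small : lambda_under F x0 <= mu ^+ 2 * (1 - gamma) /
      (20 * rqgn_ctilde opt mu L * n%:R * L * L2 * eta0).
Hypothesis gauss : forall t, std_gaussian P (u t).
Hypothesis indep : indep_of_past P u.
Let st t w := rqgn opt F M x0 G0 (u ^~ w) (K ^~ w) t.
Hypothesis factor : opt = OptionII -> determined_by_past u K /\
     {ae P, forall w, forall t,
        invmx (rqgn_scaled_G F M (st t w)) = (K t w)^T *m K t w}.

(* At time t: lm is lambda, dl and ds are the potentials before and after the
   correction by 1 + M r_t, gn is the gain matrix and Gs the corrected G_t. *)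
Let lm t w := lambda_under F (st t w).1.
Let dl t w := path_pot F L L2 mu opt x0 G0 (u ^~ w) (K ^~ w) t.
Let ds t w := path_pot_scaled F L L2 mu opt x0 G0 (u ^~ w) (K ^~ w) t.
Let gn t w := path_gain F L L2 mu opt x0 G0 (u ^~ w) (K ^~ w) t.
Let Gs t w := rqgn_scaled_G F M (st t w).

Let eta1 : 1 <= eta0.
Proof. by apply: loewner_ratio_ge1 => //; exact: (gram_spd n0 L0 mu0 JL Jmu). Qed.
Let muL : mu <= L := mu_le_L n0 L0 mu0 JL Jmu Ox0.
Let g0 : 0 < gamma. Proof. exact: gamma_gt0. Qed.
Let g1 : gamma <= 1. Proof. exact: gamma_le1. Qed.
Let N1 : 1 <= N.
Proof.
rewrite /N /pot_weight -[leLHS]mulr1; apply: ler_pM => //.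
  exact: (ctilde_ge1 opt mu0 muL).
by rewrite ler1n.
Qed.
Let M0 : 0 < M. Proof. by rewrite divr_gt0 ?mulr_gt0 ?exprn_gt0. Qed.

(** * Information carried by the directions *)

(** Generators of the sigma-algebra of the directions with index in I; the type
    info I is T equipped with it. *)
Definition dir_events (I : set nat) : set (set T) :=
  [set A | exists s (i : 'I_n) (B : set R),
     [/\ I s, measurable B & A = (fun w => u s w i 0) @^-1` B]].
Notation info I := (g_sigma_algebraType (dir_events I)).

Lemma info_measurable I A : sigma_gen u I A -> measurable A.
Proof.
apply: smallest_sub; first exact: sigma_algebra_measurable.
move=> _ [s [i [B [_ mB ->]]]]; rewrite -[X in measurable X]setTI.
by have [mu_ _] := gauss s; exact: mu_.
Qed.

Lemma info_mxmeas I m p (A : T -> 'M[R]_(m, p)) :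
  mxmeas (A : info I -> 'M[R]_(m, p)) -> mxmeas A.
Proof.
move=> h i j _ B mB; rewrite setTI; apply: (@info_measurable I).
by have := h i j measurableT B mB; rewrite setTI.
Qed.

Lemma info_dir (I : set nat) s : I s -> mxmeas (u s : info I -> 'cV[R]_n).
Proof.
move=> Is i j _ B mB; rewrite setTI ord1; apply: sub_sigma_algebra.
by exists s, i, B.
Qed.

Let past t := [set s | (s < t)%N].

Lemma info_factor t s : opt = OptionII -> (s <= t)%N ->
  mxmeas (K s : info (past t) -> 'M[R]_n).
Proof.
move=> e st_ i j _ B mB; have [h _] := factor e.
rewrite setTI; apply: (@sub_sigma_algebra2 _ setT _ _ _ _ (h s i j B mB)).
move=> _ [r [k [C [rs mC ->]]]]; exists r, k, C; split => //.
exact: leq_trans rs st_.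
Qed.

Lemma info_state t : mxmeas ((fun w => (st t w).1) : info (past t) -> 'cV[R]_d) /\
  mxmeas ((fun w => (st t w).2) : info (past t) -> 'M[R]_n).
Proof.
apply: (@mxmeas_rqgn _ (info (past t)) R n d F L2 dF JLip opt M x0 G0 u K t).
  by move=> s lt_st; exact: info_dir.
by move=> e s lt_st; apply: info_factor => //; exact: ltnW.
Qed.

Lemma info_next t :
  mxmeas ((fun w => gram F (st t.+1 w).1) : info (past t) -> 'M[R]_n).
Proof.
have [mx mG] := info_state t.
apply: (mxmeas_gram JLip); exact: (mxmeas_next dF JLip mx mG).
Qed.

Lemma info_scaled t : mxmeas ((fun w => Gs t w) : info (past t) -> 'M[R]_n).
Proof. by have [mx mG] := info_state t; exact: (mxmeas_scaled dF JLip M mx mG). Qed.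

Definition has_factor t w : bool :=
  if opt is OptionII then invmx (Gs t w) == (K t w)^T *m K t w else true.

Lemma has_factorP t w : has_factor t w -> good_factor opt (K t w) (Gs t w).
Proof. by rewrite /has_factor => h e; rewrite e in h; exact/eqP. Qed.

Lemma ae_has_factor : {ae P, forall w, forall t, has_factor t w}.
Proof.
have [e|e] := pselect (opt = OptionII); last first.
  by apply: aeW => w t; rewrite /has_factor; case: opt e.
have [_ h] := factor e; apply: filterS h => w h t.
by rewrite /has_factor e; apply/eqP; exact: h.
Qed.

(** The gain matrix, set to 0 on the null event where K_t is not a factor: it
    is then bounded everywhere. *)
Definition gain_or0 t w : 'M[R]_n := if has_factor t w then gn t w else 0.

Lemma info_gain t : mxmeas (gain_or0 t : info (past t) -> 'M[R]_n).
Proof.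
have mK (e : opt = OptionII) : mxmeas (K t : info (past t) -> 'M[R]_n).
  exact: info_factor.
apply: mxmeas_if; last exact: mxmeas_cst.
  rewrite /has_factor; case: opt mK => mK; try exact: measurable_cst.
  apply: mxmeas_eq; first exact: (mxmeas_inv (@info_scaled t)).
  by apply: mxmeasM; [apply: mxmeas_tr|]; exact: mK.
by apply: mxmeas_gain => //; [exact: info_scaled|exact: info_next].
Qed.

Lemma gain_or0_psd t w : psd (gain_or0 t w).
Proof.
rewrite /gain_or0; case: ifP => [/has_factorP g|_].
  exact: (path_gain_psd n0 dF L0 L20 mu0 JL JLip Jmu Ox0 HG0 small g).
by split; [exact: trmx0|move=> v; rewrite mulmx0 mul0mx mxE].
Qed.

Lemma gain_or0_bound t w i j :
  `|gain_or0 t w i j| <= N * (4 * ratio_bound F x0 G0 t - 1).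
Proof.
rewrite /gain_or0; case: ifP => [/has_factorP g|_].
  exact: (path_gain_bound n0 dF L0 L20 mu0 JL JLip Jmu Ox0 HG0 small g).
rewrite mxE normr0 mulr_ge0 ?(le_trans _ N1) //.
by have := ratio_bound_ge1 n0 L0 mu0 JL Jmu Ox0 HG0 t; lra.
Qed.

Lemma gain_dir_indep t i j k l B1 B2 : measurable B1 -> measurable B2 ->
  P ((fun w => gain_or0 t w i j) @^-1` B1 `&` (fun w => dir_prod k l (u t w)) @^-1` B2) =
  (P ((fun w => gain_or0 t w i j) @^-1` B1) *
   P ((fun w => dir_prod k l (u t w)) @^-1` B2))%E.
Proof.
move=> mB1 mB2; rewrite setIC muleC; apply: (indep (t := t)).
  have := @measurable_dir_prod R _ (info [set t]) n _ k l (info_dir (erefl t)).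
  by move=> /(_ measurableT _ mB2); rewrite setTI.
by have := @info_gain t i j measurableT _ mB1; rewrite setTI.
Qed.

Lemma measurable_state t : mxmeas (fun w => (st t w).1) /\ mxmeas (fun w => (st t w).2).
Proof. by have [mx mG] := info_state t; split; exact: info_mxmeas. Qed.

Lemma measurable_lm t : measurable_fun [set: T] (lm t).
Proof. by have [mx _] := measurable_state t; exact: (measurable_lambda dF JLip). Qed.

Lemma measurable_dl t : measurable_fun [set: T] (dl t).
Proof.
have [mx mG] := measurable_state t.
by apply: measurable_pot => //; exact: (mxmeas_gram JLip).
Qed.

Lemma measurable_ds t : measurable_fun [set: T] (ds t).
Proof.
apply: measurable_pot; first exact: info_mxmeas (@info_scaled t).
exact: info_mxmeas (@info_next t).
Qed.

(** * Decrease of the potential in expectation *)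

Let dl0 t w : 0 <= dl t w.
Proof. exact: (path_pot_ge0 n0 dF L0 L20 mu0 JL JLip Jmu Ox0 HG0 small). Qed.

Let ds0 t w : 0 <= ds t w.
Proof.
apply: (pot_ge0 opt n0 mu0 (gram_well_cond n0 L0 mu0 JL Jmu
  (path_in n0 dF L0 L20 mu0 JL JLip Jmu Ox0 HG0 small (u ^~ w) (K ^~ w) t.+1))).
exact: (path_scaled_lower n0 dF L0 L20 mu0 JL JLip Jmu Ox0 HG0 small).
Qed.

Let delta0 := rqgn_delta0 opt mu L G0 (gram F x0).

(** The Lyapunov function: the potential alone is not decreasing in expectation,
    since the drift of the Gram matrix raises it by a multiple of lambda. *)
Let theta t w := dl t w + 2 * N * (M * lm t w).

Let theta_init w : theta 0 w = delta0 + 2 * N * (M * lambda_under F x0).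
Proof. by []. Qed.

#[local] Opaque path_pot path_pot_scaled path_gain lambda_under gram rqgn_scaled_G rqgn
  rqgn_delta0 spectral_norm enorm jac sing_val loewner_ratio rqgn_ctilde rqgn_gamma.

(** The gain is a function of the past, independent of the direction, so its
    expected Rayleigh quotient is its expected trace over n. *)
Lemma expected_pot_step t :
  (\int[P]_w (dl t.+1 w)%:E + gamma%:E * \int[P]_w (ds t w)%:E <= \int[P]_w (ds t w)%:E)%E.
Proof.
pose q w := bform (gain_or0 t w) (u t w) (u t w) / bform 1%:M (u t w) (u t w).
have mA : mxmeas (gain_or0 t) by exact: info_mxmeas (@info_gain t).
have mu_ : mxmeas (u t) by exact: gaussian_mxmeas (gauss t).
have mq : measurable_fun [set: T] q.
  apply: measurable_funM; first exact: mxmeas_bform.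
  by apply: measurable_fun_invr; apply: mxmeas_bform => //; exact: mxmeas_cst.
have q0 w : 0 <= q w.
  by rewrite divr_ge0 //; apply: psd_ge0; [exact: gain_or0_psd|exact: psd1].
apply: (@le_trans _ _ (\int[P]_w (dl t.+1 w)%:E + \int[P]_w (q w)%:E)%E); last first.
  rewrite -ge0_integralD //; first last.
  - exact/measurable_EFinP.
  - by move=> w _; rewrite lee_fin; exact: q0.
  - by apply/measurable_EFinP; exact: measurable_dl.
  - by move=> w _; rewrite lee_fin; exact: dl0.
  apply: ae_ge0_le_integral; first exact: measurableT.
  - by move=> w _; rewrite adde_ge0 // lee_fin; [exact: dl0|exact: q0].
  - apply: emeasurable_funD; last exact/measurable_EFinP.
    by apply/measurable_EFinP; exact: measurable_dl.
  - by move=> w _; rewrite lee_fin; exact: ds0.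
  - by apply/measurable_EFinP; exact: measurable_ds.
  apply: filterS ae_has_factor => w h _; rewrite -EFinD lee_fin -lerBrDr /q /gain_or0 h.
  exact: (path_pot_step n0 dF L0 L20 mu0 JL JLip Jmu Ox0 HG0 small (has_factorP (h t))).
apply: leeD2l.
rewrite (expected_rayleigh n0 (gauss t) mA (gain_or0_bound t) (@gain_dir_indep t)).
have nR : 0 < n%:R :> R by rewrite ltr0n.
rewrite -!ge0_integralZl_EFin //; first last.
- exact: ltW.
- by apply/measurable_EFinP; exact: measurable_ds.
- by move=> w _; rewrite lee_fin; exact: ds0.
- by apply/measurable_EFinP; exact: mxmeas_trace.
- by move=> w _; rewrite lee_fin; apply: trace_psd_nneg; exact: gain_or0_psd.
apply: ae_ge0_le_integral; first exact: measurableT.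
- by move=> w _; rewrite -EFinM lee_fin; apply: mulr_ge0 (ltW g0) (ds0 t w).
- apply/measurable_EFinP; apply: measurable_funM; first exact: measurable_cst.
  exact: measurable_ds.
- move=> w _; rewrite -EFinM lee_fin mulr_ge0 ?invr_ge0 ?(ltW nR) //.
  by apply: trace_psd_nneg; exact: gain_or0_psd.
- apply/measurable_EFinP; apply: measurable_funM; first exact: measurable_cst.
  exact: mxmeas_trace.
apply: filterS ae_has_factor => w h _; rewrite -!EFinM lee_fin ler_pdivlMl // mulrA /gain_or0 h.
exact: (path_gain_trace n0 dF L0 L20 mu0 JL JLip Jmu Ox0 HG0 small (has_factorP (h t))).
Qed.

(* The a priori bound of M times lambda. *)
Let s_ t := rho ^+ t / (10 * eta0).

Let lm0 t w : 0 <= lm t w. Proof. exact: lambda_ge0. Qed.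
Let ml0 t w : 0 <= M * lm t w. Proof. by rewrite mulr_ge0 // ltW. Qed.
Let mls t w : M * lm t w <= s_ t.
Proof. exact: (path_weight1 n0 dF L0 L20 mu0 JL JLip Jmu Ox0 HG0 small). Qed.
Let nmls t w : N * (M * lm t w) <= (1 - gamma) * s_ t.
Proof. exact: (path_weight n0 dF L0 L20 mu0 JL JLip Jmu Ox0 HG0 small). Qed.
Let N0 : 0 <= N. Proof. exact: le_trans ler01 N1. Qed.
Let nml0 t w : 0 <= N * (M * lm t w). Proof. exact: mulr_ge0 N0 (ml0 t w). Qed.
Let w0 t w : 0 <= 2 * N * (M * lm t w).
Proof. by rewrite -mulrA; exact: mulr_ge0 (ler0n _ 2) (nml0 t w). Qed.
Let s0 t : 0 <= s_ t. Proof. exact: le_trans (ml0 t point) (mls t point). Qed.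

Let theta_ge t w : dl t w + M * lm t w / 4 <= theta t w.
Proof.
rewrite /theta lerD2l; have := ml0 t w; have := N1; set z := M * _; set N' := N.
move=> h1 h2; have : z <= N' * z by rewrite ler_peMl.
by lra.
Qed.

Let theta0 t w : 0 <= theta t w.
Proof. by apply: le_trans (theta_ge t w); rewrite addr_ge0 // divr_ge0. Qed.

Let measurable_theta t : measurable_fun [set: T] (theta t).
Proof.
apply: measurable_funD; first exact: measurable_dl.
apply: measurable_funM; first exact: measurable_cst.
by apply: measurable_funM; [exact: measurable_cst|exact: measurable_lm].
Qed.

Let step_factor t w := (1 + M * lm t w / 2) * (dl t w + M * lm t w / 4).

Let lm_step t w : lm t.+1 w <= step_factor t w * lm t w.
Proof.
rewrite /step_factor -mulrA.
exact: (path_lambda_step n0 dF L0 L20 mu0 JL JLip Jmu Ox0 HG0 small).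
Qed.

Let step_factor_le t w : step_factor t w <= (1 + s_ t) * theta t w.
Proof.
apply: ler_pM => //.
- by rewrite addr_ge0 // divr_ge0.
- by rewrite addr_ge0 // divr_ge0.
- by have := mls t w; have := ml0 t w; lra.
Qed.

(** Both parts of theta acquire the factor 1 - gamma: the potential by the
    update, and lambda because one step multiplies it by at most
    (1 + s_t) theta, where N M lambda is at most (1 - gamma) s_t. *)
Lemma theta_step t C : (\int[P]_w (theta t w)%:E <= C%:E)%E ->
  (\int[P]_w (theta t.+1 w)%:E <= ((1 - gamma) * expR (4 * s_ t) * C)%:E)%E.
Proof.
move=> hC; have st0 := s0 t; have g10 : 0 <= 1 - gamma by rewrite subr_ge0.
have b_le : (\int[P]_w (ds t w)%:E <= ((1 + s_ t) ^+ 2 * C)%:E)%E.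
  apply: (@le_trans _ _ (\int[P]_w ((1 + s_ t) ^+ 2 * theta t w)%:E)%E).
    apply: integral_mono => w; first exact: ds0.
    apply: le_trans (path_scaled_pot_le n0 dF L0 L20 mu0 JL JLip Jmu Ox0 HG0 small _ _ t) _.
    apply: ler_pM; rewrite ?sqr_ge0 //; first exact: theta0.
    apply: lerXn2r; rewrite ?nnegrE.
    - exact: addr_ge0 ler01 (ml0 t w).
    - exact: addr_ge0 ler01 st0.
    - by rewrite lerD2l; exact: mls.
  under eq_integral do rewrite EFinM.
  rewrite ge0_integralZl_EFin ?sqr_ge0 //; first last.
  - by apply/measurable_EFinP; exact: measurable_theta.
  - by move=> w _; rewrite lee_fin.
  by rewrite [((1 + s_ t) ^+ 2 * C)%:E]EFinM lee_wpmul2l // lee_fin sqr_ge0.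
have l_le : (\int[P]_w (2 * N * (M * lm t.+1 w))%:E <=
    ((1 - gamma) * (2 * s_ t * (1 + s_ t) ^+ 2) * C)%:E)%E.
  apply: (@le_trans _ _ (\int[P]_w ((1 - gamma) * (2 * s_ t * (1 + s_ t) ^+ 2) * theta t w)%:E)%E).
    apply: integral_mono => w; first exact: w0.
    apply: (@le_trans _ _ (2 * (step_factor t w * (N * (M * lm t w))))).
      rewrite -[2 * N * _]mulrA ler_pM2l //.
      have := ler_wpM2l (mulr_ge0 N0 (ltW M0)) (lm_step t w).
      by congr (_ <= _); ring.
    have h : step_factor t w * (N * (M * lm t w)) <=
        ((1 + s_ t) * theta t w) * ((1 - gamma) * s_ t).
      apply: ler_pM; [|exact: nml0|exact: step_factor_le|exact: nmls].
      by apply: mulr_ge0; apply: addr_ge0 => //; exact: divr_ge0.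
    apply: le_trans (ler_wpM2l _ h) _ => //.
    have h1 : 1 + s_ t <= (1 + s_ t) ^+ 2 by rewrite expr2 ler_peMl ?addr_ge0 // lerDl.
    have h2 : 0 <= 2 * s_ t * (1 - gamma) * theta t w.
      exact: mulr_ge0 (mulr_ge0 (mulr_ge0 (ler0n _ 2) st0) g10) (theta0 t w).
    have := ler_wpM2l h2 h1; move: (theta t w) (s_ t) => a b.
    by congr (_ <= _); ring.
  under eq_integral do rewrite EFinM.
  have k0 : 0 <= (1 - gamma) * (2 * s_ t * (1 + s_ t) ^+ 2).
    exact: mulr_ge0 g10 (mulr_ge0 (mulr_ge0 (ler0n _ 2) st0) (sqr_ge0 _)).
  rewrite ge0_integralZl_EFin //; first last.
  - by apply/measurable_EFinP; exact: measurable_theta.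
  - by move=> w _; rewrite lee_fin.
  by rewrite [X in (_ <= X)%E]EFinM lee_wpmul2l // lee_fin.
have C0 : 0 <= C.
  by rewrite -lee_fin; apply: le_trans hC; apply: integral_ge0 => w _; rewrite lee_fin.
have a_le : (\int[P]_w (dl t.+1 w)%:E <= ((1 - gamma) * ((1 + s_ t) ^+ 2 * C))%:E)%E.
  have := expected_pot_step t; move: b_le.
  have b0 : (0 <= \int[P]_w (ds t w)%:E)%E.
    by apply: integral_ge0 => w _; rewrite lee_fin; exact: ds0.
  have a0 : (0 <= \int[P]_w (dl t.+1 w)%:E)%E.
    by apply: integral_ge0 => w _; rewrite lee_fin; exact: dl0.
  move: (\int[P]_w (ds t w)%:E)%E b0 => [b| |] // b0.
  move: (\int[P]_w (dl t.+1 w)%:E)%E a0 => [a| |] // a0; rewrite ?lee_fin.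
  move=> hb hab.
  apply: (@le_trans _ _ ((1 - gamma) * b)); first by rewrite mulrBl mul1r lerBrDr.
  by rewrite ler_wpM2l.
have -> : (\int[P]_w (theta t.+1 w)%:E = \int[P]_w (dl t.+1 w)%:E +
    \int[P]_w (2 * N * (M * lm t.+1 w))%:E)%E.
  rewrite -ge0_integralD //.
  - by move=> w _; rewrite lee_fin; exact: dl0.
  - by apply/measurable_EFinP; exact: measurable_dl.
  - by move=> w _; rewrite lee_fin; exact: w0.
  - apply/measurable_EFinP; apply: measurable_funM; first exact: measurable_cst.
    by apply: measurable_funM; [exact: measurable_cst|exact: measurable_lm].
apply: le_trans (leeD a_le l_le) _; rewrite -EFinD lee_fin.
have -> : (1 - gamma) * ((1 + s_ t) ^+ 2 * C) + (1 - gamma) * (2 * s_ t * (1 + s_ t) ^+ 2) * C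
  = (1 - gamma) * ((1 + s_ t) ^+ 2 * (1 + 2 * s_ t)) * C by ring.
rewrite ler_wpM2r // ler_wpM2l //.
have -> : 4 * s_ t = 2%:R * s_ t + 2 * s_ t by rewrite -mulrDl; congr (_ * _); ring.
rewrite expRD expRM_natl; apply: ler_pM; rewrite ?sqr_ge0 ?expR_ge1Dx //.
  by rewrite addr_ge0 // mulr_ge0.
  by rewrite ler_pXn2r ?nnegrE ?expR_ge0 ?addr_ge0 ?expR_ge1Dx.
by rewrite -expRM_natl expR_ge1Dx.
Qed.

(** The exponents 4 s_t telescope to 4 / 5 (1 - rho^t). *)
Lemma expected_theta t : (\int[P]_w (theta t w)%:E <=
  ((1 - gamma) ^+ t * expR (4 / 5 * (1 - rho ^+ t)) *
     (delta0 + 2 * N * (M * lambda_under F x0)))%:E)%E.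
Proof.
elim: t => [|t IH].
  rewrite expr0 mul1r expr0 subrr mulr0 expR0 mul1r.
  under eq_integral do rewrite theta_init.
  by rewrite integral_prob_cst.
apply: le_trans (theta_step IH) _; rewrite lee_fin.
rewrite le_eqVlt; apply/orP; left; apply/eqP.
have -> : expR (4 / 5 * (1 - rho ^+ t.+1)) =
    expR (4 * s_ t) * expR (4 / 5 * (1 - rho ^+ t)).
  rewrite -expRD; congr expR; rewrite exprS /s_ {1}/rho.
  by field; rewrite gt_eqF // (lt_le_trans _ eta1).
move: (expR (4 * s_ t)) (expR _) (delta0 + _) => a b c.
by rewrite exprS; ring.
Qed.

(** * Bounds in expectation and with high probability *)

Let B := delta0 + 7 * (1 - gamma) / (20 * eta0).
Let q := q_under gamma delta0 eta0.

Let e0 : 0 < eta0. Proof. exact: lt_le_trans eta1. Qed.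
Let delta00 : 0 <= delta0. Proof. exact: (dl0 0 point). Qed.
Let g10 : 0 <= 1 - gamma. Proof. by rewrite subr_ge0. Qed.
Let B0 : 0 <= B.
Proof.
apply: addr_ge0 delta00 _; apply: divr_ge0.
  exact: mulr_ge0 (ler0n _ 7) g10.
exact: mulr_ge0 (ler0n _ 20) (ltW e0).
Qed.
Lemma q_ge0 : 0 <= q. Proof. exact: mulr_ge0 (expR_ge0 _) B0. Qed.

Lemma expected_theta_le t :
  (\int[P]_w (theta t w)%:E <= ((1 - gamma) ^+ t * (expR (4 / 5) * B))%:E)%E.
Proof.
have rho0 : 0 <= rho.
  have := rho_bounds n0 L0 mu0 JL Jmu Ox0 HG0; rewrite -/eta0 -/rho => /andP[h _].
  by apply: le_trans h; apply: divr_ge0.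
apply: le_trans (expected_theta t) _; rewrite lee_fin -mulrA.
apply: ler_wpM2l; first exact: exprn_ge0.
have i0 : 0 <= 2 * N * (M * lambda_under F x0) by exact: (w0 0 point).
apply: ler_pM; [exact: expR_ge0|exact: addr_ge0 delta00 i0| |].
  by rewrite ler_expR; have := exprn_ge0 t rho0; lra.
rewrite lerD2l -mulrA.
have := lambda0_weight n0 L0 L20 mu0 JL Jmu Ox0 HG0 small; rewrite -/N -/M -/gamma -/eta0.
have -> : 7 * (1 - gamma) / (20 * eta0) = 7 / 2 * ((1 - gamma) / (10 * eta0)).
  by field; rewrite gt_eqF.
have : 0 <= (1 - gamma) / (10 * eta0).
  by apply: divr_ge0 g10 (mulr_ge0 (ler0n _ 10) (ltW e0)).
move: ((1 - gamma) / (10 * eta0)) (N * (M * lambda_under F x0)) => a b; lra.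
Qed.

Let step_factor0 t w : 0 <= step_factor t w.
Proof.
apply: mulr_ge0.
  exact: addr_ge0 ler01 (divr_ge0 (ml0 t w) (ler0n _ 2)).
exact: addr_ge0 (dl0 t w) (divr_ge0 (ml0 t w) (ler0n _ 4)).
Qed.

Let measurable_step_factor t : measurable_fun [set: T] (step_factor t).
Proof.
have ml : measurable_fun [set: T] (fun w => M * lm t w).
  by apply: measurable_funM; [exact: measurable_cst|exact: measurable_lm].
apply: measurable_funM; apply: measurable_funD.
- exact: measurable_cst.
- by apply: measurable_funM; [exact: ml|exact: measurable_cst].
- exact: measurable_dl.
- by apply: measurable_funM; [exact: ml|exact: measurable_cst].
Qed.

Let expected_step_factor t :
  (\int[P]_w (step_factor t w)%:E <= ((1 - gamma) ^+ t * q)%:E)%E.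
Proof.
have st0 := s0 t.
apply: (@le_trans _ _ (\int[P]_w ((1 + s_ t) * theta t w)%:E)%E).
  by apply: integral_mono => w; [exact: step_factor0|exact: step_factor_le].
under eq_integral do rewrite EFinM.
rewrite ge0_integralZl_EFin; first last.
- exact: addr_ge0 ler01 st0.
- by apply/measurable_EFinP; exact: measurable_theta.
- by move=> w _; rewrite lee_fin.
- exact: measurableT.
have se : 1 + s_ t <= expR (1 / 10).
  apply: le_trans (expR_ge1Dx _) _; rewrite ler_expR /s_.
  have := rho_bounds n0 L0 mu0 JL Jmu Ox0 HG0; rewrite -/eta0 -/rho => /andP[h1 h2].
  have r0 : 0 <= rho by lra.
  have : rho ^+ t <= 1 by apply: exprn_ile1 => //; exact: ltW.
  have e10 : 10 <= 10 * eta0 by have := eta1; lra.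
  move=> h; apply: ler_pM => //; first exact: exprn_ge0.
    by rewrite invr_ge0; lra.
  by rewrite lef_pV2 ?posrE //; lra.
apply: (@le_trans _ _ ((1 + s_ t)%:E * ((1 - gamma) ^+ t * (expR (4 / 5) * B))%:E)%E).
  by apply: lee_wpmul2l; [rewrite lee_fin addr_ge0|exact: expected_theta_le].
rewrite -EFinM lee_fin mulrCA; apply: ler_wpM2l; first exact: exprn_ge0.
rewrite mulrA /q /q_under -/B; apply: ler_wpM2r; first exact: B0.
apply: (@le_trans _ _ (expR (1 / 10) * expR (4 / 5))).
  by apply: ler_wpM2r => //; exact: expR_ge0.
by rewrite -expRD ler_expR; lra.
Qed.

(** The ratio eta_t need not be known to be measurable: integrals of nonnegative
    functions are monotone anyway. *)
Lemma expected_eta t :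
  ('E_P[(fun w => loewner_ratio (st t w).2 (gram F (st t w).1) - 1)%R] <=
     ((1 - gamma) ^+ t * q)%:E)%E.
Proof.
rewrite expectationE.
apply: (@le_trans _ _ (\int[P]_w (theta t w)%:E)%E).
  apply: integral_mono => w.
    rewrite subr_ge0; apply: loewner_ratio_ge1; first exact: n0.
      apply: (gram_spd n0 L0 mu0 JL Jmu).
      exact: (path_in n0 dF L0 L20 mu0 JL JLip Jmu Ox0 HG0 small).
    exact: (path_lower n0 dF L0 L20 mu0 JL JLip Jmu Ox0 HG0 small).
  apply: (@le_trans _ _ (dl t w)).
    exact: (path_ratio_le n0 dF L0 L20 mu0 JL JLip Jmu Ox0 HG0 small).
  by rewrite /theta lerDl.
apply: le_trans (expected_theta_le t) _; rewrite lee_fin.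
apply: ler_wpM2l; first exact: exprn_ge0.
by apply: ler_wpM2r; [exact: B0|rewrite ler_expR; lra].
Qed.

Lemma expected_ratio t :
  ('E_P[(fun w => lm t.+1 w / lm t w)%R] <= ((1 - gamma) ^+ t * q)%:E)%E.
Proof.
rewrite expectationE; apply: le_trans (expected_step_factor t).
apply: integral_mono => w; first exact: divr_ge0.
have [e|h] := eqVneq (lm t w) 0; first by rewrite e invr0 mulr0 step_factor0.
by rewrite ler_pdivrMr ?lm_step // lt_neqAle eq_sym h lm0.
Qed.

Lemma ae_bounds : {ae P, forall w, forall t, spd (gram F (st t w).1) /\
  loewner (gram F (st t w).1) (st t w).2}.
Proof.
apply: aeW => w t; split.
  apply: (gram_spd n0 L0 mu0 JL Jmu).
  exact: (path_in n0 dF L0 L20 mu0 JL JLip Jmu Ox0 HG0 small).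
exact: (path_lower n0 dF L0 L20 mu0 JL JLip Jmu Ox0 HG0 small).
Qed.

Lemma superlinear_lambda p : 0 < p -> exists t0 : nat,
  t0%:R <= (2 + (ln (3 / 2))^-1) * (ln (1 + q / (p * gamma ^+ 2)) / gamma) /\
  ((1 - p)%:E <= P [set w | forall t : nat, (1 <= t)%N ->
     (lm (t0 + t)%N w <= (1 - gamma / (gamma + 1)) ^+ ((t * (t - 1)) %/ 2) *
        (1 / 2) ^+ t * rho ^+ t0 * lambda_under F x0)%R])%E.
Proof.
move=> p0; apply: (@superlinear_whp _ _ _ _ step_factor lm).
- by rewrite g0 g1.
- exact: q_ge0.
- exact: p0.
- exact: measurable_step_factor.
- exact: step_factor0.
- exact: measurable_lm.
- exact: lm0.
- exact: lm_step.
- move=> t w.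
  by have [_ _ _] := path_invariant n0 dF L0 L20 mu0 JL JLip Jmu Ox0 HG0 small (u ^~ w) (K ^~ w) t.
- exact: expected_step_factor.
Qed.

End Stochastic.

Theorem theorem17 (R : realType) :
  exists C : R, 0 < C /\
  forall (n d : nat) (F : 'cV[R]_d -> 'cV[R]_n) (L L2 mu : R)
    (opt : rqgn_option) (x0 : 'cV[R]_d) (G0 : 'M[R]_n)
    (disp : measure_display) (T : measurableType disp) (P : probability T R)
    (u : nat -> T -> 'cV[R]_n) (K : nat -> T -> 'M[R]_n),
  let H0 := gram F x0 in
  let M := 2 * L * L2 / mu ^+ 2 in
  let st t w := rqgn opt F M x0 G0 (u ^~ w) (K ^~ w) t in
  let x t w := (st t w).1 in
  let G t w := (st t w).2 in
  let H t w := gram F (x t w) in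
  let lam t w := lambda_under F (x t w) in
  let eta t w := loewner_ratio (G t w) (H t w) in
  let eta0 := loewner_ratio G0 H0 in
  let gamma := rqgn_gamma opt n mu L in
  let q := q_under gamma (rqgn_delta0 opt mu L G0 H0) eta0 in
  (0 < n)%N -> (n < d)%N ->
  (forall y, differentiable F y) ->
  0 < L -> 0 < L2 ->
  (forall y, spectral_norm (jac F y) <= L) ->
  (forall y z, spectral_norm (jac F y - jac F z) <= L2 * enorm (y - z)) ->
  0 < mu ->
  Omega_under F mu L2 !=set0 ->
  (forall y, Omega_under F mu L2 y -> mu <= sing_val n (jac F y)) ->
  Omega_under F mu L2 x0 ->
  spd G0 -> loewner H0 G0 ->
  (forall t, std_gaussian P (u t)) -> indep_of_past P u ->
  (opt = OptionII ->
     determined_by_past u K /\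
     {ae P, forall w, forall t,
        invmx (rqgn_scaled_G F M (st t w)) = (K t w)^T *m K t w}) ->
  lambda_under F x0 <=
    mu ^+ 2 * (1 - gamma) /
      (20 * rqgn_ctilde opt mu L * n%:R * L * L2 * eta0) ->
  [/\ {ae P, forall w, forall t, spd (H t w) /\ loewner (H t w) (G t w)},
      forall t,
        ('E_P[(fun w => eta t w - 1)%R] <= ((1 - gamma) ^+ t * q)%:E)%E,
      forall t,
        (* a / 0 = 0: the ratio is 0 where its denominator vanishes *)
        ('E_P[(fun w => lam t.+1 w / lam t w)%R] <= ((1 - gamma) ^+ t * q)%:E)%E &
      forall p : R, 0 < p < 1 ->
        exists t0 : nat,
          t0%:R <= C * (ln (1 + q / (p * gamma ^+ 2)) / gamma) /\
          ((1 - p)%:E <=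
           P [set w | forall t : nat, (1 <= t)%N ->
                (lam (t0 + t)%N w <=
                  (1 - gamma / (gamma + 1)) ^+ ((t * (t - 1)) %/ 2) *
                  (1 / 2) ^+ t * (1 - 1 / (2 * eta0)) ^+ t0 *
                  lambda_under F x0)%R])%E].
Proof.
have C0 : 0 < 2 + (ln (3 / 2 : R))^-1.
  by rewrite addr_gt0 // invr_gt0; apply: ln_gt0; lra.
exists (2 + (ln (3 / 2 : R))^-1); split; first exact: C0.
move=> n d F L L2 mu opt x0 G0 disp T P u K H0 M st x G H lam eta eta0 gamma q.
move=> n0 _ dF L0 L20 JL JLip mu0 _ Jmu Ox0 _ HG0 gauss indep factor small.
split.
- exact: (ae_bounds P u K n0 dF L0 L20 mu0 JL JLip Jmu Ox0 HG0 small).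
- exact: (expected_eta n0 dF L0 L20 mu0 JL JLip Jmu Ox0 HG0 small gauss indep factor).
- exact: (expected_ratio n0 dF L0 L20 mu0 JL JLip Jmu Ox0 HG0 small gauss indep factor).
move=> p /andP[p0 _].
exact: (superlinear_lambda n0 dF L0 L20 mu0 JL JLip Jmu Ox0 HG0 small gauss indep factor p0).
Qed.
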